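(* Let $n>m\ge1$, $R>1$, and let $F:C_{R+1}\to\mathbb{R}^m$ be a continuous Gaussian random field satisfying the $(R;M,k_1,k_2)$-assumptions on $C_{R+1}$. Then there are constants $D_2=D_2(n,m,M,k_1,k_2)>0$ and $q=q(n,m)>1$ such that $\mathcal{E}\big((N(R;F))^q\big)\le D_2\cdot|C_R|^q$.
   Context: $C_R=(-R,R)^n$. Write $F=(f_1,\dots,f_m)$, $K_{i_1i_2}(x,y)=\mathcal{E}(f_{i_1}(x)f_{i_2}(y))$. The $(R;M,k_1,k_2)$-assumptions: (A1) $F$ centered and $\mathcal{E}|\sum_i\eta_if_i(x)+\sum_{i,j}\xi_{ij}\partial_jf_i(x)|^2\ge k_1>0$ for all $x\in C_{R+1}$ and unit $(\eta,\xi)\in\mathbb{R}^m\times\mathbb{R}^{nm}$; (A2) $F$ a.s. $C^{3-}=\bigcap_{0<\beta<1}C^{2+\beta}$ on $C_{R+1}$ and $\max_{0\le|\alpha|\le3}\sup_{x\in C_{R+1}}|D_x^\alpha D_y^\alpha K_{i_1i_2}(x,y)|_{y=x}|\le M$; (A3) for distinct $x,y\in C_R$, $(F(x),F(y))$ has non-degenerate distribution with density at $(0,0)$ at most $k_2/\|x-y\|^m$ if $\|x-y\|\le1$ and at most $k_2$ if $\|x-y\|>1$. $N(R;F)$ is the number of connected components of $F^{-1}(0)$ fully contained in $C_R$. *)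

(* Defs.v *)
From HB Require Import structures.
From mathcomp Require Import all_boot all_order all_algebra.
From mathcomp Require Import all_classical all_reals all_analysis.
Set Implicit Arguments. Unset Strict Implicit. Unset Printing Implicit Defensive.
Import Order.TTheory GRing.Theory Num.Theory.
Import numFieldNormedType.Exports.
Local Open Scope classical_set_scope.
Local Open Scope ring_scope.

Section Defs.
Context {R : realType} {n : nat}.

Definition ev (j : 'I_n) : 'rV[R]_n := delta_mx 0 j.

Definition cube (r : R) : set 'rV[R]_n := [set x | forall j, - r < x 0 j < r].

Definition enorm (x : 'rV[R]_n) : R := Num.sqrt (\sum_j x 0 j ^+ 2).

Definition pd (j : 'I_n) (g : 'rV[R]_n -> R^o) : 'rV[R]_n -> R^o :=
  fun x => 'D_(ev j) g x.

Definition pds (s : seq 'I_n) (g : 'rV[R]_n -> R^o) : 'rV[R]_n -> R^o :=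
  foldr pd g s.

Fixpoint pds_ok (U : set 'rV[R]_n) (s : seq 'I_n) (g : 'rV[R]_n -> R^o) : Prop :=
  match s with
  | [::] => True
  | j :: s' => pds_ok U s' g /\ forall x, U x -> derivable (pds s' g) x (ev j)
  end.

(* multi-indices alpha of order |alpha| = size s, encoded as nondecreasing lists *)
Definition multi_index (s : seq 'I_n) : bool := sorted (fun i j : 'I_n => (i <= j)%N) s.

Definition loc_holder (U : set 'rV[R]_n) (beta : R) (h : 'rV[R]_n -> R) : Prop :=
  forall x, U x -> exists2 rho : R, 0 < rho & exists L : R, forall y z,
    U y -> U z -> enorm (y - x) < rho -> enorm (z - x) < rho ->
    `|h y - h z| <= L * powR (enorm (y - z)) beta.

Definition C3minus (U : set 'rV[R]_n) (g : 'rV[R]_n -> R^o) : Prop :=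
  (forall s : seq 'I_n, (size s <= 2)%N ->
     pds_ok U s g /\ forall x, U x -> {for x, continuous (pds s g)}) /\
  (forall beta : R, 0 < beta < 1 -> forall s : seq 'I_n, size s = 2%N ->
     loc_holder U beta (pds s g)).

End Defs.

Section Random.
Context {R : realType} {n m : nat} {d : measure_display} {T : measurableType d}.
Variable P : probability T R.
Local Open Scope ereal_scope.

Definition gaussian_rv (X : T -> R) : Prop :=
  measurable_fun setT X /\ exists mu s : R, forall A : set R, measurable A ->
    P (X @^-1` A) = if s == 0%R then \d_mu A else normal_prob mu s A.

Definition Ex (X : T -> R) : R := fine (\int[P]_w (X w)%:E).

Variable F : T -> 'rV[R]_n -> 'rV[R]_m.
Definition fc (i : 'I_m) (w : T) : 'rV[R]_n -> R^o := fun x => F w x ord0 i.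

Definition gaussian_field (U : set 'rV[R]_n) : Prop :=
  forall (k : nat) (c : 'I_k -> R) (idx : 'I_k -> 'I_m) (pts : 'I_k -> 'rV[R]_n),
    (forall j, U (pts j)) ->
    gaussian_rv (fun w => (\sum_j c j * F w (pts j) ord0 (idx j))%R).

Definition as_continuous (U : set 'rV[R]_n) : Prop :=
  {ae P, forall w, forall x, U x -> {for x, continuous (F w)}}.

Definition cov_kernel (i1 i2 : 'I_m) (x y : 'rV[R]_n) : R :=
  Ex (fun w => fc i1 w x * fc i2 w y)%R.

Definition assumption_A1 (r k1 : R) : Prop :=
  (forall (i : 'I_m) x, cube (r + 1) x -> Ex (fun w => fc i w x) = 0%R) /\
  forall x, cube (r + 1) x ->
  forall (eta : 'I_m -> R) (xi : 'I_m -> 'I_n -> R),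
    (\sum_i eta i ^+ 2 + \sum_i \sum_j xi i j ^+ 2)%R = 1%R ->
    \int[P]_w ((\sum_i eta i * fc i w x
                + \sum_i \sum_j xi i j * pd j (fc i w) x) ^+ 2)%:E >= k1%:E.

Definition DyK (s : seq 'I_n) (i1 i2 : 'I_m) (x y : 'rV[R]_n) : R :=
  pds s (fun y' => cov_kernel i1 i2 x y') y.
Definition DxDyK (s : seq 'I_n) (i1 i2 : 'I_m) (x y : 'rV[R]_n) : R :=
  pds s (fun x' => DyK s i1 i2 x' y) x.

Definition assumption_A2 (r M : R) : Prop :=
  {ae P, forall w, forall i, C3minus (cube (r + 1)) (fc i w)} /\
  forall (i1 i2 : 'I_m) (s : seq 'I_n), multi_index s -> (size s <= 3)%N ->
    (forall x, cube (r + 1) x -> pds_ok (cube (r + 1)) s (cov_kernel i1 i2 x)) /\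
    (forall y, cube (r + 1) y ->
        pds_ok (cube (r + 1)) s (fun x' => DyK s i1 i2 x' y)) /\
    (forall x, cube (r + 1) x -> (`|DxDyK s i1 i2 x x| <= M)%R).

Definition cov2 (x y : 'rV[R]_n) : 'M[R]_(m + m) :=
  \matrix_(a, b) Ex (fun w => (row_mx (F w x) (F w y)) ord0 a
                               * (row_mx (F w x) (F w y)) ord0 b)%R.

(* value at (0,0) of the density of the centered non-degenerate Gaussian
   vector (F(x), F(y)) : (2 pi)^{-m} det(Sigma)^{-1/2} *)
Definition density00 (x y : 'rV[R]_n) : R :=
  (Num.sqrt ((pi *+ 2) ^+ (m + m) * \det (cov2 x y)))^-1.

Definition assumption_A3 (r k2 : R) : Prop :=
  forall x y, cube r x -> cube r y -> x != y ->
    \det (cov2 x y) != 0%R /\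
    (density00 x y <= (if enorm (x - y) <= 1 then k2 / enorm (x - y) ^+ m
                       else k2))%R.

Definition assumptions (r M k1 k2 : R) : Prop :=
  gaussian_field (cube (r + 1)) /\ as_continuous (cube (r + 1)) /\
  assumption_A1 r k1 /\ assumption_A2 r M /\ assumption_A3 r k2.

Definition zero_set (r : R) (w : T) : set 'rV[R]_n :=
  [set x | cube (r + 1) x /\ F w x = 0%R].

Definition inner_components (r : R) (w : T) : set (set 'rV[R]_n) :=
  [set C | exists x, zero_set r w x /\ C = connected_component (zero_set r w) x
                     /\ C `<=` cube r].

Definition Ncomp (r : R) (w : T) : \bar R :=
  ereal_sup [set (k%:R)%:E | k in [set k : nat | exists c : 'I_k -> set 'rV[R]_n,
                 injective c /\ forall j, inner_components r w (c j)]].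

End Random.

(* Main.v *)
(** Consider grids of spacing [b^-k], [b = 2^D], and the tolerance
    [tol k = 2^k b^-k]. In a unit box, if from level [k] on the first derivatives
    of [F] differ by at most the tolerance between neighbouring grid points, then
    by chaining they oscillate little at distance [b^-k]; if moreover [DF] is onto
    at a zero [x] with a margin comparable to [tol k], every zero within [b^-k] of
    [x] is joined to [x] inside the zero set. A component of the zero set can thus
    be charged to one grid cell at the first level [k] where this happens, and at
    that cell the previous level fails: the derivatives jump between neighbours,
    or are large, or [F] and some combination [u . DF] are small simultaneously.

    Limits of the field stay in a Gaussian Hilbert space, where even moments are
    controlled by the variance and a nondegenerate [N]-tuple is [alpha]-small with
    probability [O(alpha^N)]. The covariance bounds make the derivatives Lipschitz
    in mean square, so a given cell is bad with probability [O(b^(-kn) 16^-k)]. If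
    [X k] is the number of bad cells of level [k], then [X k <= A b^(kn)] with [A] of
    the order of [|C_R|], and for [e = 1/(D n)] one has
    [(sum X k)^(1+e) <= 4 A^e (sum 8^k X k)], whose mean is [O(A^(1+e))]. *)
Require Import Defs.
From HB Require Import structures.
From mathcomp Require Import all_boot all_order all_algebra.
From mathcomp Require Import all_classical all_reals all_analysis.
From mathcomp Require Import measurable_realfun ring lra zify.
Import Order.TTheory GRing.Theory Num.Theory.
Import numFieldNormedType.Exports.
Local Open Scope classical_set_scope.
Local Open Scope ring_scope.

(* The library does not join completeness with the norm of matrices. *)
HB.instance Definition _ (R : realType) (m n : nat) := Complete.on 'M[R]_(m, n).

(** The exponents rest on a dimension count. A degenerate zero satisfies [m + n] equations, [F = 0]
    and [u . DF = 0], while the point has [n] parameters and the direction [u] has [m - 1], so one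
    factor [b^-k] is left over. The depth [D] makes it outweigh the factors [2^k] lost through the
    tolerances, with [16^-k] to spare. A tolerance exceeding the spacing by [2^k] puts roughness far
    into the Gaussian tail: a high enough moment beats the number of neighbouring pairs, so that
    mean square bounds on second derivatives replace uniform control of the random ones on a box. A
    sample whose bad cells never stop only makes the majorant infinite there, and the finite
    integral of the majorant takes care of it. The gain in the exponent is as small as [1/(D n)]
    because the only sure bound on [X k] is the number of cells. Gaussianity is assumed of the
    values of [F]. Its derivatives are pointwise limits of difference quotients, and for centered
    Gaussian variables pointwise convergence forces mean square convergence, since
    [E cos X = exp(- E X^2 / 2)]. *)

(** * Mean value estimates along coordinate paths *)

Section LineCalculus.
Context {R : realType} {n : nat}.
Implicit Types (u v w x y : 'rV[R]_n) (f : 'rV[R]_n -> R^o) (U : set 'rV[R]_n).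

Lemma is_derive_line f u v (t : R) :
  derivable f (t *: v + u) v ->
  is_derive t (1:R) (fun s : R => f (s *: v + u) : R^o) ('D_v f (t *: v + u)).
Proof.
move=> df.
have E : (fun h : R => h^-1 *: (((fun s : R => f (s *: v + u) : R^o) \o shift t) (h *: (1:R)) - f (t *: v + u))) =
         (fun h : R => h^-1 *: ((f \o shift (t *: v + u)) (h *: v) - f (t *: v + u))).
  apply/funext => h /=; congr (_ *: (f _ - _)).
  by rewrite addrA -scalerDl; congr (_ *: _ + _); rewrite /GRing.scale/= mulr1.
split; first by rewrite /derivable E.
by rewrite /derive E.
Qed.

Lemma coord_mvt f u v (h c eta : R) :
  (forall t, (0 <= t <= h) || (h <= t <= 0) ->
     derivable f (t *: v + u) v /\ `|'D_v f (t *: v + u) - c| <= eta) ->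
  `|f (h *: v + u) - f u - h * c| <= eta * `|h|.
Proof.
move=> H.
pose phi := fun s : R => f (s *: v + u) : R^o.
pose dphi := fun s : R => 'D_v f (s *: v + u).
have der t : (0 <= t <= h) || (h <= t <= 0) -> is_derive t (1:R) phi (dphi t).
  by move=> /H[? _]; exact: is_derive_line.
have phi0 : f u = phi 0 by rewrite /phi scale0r add0r.
rewrite phi0 -/(phi h).
have [h0|h0] := leP 0 h.
  have [| |t] := @MVT_segment _ phi dphi 0 h h0.
  - move=> x; rewrite in_itv/= => /andP[x0 xh]; apply: der.
    by rewrite (ltW x0) (ltW xh).
  - apply: derivable_within_continuous => x; rewrite in_itv/= => xh.
    by have [] := der x; rewrite ?xh.
  rewrite in_itv/= => th -> ; rewrite subr0.
  have [|_ b] := H t; first by rewrite th.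
  by rewrite mulrC -mulrBr normrM mulrC; apply: ler_wpM2r.
have [| |t] := @MVT_segment _ phi dphi h 0 (ltW h0).
- move=> x; rewrite in_itv/= => /andP[x0 xh]; apply: der.
  by rewrite (ltW x0) (ltW xh) orbT.
- apply: derivable_within_continuous => x; rewrite in_itv/= => xh.
  by have [] := der x; rewrite ?xh ?orbT.
rewrite in_itv/= => th E.
have [|_ b] := H t; first by rewrite th orbT.
have -> : phi h - phi 0 = dphi t * h by rewrite -[LHS]opprB E sub0r mulrN opprK.
by rewrite mulrC -mulrBr normrM mulrC; apply: ler_wpM2r.
Qed.

(** Contains with any two points the coordinate box they span. Ordinary convexity would not do,
    since the paths below run parallel to the axes, along which the partial derivatives are
    known. *)
Definition box_convex U := forall u v w, U u -> U v ->
  (forall j, (u 0 j <= w 0 j <= v 0 j) || (v 0 j <= w 0 j <= u 0 j)) -> U w.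

(* Moves from [u] to [v] one coordinate at a time. *)
Lemma box_path U (rho : 'rV[R]_n -> 'rV[R]_n -> R) (eta : R) :
  box_convex U -> (forall u, rho u u <= 0) ->
  (forall u v w, U u -> U v -> U w -> rho u w <= rho u v + rho v w) ->
  (forall u j h, U u -> U (h *: ev j + u) -> rho u (h *: ev j + u) <= eta * `|h|) ->
  forall u v, U u -> U v -> rho u v <= eta * \sum_j `|v 0 j - u 0 j|.
Proof.
move=> cU rho0 tri step u v Uu Uv.
pose w (k : nat) : 'rV[R]_n := \row_j (if (j < k)%N then v 0 j else u 0 j).
have Uw k : U (w k).
  apply: (cU u v) => // j; rewrite mxE; case: ifP => _; rewrite !lexx/= ?andbT.
    by rewrite le_total.
  by rewrite le_total.
have H k : (k <= n)%N -> rho u (w k) <= eta * \sum_(j < n | (j < k)%N) `|v 0 j - u 0 j|.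
  elim: k => [_|k IH kn].
    have -> : w 0 = u by apply/rowP => j; rewrite mxE.
    by rewrite big_pred0 ?mulr0.
  apply: (le_trans (tri _ (w k) _ Uu (Uw _) (Uw _))).
  pose jk := Ordinal kn.
  have wE : w k.+1 = (v 0 jk - u 0 jk) *: ev jk + w k.
    apply/rowP => j; rewrite !mxE eqxx/= ltnS leq_eqVlt.
    have [->|jk'] := eqVneq j jk; first by rewrite eqxx/= ltnn mulr1 subrK.
    have -> : (j == k :> nat) = false by apply/negbTE/eqP => E; move/eqP: jk'; apply; apply/val_inj.
    by rewrite /= mulr0 add0r.
  have -> : \sum_(j < n | (j < k.+1)%N) `|v 0 j - u 0 j| =
     \sum_(j < n | (j < k)%N) `|v 0 j - u 0 j| + `|v 0 jk - u 0 jk|.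
    rewrite (bigD1 jk)/= ?ltnS// addrC; congr (_ + _); apply: eq_bigl => j.
    rewrite ltnS leq_eqVlt -(inj_eq val_inj)/=.
    by have [->|] := eqVneq (j : nat) k; rewrite ?ltnn ?andbT.
  rewrite mulrDr; apply: lerD; first exact: IH (ltnW kn).
  by rewrite wE; apply: step => //; rewrite -wE.
have E : w n = v by apply/rowP => j; rewrite mxE ltn_ord.
have := H n (leqnn _); rewrite E (eq_bigl xpredT)// => j; exact: ltn_ord.
Qed.

(** The defect of the linear approximation is subadditive along a path, so the one-coordinate case,
    which is the mean value inequality, is enough. *)
Lemma box_linearization U f (c : 'I_n -> R) (eta : R) :
  box_convex U ->
  (forall j x, U x -> derivable f x (ev j) /\ `|'D_(ev j) f x - c j| <= eta) ->
  forall u v, U u -> U v ->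
  `|f v - f u - \sum_j (v 0 j - u 0 j) * c j| <= eta * \sum_j `|v 0 j - u 0 j|.
Proof.
move=> cU df.
apply: (@box_path U (fun u v => `|f v - f u - \sum_j (v 0 j - u 0 j) * c j|)) => //.
- by move=> u; rewrite subrr sub0r normrN big1 ?normr0// => j _; rewrite subrr mul0r.
- move=> u v w _ _ _; 
  suff -> : f w - f u - \sum_j (w 0 j - u 0 j) * c j =
     (f v - f u - \sum_j (v 0 j - u 0 j) * c j) +
     (f w - f v - \sum_j (w 0 j - v 0 j) * c j) by exact: ler_normD.
  rewrite addrACA [X in _ = X + _](_ : _ = (f w - f u)%R); last first.
    by rewrite addrC addrA subrK.
  congr (_ + _); rewrite -opprD -big_split/=; congr (- _).
  by apply: eq_bigr => j _; ring.
- move=> u j h Uu Uv.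
  have -> : \sum_j0 ((h *: ev j + u) 0 j0 - u 0 j0) * c j0 = h * c j.
    rewrite (bigD1 j)//= big1 ?addr0 => [|i ij]; rewrite !mxE addrK eqxx/=.
      by rewrite eqxx mulr1.
    by rewrite (negbTE ij) mulr0 mul0r.
  apply: coord_mvt => t th; apply: df; apply: (cU u (h *: ev j + u)) => // i.
  rewrite !mxE eqxx/=; case: eqVneq => [->|ij]; last by rewrite !mulr0 !add0r lexx.
  by rewrite !mulr1 lerDr gerDr !lerD2r.
Qed.

End LineCalculus.

(** * Joining nearby zeros where the derivative is onto *)

Section ZeroSetPath.
Context {R : realType}.

Lemma mx_norm_le {p q} (A : 'M[R]_(p, q)) (e : R) :
  0 <= e -> (forall i j, `|A i j| <= e) -> `|A| <= e.
Proof.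
by move=> e0 H; rewrite /Num.norm/= mx_normrE; apply/bigmax_leP; split => // -[i j] _; exact: H.
Qed.

Lemma mx_entry_le {p q} (A : 'M[R]_(p, q)) i j : `|A i j| <= `|A|.
Proof.
by rewrite [leRHS]/Num.norm/= mx_normrE; apply/bigmax_geP; right; exists (i, j).
Qed.

Lemma mx_norm_tr {p q} (A : 'M[R]_(p, q)) : `|A^T| = `|A|.
Proof.
apply/eqP; rewrite eq_le; apply/andP; split; apply: mx_norm_le => // i j.
  by rewrite mxE; exact: mx_entry_le.
by have := mx_entry_le A^T j i; rewrite mxE.
Qed.

Lemma mulmx_norm_le {p q r} (A : 'M[R]_(p, q)) (B : 'M[R]_(q, r)) :
  `|A *m B| <= q%:R * (`|A| * `|B|).
Proof.
apply: mx_norm_le => [|i j]; first by rewrite mulr_ge0// mulr_ge0.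
rewrite mxE; apply: le_trans (ler_norm_sum _ _ _) _.
rewrite mulr_natl -[X in _ *+ X]card_ord -sumr_const; apply: ler_sum => k _.
by rewrite normrM ler_pM// mx_entry_le.
Qed.

(** [B] is the Moore-Penrose inverse [(J^T J)^-1 J^T]. With [S = J^T J] and [w = v S^-1] one has
    [|v B| = |J w|] and [|J w|^2 <= v . w <= m |v| |w| <= (m / tau) |v| |J w|]; the factor [m] is
    the price of the sup norm. *)
Lemma bounded_right_inverse {n m} (J : 'M[R]_(n, m)) (tau : R) : 0 < tau ->
  (forall u : 'cV[R]_m, tau * `|u| <= `|J *m u|) ->
  exists2 B : 'M[R]_(m, n), B *m J = 1%:M &
    forall v : 'rV[R]_m, `|v *m B| <= m%:R / tau * `|v|.
Proof.
move=> tau0 HJ; pose S := J^T *m J.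
have sq (w : 'rV[R]_m) : `|J *m w^T| ^+ 2 <= (w *m S *m w^T) 0 0.
  have -> : (w *m S *m w^T) 0 0 = \sum_i ((J *m w^T) i 0) ^+ 2.
    have -> : w *m S *m w^T = (J *m w^T)^T *m (J *m w^T).
      by rewrite trmx_mul trmxK /S !mulmxA.
    by rewrite mxE; apply: eq_bigr => i _; rewrite mxE expr2.
  have s0 : 0 <= \sum_i ((J *m w^T) i 0) ^+ 2 by apply: sumr_ge0 => i _; exact: sqr_ge0.
  rewrite -[leRHS]sqr_sqrtr// ler_pXn2r ?nnegrE ?sqrtr_ge0//.
  apply: mx_norm_le => [|i j]; first exact: sqrtr_ge0.
  rewrite ord1 -sqrtr_sqr ler_sqrt// (bigD1 i)//= lerDl.
  by apply: sumr_ge0 => k _; exact: sqr_ge0.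
have low (w : 'rV[R]_m) : tau * `|w| <= `|J *m w^T| by rewrite -[`|w|]mx_norm_tr.
have Su : S \in unitmx.
  rewrite -row_free_unit; apply: inj_row_free => w wS0.
  have := sq w; rewrite wS0 mul0mx mxE => H.
  have Jw : `|J *m w^T| = 0.
    by apply/eqP; rewrite -sqrf_eq0 eq_le H sqr_ge0.
  have := low w; rewrite Jw pmulr_rle0// => w0.
  by apply/eqP; rewrite -normr_eq0 eq_le w0 normr_ge0.
exists (invmx S *m J^T); first by rewrite -mulmxA mulVmx.
move=> v; pose w := v *m invmx S.
have wv : w *m S = v by rewrite mulmxKV.
have -> : `|v *m (invmx S *m J^T)| = `|J *m w^T|.
  by rewrite -[RHS]mx_norm_tr trmx_mul trmxK mulmxA.
have := sq w; rewrite wv => H1.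
have H2 : (v *m w^T) 0 0 <= m%:R * (`|v| * `|w|).
  apply: le_trans (ler_norm _) _; apply: le_trans (mx_entry_le _ _ _) _.
  by rewrite -[`|w|]mx_norm_tr; exact: mulmx_norm_le.
have := low w => H3.
have [w0|w0] := eqVneq `|J *m w^T| 0; first by rewrite w0 mulr_ge0// divr_ge0// ltW.
have Jp : 0 < `|J *m w^T| by rewrite lt_neqAle eq_sym w0 normr_ge0.
rewrite -(ler_pM2r Jp) -expr2; apply: le_trans H1 _; apply: le_trans H2 _.
have -> : m%:R / tau * `|v| * `|J *m w^T| = m%:R * (`|v| * (tau^-1 * `|J *m w^T|)) by ring.
by rewrite ler_wpM2l// ler_wpM2l// ler_pdivlMl.
Qed.

Context {n m : nat}.

(* Near [x] the map [F] is a small perturbation of its linear part [J], so the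
   segment from [x] to [x'] can be corrected within the range of a right
   inverse [B] of [J] to a path of zeros, by a contraction. *)
Lemma zeros_connected (F : 'rV[R]_n -> 'rV[R]_m) (x x' : 'rV[R]_n)
    (J : 'M[R]_(n, m)) (B : 'M[R]_(m, n)) (zeta kappa rho : R) :
  B *m J = 1%:M -> 0 <= zeta -> 0 <= kappa ->
  (forall v : 'rV[R]_m, `|v *m B| <= kappa * `|v|) ->
  (forall y y', `|y - x| <= 3 * rho -> `|y' - x| <= 3 * rho ->
     `|F y' - F y - (y' - y) *m J| <= zeta * `|y' - y|) ->
  2 * (zeta * kappa) <= 1 -> `|x' - x| <= rho -> F x = 0 -> F x' = 0 ->
  exists C : set 'rV[R]_n, [/\ connected C, C x, C x' &
    forall y, C y -> F y = 0 /\ `|y - x| <= 3 * rho].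
Proof.
move=> BJ z0 k0 HB lin zk xx' Fx Fx'.
set r0 := `|x' - x|; have r00 : 0 <= r0 by exact: normr_ge0.
have xin : `|x - x| <= 3 * rho by rewrite subrr normr0 mulr_ge0// (le_trans r00).
have x'in : `|x' - x| <= 3 * rho.
  by apply: (le_trans xx'); rewrite ler_peMl ?ler1n// (le_trans r00).
have dJ : `|(x' - x) *m J| <= zeta * r0.
  by have := lin x x' xin x'in; rewrite Fx Fx' subrr sub0r normrN.
pose z (t : R) := x + t *: (x' - x).
pose pt (t : R) (v : 'rV[R]_m) := z t + v *m B.
(* A ball that the map [T] below sends into itself: [|T 0| <= 2 zeta r0], and [T] contracts by
   [1/2]. *)
pose inV v := `|v : 'rV[R]_m| <= 4 * zeta * r0.
have ptE t v t' v' : pt t' v' - pt t v = (t' - t) *: (x' - x) + (v' - v) *m B.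
  rewrite /pt /z scalerBl mulmxBl opprD addrACA; congr (_ + _).
  by rewrite opprD addrACA subrr add0r.
have ptJ t v t' v' : (pt t' v' - pt t v) *m J = (t' - t) *: ((x' - x) *m J) + (v' - v).
  by rewrite ptE mulmxDl scalemxAl -mulmxA BJ mulmx1.
have ptin t v : 0 <= t <= 1 -> inV v -> `|pt t v - x| <= 3 * rho.
  move=> /andP[t0 t1] Vv.
  have -> : pt t v - x = t *: (x' - x) + v *m B.
    by rewrite /pt /z addrAC; congr (_ + _); rewrite addrC addKr.
  apply: le_trans (ler_normD _ _) _.
  have a1 : `|t *: (x' - x)| <= r0 by rewrite normrZ ger0_norm// ler_piMl.
  have a2 : `|v *m B| <= 2 * r0.
    apply: le_trans (HB _) _; apply: (@le_trans _ _ (kappa * (4 * zeta * r0))).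
      exact: ler_wpM2l.
    have -> : kappa * (4 * zeta * r0) = 2 * (zeta * kappa) * (2 * r0) by ring.
    by rewrite ler_piMl// mulr_ge0.
  by apply: (le_trans (lerD a1 a2)); move: xx'; rewrite -/r0; lra.
have half (a : R) : 0 <= a -> zeta * (kappa * a) <= 2^-1 * a.
  by move=> a0; rewrite mulrA ler_wpM2r//; lra.
(* With [t = t'] this is uniqueness of the correction, which identifies the ends of the path with
   [x] and [x']. In general it makes the correction Lipschitz in [t], hence the path continuous. *)
have key t v t' v' : 0 <= t <= 1 -> 0 <= t' <= 1 -> inV v -> inV v' ->
    F (pt t v) = 0 -> F (pt t' v') = 0 -> `|v' - v| <= 4 * zeta * r0 * `|t' - t|.
  move=> t01 t'01 Vv Vv' F1 F2.
  have := lin _ _ (ptin _ _ t01 Vv) (ptin _ _ t'01 Vv').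
  rewrite F1 F2 subrr sub0r normrN ptJ => H.
  have H1 : `|v' - v| <= `|(t' - t) *: ((x' - x) *m J) + (v' - v)| + `|t' - t| * (zeta * r0).
    have := ler_normB ((t' - t) *: ((x' - x) *m J) + (v' - v)) ((t' - t) *: ((x' - x) *m J)).
    rewrite [X in `|X| <= _]addrC addKr normrZ => /le_trans; apply.
    by rewrite lerD2l ler_wpM2l.
  have H2 : `|pt t' v' - pt t v| <= `|t' - t| * r0 + kappa * `|v' - v|.
    rewrite ptE; apply: le_trans (ler_normD _ _) _; rewrite normrZ lerD2l; exact: HB.
  have H3 : zeta * `|pt t' v' - pt t v| <= zeta * (`|t' - t| * r0) + 2^-1 * `|v' - v|.
    apply: le_trans (ler_wpM2l z0 H2) _; rewrite mulrDr lerD2l; exact: half.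
  have -> : 4 * zeta * r0 * `|t' - t| = 4 * (zeta * (`|t' - t| * r0)) by ring.
  have E : `|t' - t| * (zeta * r0) = zeta * (`|t' - t| * r0) by ring.
  by rewrite E in H1; lra.
have ex t : exists v, 0 <= t <= 1 -> inV v /\ F (pt t v) = 0.
  have [t01|] := boolP (0 <= t <= 1); last by exists 0.
  have V0 : inV 0 by rewrite /inV normr0 !mulr_ge0.
  (* A Newton iteration with frozen derivative: as [B *m J = 1%:M], the increments of [F (pt t v)]
     are those of [v] up to an error of half their size. *)
  pose T v := v - F (pt t v).
  have TT v v' : inV v -> inV v' -> `|T v' - T v| <= 2^-1 * `|v' - v|.
    move=> Vv Vv'; have := lin _ _ (ptin _ _ t01 Vv) (ptin _ _ t01 Vv').
    rewrite ptJ subrr scale0r add0r ptE subrr scale0r add0r => H.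
    have -> : T v' - T v = - (F (pt t v') - F (pt t v) - (v' - v)).
      by apply/rowP => i; rewrite /T !mxE; ring.
    rewrite normrN; apply: (le_trans H).
    by apply: (le_trans (ler_wpM2l z0 (HB _))); exact: half.
  have T0 : `|T 0| <= 2 * zeta * r0.
    have := lin _ _ xin (ptin _ _ t01 V0).
    have -> : pt t 0 - x = t *: (x' - x) by rewrite /pt /z mul0mx addr0 addrC addKr.
    rewrite Fx subr0 -scalemxAl normrZ => H.
    have /andP[t0 t1] := t01.
    have -> : T 0 = - (F (pt t 0) - t *: ((x' - x) *m J) + t *: ((x' - x) *m J)).
      by rewrite subrK /T sub0r.
    rewrite normrN; apply: le_trans (ler_normD _ _) _; rewrite normrZ (ger0_norm t0) in H *.
    have e1 : zeta * (t * r0) <= zeta * r0 by rewrite ler_wpM2l// ler_piMl.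
    have e2 : t * `|(x' - x) *m J| <= zeta * r0.
      by apply: le_trans dJ; rewrite ler_piMl.
    by rewrite -/r0 in H; lra.
  have TV v : inV v -> inV (T v).
    move=> Vv; have := TT _ _ V0 Vv; rewrite subr0 => H.
    have : `|T v| <= `|T v - T 0| + `|T 0|.
      by rewrite -{1}(subrK (T 0) (T v)); exact: ler_normD.
    by rewrite /inV in Vv *; lra.
  pose A : set 'rV[R]_m := [set v | inV v].
  have TA : {homo T : v / A v >-> A v} by move=> v; exact: TV.
  have [|||p Ap /= pT] := @banach_fixed_point R _ A (mkfun TA).
  - have h0 : (0 : R) <= 2^-1 by [].
    exists (NngNum h0); split => /=; first by lra.
    by move=> [v v'] [/= Av Av']; apply: TT.
  - have -> : A = (fun v : 'rV[R]_m => `|v|) @^-1` [set s | s <= 4 * zeta * r0] by [].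
    apply: preimage_closed; last exact: closed_le.
    by move=> ? _; exact: norm_continuous.
  - by exists 0.
  exists p => _; split => //.
  by move/esym/eqP: pT; rewrite /T subr_eq -subr_eq0 opprD addrA subrr sub0r oppr_eq0 => /eqP.
have [v Hv] := choice ex.
pose gam t := pt t (v t).
have vlip t t' : 0 <= t <= 1 -> 0 <= t' <= 1 -> `|v t' - v t| <= 4 * zeta * r0 * `|t' - t|.
  by move=> t01 t'01; have [? ?] := Hv _ t01; have [? ?] := Hv _ t'01; exact: key.
have glip t t' : 0 <= t <= 1 -> 0 <= t' <= 1 -> `|gam t' - gam t| <= 3 * r0 * `|t' - t|.
  move=> t01 t'01; rewrite /gam ptE; apply: le_trans (ler_normD _ _) _.
  rewrite normrZ -/r0; have H1 := HB (v t' - v t).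
  have H2 := ler_wpM2l k0 (vlip _ _ t01 t'01).
  have : kappa * (4 * zeta * r0 * `|t' - t|) <= 2 * r0 * `|t' - t|.
    have -> : kappa * (4 * zeta * r0 * `|t' - t|) = 2 * (zeta * kappa) * (2 * r0 * `|t' - t|) by ring.
    by rewrite ler_piMl// !mulr_ge0.
  by have -> : 3 * r0 * `|t' - t| = `|t' - t| * r0 + 2 * r0 * `|t' - t|; [ring|lra].
have V0 : inV 0 by rewrite /inV normr0 !mulr_ge0.
have endpoint t : 0 <= t <= 1 -> F (pt t 0) = 0 -> v t = 0.
  move=> t01 F0; have [Vv Fv] := Hv _ t01.
  have := key _ _ _ _ t01 t01 V0 Vv F0 Fv; rewrite !subrr subr0 normr0 mulr0 => H.
  by apply/eqP; rewrite -normr_eq0 eq_le H normr_ge0.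
have p00 : pt 0 0 = x by rewrite /pt /z mul0mx scale0r !addr0.
have p10 : pt 1 0 = x' by rewrite /pt /z mul0mx scale1r addr0 addrC subrK.
have i0 : 0 <= (0 : R) <= 1 by lra.
have i1 : 0 <= (1 : R) <= 1 by lra.
exists (gam @` `[0, 1]%classic); split.
- apply: connected_continuous_connected; first exact: segment_connected.
  apply/subspace_continuousP => t /=; rewrite in_itv/= => t01.
  apply/cvgrPdist_lt => /= e e0; near=> s.
  have s01 : 0 <= s <= 1.
    have : `[0, 1]%classic s by near: s; exact: withinT.
    by rewrite /= in_itv.
  apply: (le_lt_trans (glip _ _ s01 t01)).
  have : `|t - s| < e / (3 * r0 + 1).
    near: s; apply: cvg_within; rewrite nbhs_simpl/=.
    have e'0 : 0 < e / (3 * r0 + 1) by rewrite divr_gt0//; lra.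
    by have := @nbhsx_ballx _ _ t _ e'0; apply: filterS => s; rewrite -ball_normE.
  rewrite ltr_pdivlMr; last by lra.
  move=> /(le_lt_trans _); apply; rewrite mulrC ler_wpM2l//; lra.
- by exists 0; rewrite /= ?in_itv//= /gam endpoint// p00.
- by exists 1; rewrite /= ?in_itv//= /gam endpoint// p10.
- move=> y [t /=]; rewrite in_itv/= => t01 <-.
  by have [Vv Fv] := Hv _ t01; split => //; exact: ptin.
Unshelve. all: by end_near.
Qed.

End ZeroSetPath.

(** * Scales and chaining *)

Section Scales.
Context {R : realType}.
Variable D : nat.
Hypothesis D2 : (2 <= D)%N.

Definition base : nat := (2 ^ D)%N.
(* [mesh k] is the spacing of the [k]-th grid, [tol k] the oscillation allowed
   to the first derivatives at that spacing. *)
Definition mesh (k : nat) : R := (base ^ k)%:R^-1.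
Definition tol (k : nat) : R := 2 ^+ k * mesh k.

Lemma base_ge4 : (4 <= base)%N.
Proof. by rewrite /base -[4%N]/(2 ^ 2)%N leq_exp2l. Qed.

Lemma basek_gt0 k : (0 < base ^ k)%N.
Proof. by rewrite expn_gt0 (leq_trans _ base_ge4). Qed.

Lemma mesh_gt0 k : 0 < mesh k.
Proof. by rewrite invr_gt0 ltr0n basek_gt0. Qed.

Lemma meshS k : base%:R * mesh k.+1 = mesh k.
Proof.
rewrite /mesh expnS natrM invfM mulrA mulfV ?mul1r// pnatr_eq0 -lt0n.
exact: leq_trans base_ge4.
Qed.

Lemma tol_gt0 k : 0 < tol k.
Proof. by rewrite mulr_gt0 ?mesh_gt0// exprn_gt0. Qed.

Lemma mesh_le1 k : mesh k <= 1.
Proof. by rewrite invf_le1 ?ltr0n ?basek_gt0// ler1n basek_gt0. Qed.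

Lemma tolS k : 2^-1 * base%:R * tol k.+1 = tol k.
Proof. by rewrite /tol exprS -(meshS k); field. Qed.

(** The slack of the chaining induction: an increment of size [tol k.+1] fits into
    [tol k - tol k.+1], so the increments of all finer levels sum to at most [tol k]. *)
Lemma tol_half k : 2 * tol k.+1 <= tol k.
Proof.
rewrite -[leRHS]tolS ler_wpM2r ?(ltW (tol_gt0 _))//.
have : (4 : R) <= base%:R by rewrite ler_nat base_ge4.
by lra.
Qed.

Lemma mesh_lt_half k : mesh k <= 2^-1 ^+ k.
Proof.
rewrite exprVn /mesh lef_pV2 ?posrE ?exprn_gt0 ?ltr0n ?basek_gt0//.
rewrite -natrX ler_nat; case: k => // k; rewrite leq_exp2r//.
exact: leq_trans base_ge4.
Qed.

Lemma mesh_cvg0 : mesh k @[k --> \oo] --> (0 : R).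
Proof.
apply: (@squeeze_cvgr _ _ _ _ (fun=> 0) (fun k => 2^-1 ^+ k)).
- by near=> k; rewrite ltW ?mesh_gt0// mesh_lt_half.
- exact: cvg_cst.
- by apply: cvg_expr; rewrite ger0_norm// invf_lt1// ltr1n.
Unshelve. all: by end_near. Qed.

Context {n : nat}.

Definition gridpt (c : 'rV[R]_n) k (t : {ffun 'I_n -> 'I_(base ^ k)}) : 'rV[R]_n :=
  \row_j (c 0 j + (t j)%:R * mesh k).

(** Half-open, so that the cells of each level partition it and their corners, the grid points, all
    belong to it. *)
Definition unit_box (c : 'rV[R]_n) : set 'rV[R]_n :=
  [set x | forall j, c 0 j <= x 0 j < c 0 j + 1].

Definition cell (c : 'rV[R]_n) k t (x : 'rV[R]_n) :=
  forall j, gridpt c k t 0 j <= x 0 j < gridpt c k t 0 j + mesh k.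

Lemma gridpt_box c k t : unit_box c (gridpt c k t).
Proof.
move=> j; rewrite mxE lerDl mulr_ge0 ?(ltW (mesh_gt0 _))//= ltrD2l.
by rewrite -ltr_pdivlMr ?mesh_gt0// invrK mul1r ltr_nat.
Qed.

Lemma cell_exists c k x : unit_box c x -> exists t, cell c k t x.
Proof.
move=> cx.
have lt (j : 'I_n) : (Num.truncn ((x 0 j - c 0 j) * (base ^ k)%N%:R)%R < base ^ k)%N.
  have /andP[c0 c1] := cx j.
  rewrite truncn_lt_nat; last by rewrite mulr_ge0// subr_ge0.
  by rewrite gtr_pMl ?ltr0n ?basek_gt0//; lra.
exists [ffun j => Ordinal (lt j)] => j; rewrite mxE ffunE/=.
have /andP[c0 c1] := cx j.
have y0 : 0 <= (x 0 j - c 0 j) * (base ^ k)%:R by rewrite mulr_ge0// subr_ge0.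
have bk : 0 < (base ^ k)%:R :> R by rewrite ltr0n basek_gt0.
have /andP[h1 h2] := truncn_itv y0.
have E : x 0 j - c 0 j = (x 0 j - c 0 j) * (base ^ k)%:R * mesh k.
  by rewrite -mulrA mulfV ?mulr1// gt_eqF.
have m0 := mesh_gt0 k.
have := ler_wpM2r (ltW m0) h1; rewrite -E => a1.
move: h2; rewrite -(ltr_pM2r m0) -E -natr1 mulrDl mul1r => a2.
by lra.
Qed.

Lemma gridptS c k t : exists t', gridpt c k.+1 t' = gridpt c k t.
Proof.
have lt j : (t j * base < base ^ k.+1)%N.
  by rewrite expnSr ltn_pmul2r// (leq_trans _ base_ge4).
exists [ffun j => Ordinal (lt j)]; apply/rowP => j; rewrite !mxE ffunE/=.
by rewrite natrM -mulrA meshS.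
Qed.

Lemma cell_dist c k t x : cell c k t x -> `|x - gridpt c k t| <= mesh k.
Proof.
move=> H; apply: mx_norm_le => [|i j]; first exact/ltW/mesh_gt0.
have := H j; rewrite ord1 !mxE => /andP[h1 h2].
by rewrite ger0_norm; lra.
Qed.

(* Chaining along the nested grids [c + mesh j * Z^n]. *)
Lemma chaining (h : 'rV[R]_n -> R) (c : 'rV[R]_n) k :
  (forall x, unit_box c x -> {for x, continuous h}) ->
  (forall j, (k <= j)%N -> forall t t',
    `|gridpt c j t - gridpt c j t'| <= base%:R * mesh j ->
    `|h (gridpt c j t) - h (gridpt c j t')| <= tol j) ->
  forall x y, unit_box c x -> unit_box c y -> `|x - y| <= 3 * mesh k ->
  `|h x - h y| <= 3 * tol k.
Proof.
move=> ch osc.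
have one x t : unit_box c x -> cell c k t x -> `|h x - h (gridpt c k t)| <= tol k.
  move=> cx ckt; apply/ler_addgt0Pr => e e0.
  have P i : exists t' : {ffun 'I_n -> 'I_(base ^ (k + i))}, cell c (k + i) t' x /\
       `|h (gridpt c (k + i) t') - h (gridpt c k t)| <= tol k - tol (k + i).
    elim: i => [|i [t' [ct' Ht']]].
      by rewrite addn0; exists t; rewrite !subrr normr0.
    rewrite addnS; have [t2 ct2] := cell_exists c (k + i).+1 x cx.
    exists t2; split => //; have [t3 E3] := gridptS c (k + i) t'.
    have near : `|gridpt c (k + i).+1 t2 - gridpt c (k + i).+1 t3| <= base%:R * mesh (k + i).+1.
      rewrite E3 meshS; apply: mx_norm_le => [|a j]; first exact/ltW/mesh_gt0.
      have := ct2 j; have := ct' j; rewrite ord1 !mxE -(meshS (k + i)).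
      have : (4 : R) * mesh (k + i).+1 <= base%:R * mesh (k + i).+1.
        by rewrite ler_wpM2r ?(ltW (mesh_gt0 _))// ler_nat base_ge4.
      have := mesh_gt0 (k + i).+1; set bm := base%:R * _.
      set p := c 0 j + _; set q := c 0 j + _.
      by move=> ? ? /andP[? ?] /andP[? ?]; rewrite ler_norml; lra.
    have := osc (k + i).+1 (leq_trans (leq_addr _ _) (leqnSn _)) _ _ near; rewrite E3 => H.
    have := tol_half (k + i); have := ler_distD (h (gridpt c (k + i) t')) (h (gridpt c (k + i).+1 t2)) (h (gridpt c k t)).
    by move: Ht' H; lra.
  have := ch x cx => /cvgrPdist_lt /(_ _ e0) /nbhs_ballP [d /= d0 Hd].
  have : \forall i \near \oo, mesh i < d.
    by have /cvgrPdist_lt/(_ _ d0) := mesh_cvg0; apply: filterS => i; rewrite sub0r normrN ger0_norm// ltW// mesh_gt0.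
  move=> [N _ HN]; have [t' [ct' Ht']] := P N.
  have cl : `|h x - h (gridpt c (k + N) t')| < e.
    apply: Hd; rewrite -ball_normE/=; apply: (le_lt_trans (cell_dist _ _ _ _ ct')).
    by apply: HN => /=; rewrite leq_addl.
  have := ler_distD (h (gridpt c (k + N) t')) (h x) (h (gridpt c k t)).
  by have := tol_gt0 (k + N); move: Ht' cl; lra.
move=> x y cx cy xy.
have [t ct] := cell_exists c k x cx; have [t' ct'] := cell_exists c k y cy.
(* Cells of points at distance at most [3 * mesh k] have corners at most [4 * mesh k] apart; these
   are neighbours because the base is at least 4. *)
have near : `|gridpt c k t - gridpt c k t'| <= base%:R * mesh k.
  have m0 := mesh_gt0 k.
  apply: mx_norm_le => [|a j]; first by rewrite mulr_ge0// ltW.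
  have /(le_trans (mx_entry_le (x - y) a j)) := xy.
  have := ct j; have := ct' j; rewrite ord1 !mxE.
  have : (4 : R) * mesh k <= base%:R * mesh k.
    by rewrite ler_wpM2r ?(ltW (mesh_gt0 _))// ler_nat base_ge4.
  set bm := base%:R * _; set p := c 0 j + _; set q := c 0 j + _.
  by move=> ? /andP[? ?] /andP[? ?]; rewrite !ler_norml; lra.
have := osc k (leqnn k) _ _ near; have := one x t cx ct; have := one y t' cy ct'.
have := ler_distD (h (gridpt c k t)) (h x) (h y).
have := ler_distD (h (gridpt c k t')) (h (gridpt c k t)) (h y).
by rewrite (distrC (h y)); lra.
Qed.

End Scales.

(** * Counting components by bad grid cells *)

Section LocalCount.
Context {R : realType} {n m : nat}.
Variable D : nat.
Hypothesis D4 : (4 <= D)%N.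
Hypothesis m0 : (0 < m)%N.
Hypothesis n0 : (0 < n)%N.
Implicit Types (F : 'rV[R]_n -> 'rV[R]_m) (x y c : 'rV[R]_n).

Let D2 : (2 <= D)%N. Proof. exact: leq_trans D4. Qed.
Local Notation b := (base D).
Local Notation mesh := (@mesh R D).
Local Notation tol := (@tol R D).

Definition comp F (i : 'I_m) : 'rV[R]_n -> R^o := fun x => F x ord0 i.
(** Transpose of the usual Jacobian: increments are row vectors and act from the left, combinations
    [u] of the components of [F] are columns and act from the right. *)
Definition jac F x : 'M[R]_(n, m) := \matrix_(j, i) pd j (comp F i) x.

Definition smooth_on (U : set 'rV[R]_n) F := forall i j x, U x ->
  derivable (comp F i) x (ev j) /\ {for x, continuous (pd j (comp F i))}.

(** Neighbours are up to [b] spacings apart, that is, one spacing of the previous level. The chain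
    can thus pass from the corner of a cell to that of a subcell in a single step. *)
Definition rough c k F := exists t t',
  `|gridpt D c k t - gridpt D c k t'| <= b%:R * mesh k /\
  exists i j, tol k < `|pd j (comp F i) (gridpt D c k t) - pd j (comp F i) (gridpt D c k t')|.

(** The threshold is matched to the tolerance: with derivatives up to [2 ^+ k], a displacement of
    [mesh k] moves [F] by the order of [tol k]. *)
Definition steep y k F := exists i j, 2 ^+ k < `|pd j (comp F i) y|.

(* A net of the vectors of sup norm at most 1 whose [i]-th coordinate is 1. *)
Definition netvec k (i : 'I_m) (p : {ffun 'I_m.-1 -> 'I_(2 * b ^ k).+1}) : 'cV[R]_m :=
  \col_l (if unlift i l is Some l' then -1 + (p l')%:R * mesh k else 1).

(** Forced by the contraction: with linearization error [3 n tol k] and a right inverse of norm at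
    most [m / (regular_const * tol k)], the condition [2 zeta kappa <= 1] holds with equality. *)
Definition regular_const : R := (6 * n * m)%:R.
(** The first term covers a failure of regularity one level up, where the tolerance is larger by the
    factor [b / 2]. The term [4 m] pays for moving the point to the grid and the vector to the net,
    and [8 n] for the size of [F] at the grid point. *)
Definition degenerate_tol : R := regular_const * b%:R + 4 * m%:R + 8 * n%:R.

Definition degenerate k y F := (forall i, `|comp F i y| <= degenerate_tol * tol k) /\
  exists i p, forall j, `|(jac F y *m netvec k i p) j ord0| <= degenerate_tol * tol k.

(** Roughness is tested one level up, so that a cell of level [k] records why level [k - 1] was not
    good; it makes all cells of the box bad at once. Levels 0 and 1 are bad by decree, since a good
    level has to be positive. *)
Definition bad c k t F := [\/ (k <= 1)%N, rough c k.-1 F,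
  degenerate k (gridpt D c k t) F | steep (gridpt D c k t) k F].

Definition regular x k F := forall u : 'cV[R]_m, regular_const * tol k * `|u| <= `|jac F x *m u|.

Definition tame c k F := forall j, (k <= j)%N -> ~ rough c j F.

(** The margin [1/4] keeps balls of radius [3 * mesh k] inside the unit box for [k >= 1], because
    the base is at least 16. *)
Definition core c : set 'rV[R]_n := [set x | forall j, c 0 j + 4^-1 <= x 0 j < c 0 j + 3 / 4].

Lemma core_box c x : core c x -> unit_box c x.
Proof. by move=> H j; have := H j; lra. Qed.

Lemma box_convex_ball x (rho : R) : box_convex [set y | `|y - x| <= rho].
Proof.
move=> u v w /= ux vx H; apply: mx_norm_le => [|i j]; first exact: le_trans ux.
have := le_trans (mx_entry_le (u - x) i j) ux; have := le_trans (mx_entry_le (v - x) i j) vx.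
have := H j; rewrite ord1 !mxE => /orP[] /andP[? ?]; rewrite !ler_norml; lra.
Qed.

Lemma three_mesh k : (0 < k)%N -> 3 * mesh k <= 4^-1.
Proof.
case: k => // k _; have := mesh_le1 (R := R) D D2 k; rewrite -(meshS D D2 k) => H.
have : (16 : R) * mesh k.+1 <= b%:R * mesh k.+1.
  rewrite ler_wpM2r ?(ltW (mesh_gt0 _ D2 _))// ler_nat.
  by rewrite /base -[16%N]/(2 ^ 4)%N leq_exp2l.
lra.
Qed.

Lemma ball_unit_box c x k y : (0 < k)%N -> core c x -> `|y - x| <= 3 * mesh k -> unit_box c y.
Proof.
move=> k0 cx yx j; have := cx j; have := three_mesh k k0.
have := le_trans (mx_entry_le (y - x) 0 j) yx; rewrite !mxE ler_norml; lra.
Qed.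

Lemma jac_osc U c k F x y : smooth_on U F -> unit_box c `<=` U -> tame c k F ->
  unit_box c x -> unit_box c y -> `|x - y| <= 3 * mesh k ->
  forall i j, `|pd j (comp F i) x - pd j (comp F i) y| <= 3 * tol k.
Proof.
move=> sF cU tF cx cy xy i j.
apply: (chaining D D2 (pd j (comp F i)) c k) => //.
  by move=> z cz; have [] := sF i j z (cU _ cz).
move=> l kl t t' tt'; rewrite leNgt; apply/negP => H.
by apply: (tF l kl); exists t, t'; split => //; exists i, j.
Qed.

Lemma sum_norm_le (v : 'rV[R]_n) : \sum_j `|v 0 j| <= n%:R * `|v|.
Proof.
rewrite mulr_natl -[X in _ *+ X]card_ord -sumr_const; apply: ler_sum => j _.
exact: mx_entry_le.
Qed.

Lemma ball_linearization U c k F x : smooth_on U F -> unit_box c `<=` U ->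
  tame c k F -> (0 < k)%N -> core c x -> forall y y',
  `|y - x| <= 3 * mesh k -> `|y' - x| <= 3 * mesh k ->
  `|F y' - F y - (y' - y) *m jac F x| <= 3 * n%:R * tol k * `|y' - y|.
Proof.
move=> sF cU tF k0 cx y y' yx y'x.
have t0 := ltW (tol_gt0 (R := R) D D2 k).
apply: mx_norm_le => [|i0 i]; first by rewrite mulr_ge0// mulr_ge0// mulr_ge0.
have := @box_linearization R n _ (comp F i) (fun j => jac F x j i) (3 * tol k)
  (box_convex_ball x (3 * mesh k)) _ y y' yx y'x.
rewrite ord1 => H; have E : (F y' - F y - (y' - y) *m jac F x) 0 i =
  comp F i y' - comp F i y - \sum_j (y' 0 j - y 0 j) * jac F x j i.
  by rewrite !mxE /comp; congr (_ - _); apply: eq_bigr => j _; rewrite !mxE.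
rewrite E; apply: (le_trans (H _)).
  move=> j z /= zx; have cz := ball_unit_box c x k z k0 cx zx.
  split; first by have [] := sF i j z (cU _ cz).
  rewrite mxE; exact: (jac_osc U c k F z x sF cU tF cz (core_box _ _ cx) zx).
have -> : 3 * n%:R * tol k * `|y' - y| = 3 * tol k * (n%:R * `|y' - y|) by ring.
apply: ler_wpM2l; first by rewrite mulr_ge0.
apply: (le_trans _ (sum_norm_le (y' - y))).
by apply: ler_sum => j _; rewrite !mxE.
Qed.

Lemma close_zeros_connected U c k F x x' : smooth_on U F -> unit_box c `<=` U ->
  tame c k F -> (0 < k)%N -> core c x -> regular x k F -> F x = 0 -> F x' = 0 ->
  `|x' - x| <= mesh k ->
  exists C : set 'rV[R]_n, [/\ connected C, C x, C x' &
    forall y, C y -> U y /\ F y = 0].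
Proof.
move=> sF cU tF k0 cx rx Fx Fx' xx'.
have t0 := tol_gt0 (R := R) D D2 k.
have nm0 : (0 : R) < n%:R * m%:R by rewrite mulr_gt0// ltr0n.
have K0 : 0 < regular_const by rewrite /regular_const !natrM -mulrA mulr_gt0.
have Kt0 : 0 < regular_const * tol k by rewrite mulr_gt0.
have [B BJ HB] := bounded_right_inverse _ _ Kt0 rx.
have mK : 0 <= m%:R / (regular_const * tol k) by rewrite divr_ge0// ltW.
have [| |C [cC Cx Cx' HC]] := @zeros_connected R n m F x x' _ B (3 * n%:R * tol k)
   (m%:R / (regular_const * tol k)) (mesh k) BJ _ mK HB
   (ball_linearization U c k F x sF cU tF k0 cx) _ xx' Fx Fx'.
- by rewrite mulr_ge0 ?(ltW t0)// mulr_ge0.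
- rewrite /regular_const !natrM; have n1 : (n%:R : R) != 0 by rewrite pnatr_eq0 -lt0n.
  have m1 : (m%:R : R) != 0 by rewrite pnatr_eq0 -lt0n.
  rewrite le_eqVlt; apply/orP; left; apply/eqP; field.
  by rewrite gt_eqF// n1 m1.
exists C; split => // y /HC[Fy yx]; split => //; apply: cU.
exact: (ball_unit_box c x k y).
Qed.

Lemma normalize_cV (u : 'cV[R]_m) : u != 0 -> exists2 i, u i 0 != 0 & `|u| = `|u i 0|.
Proof.
move=> u0; have : mx_norm u != 0 by rewrite -[mx_norm u]/(`|u|) normr_eq0.
move=> /mx_norm_neq0 [[i i'] /= E]; rewrite ord1 in E.
exists i; last exact: E.
by rewrite -normr_eq0 -E -[mx_norm u]/(`|u|) normr_eq0.
Qed.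

Lemma netvec_approx k (u : 'cV[R]_m) i : u i 0 = 1 -> `|u| <= 1 ->
  exists p, `|u - netvec k i p| <= mesh k.
Proof.
move=> ui u1.
have bk : (0 : R) < (b ^ k)%:R by rewrite ltr0n basek_gt0.
have ul l : -1 <= u l 0 <= 1 by rewrite -ler_norml (le_trans (mx_entry_le u l 0)).
have y0 l : 0 <= (u l 0 + 1) * (b ^ k)%:R by rewrite mulr_ge0//; have := ul l; lra.
have lt (l' : 'I_m.-1) : (Num.truncn ((u (lift i l') 0 + 1) * (b ^ k)%N%:R)%R < (2 * b ^ k).+1)%N.
  rewrite truncn_lt_nat// -natr1 natrM.
  have : (u (lift i l') 0 + 1) * (b ^ k)%:R <= 2 * (b ^ k)%:R.
    by rewrite ler_wpM2r ?(ltW bk)//; have := ul (lift i l'); lra.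
  lra.
exists [ffun l' => Ordinal (lt l')]; apply: mx_norm_le => [|l z].
  exact/ltW/mesh_gt0.
rewrite ord1 !mxE; case: unliftP => [l' ->|->]; last first.
  by rewrite ui subrr normr0 ltW// mesh_gt0.
rewrite ffunE/=; have /andP[h1 h2] := truncn_itv (y0 (lift i l')).
have M0 := mesh_gt0 (R := R) D D2 k.
have E : u (lift i l') 0 + 1 = (u (lift i l') 0 + 1) * (b ^ k)%:R * mesh k.
  by rewrite -mulrA mulfV ?mulr1// gt_eqF.
have := ler_wpM2r (ltW M0) h1; rewrite -E => a1.
move: h2; rewrite -(ltr_pM2r M0) -E -natr1 mulrDl mul1r => a2.
by rewrite ler_norml; lra.
Qed.

(** The corner [y] of the cell sees the irregularity of [x]. Unless [y] is steep, going from the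
    zero [x] to [y] keeps [F] of the order of the tolerance. A vector nearly annihilated by the
    derivative at [x], normalized so that its largest coordinate is 1, remains so at [y] and after
    rounding to the net. *)
Lemma irregular_bad U c k F x t : smooth_on U F -> unit_box c `<=` U ->
  tame c k.+1 F -> core c x -> cell D c k.+1 t x -> F x = 0 -> ~ regular x k F ->
  bad c k.+1 t F.
Proof.
move=> sF cU tF cx ct Fx nreg.
have [st|nst] := pselect (steep (gridpt D c k.+1 t) k.+1 F); first by constructor 4.
constructor 3; set y := gridpt D c k.+1 t; set k' := k.+1.
have cy : unit_box c y by exact: gridpt_box.
have t0 := tol_gt0 (R := R) D D2 k'.
have M0 := mesh_gt0 (R := R) D D2 k'.
have xy : `|x - y| <= mesh k' by exact: cell_dist.
have xy3 : `|x - y| <= 3 * mesh k' by apply: (le_trans xy); lra.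
have osc := jac_osc U c k' F x y sF cU tF (core_box _ _ cx) cy xy3.
have gy i j : `|pd j (comp F i) y| <= 2 ^+ k'.
  by rewrite leNgt; apply/negP => H; apply: nst; exists i, j.
have yx : `|y - x| <= mesh k' by rewrite distrC.
have yx3 : `|y - x| <= 3 * mesh k' by rewrite distrC.
have xx : `|x - x| <= 3 * mesh k' by rewrite subrr normr0; lra.
have K0 : 0 <= regular_const by [].
have nR : (0 : R) <= n%:R by []. have mR : (0 : R) <= m%:R by [].
have Kb : 0 <= regular_const * b%:R by rewrite mulr_ge0.
have Kbt : 0 <= regular_const * b%:R * tol k' by rewrite mulr_ge0// ltW.
have nt : 0 <= n%:R * tol k' by rewrite mulr_ge0// ltW.
have mt : 0 <= m%:R * tol k' by rewrite mulr_ge0// ltW.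
have C1E : degenerate_tol * tol k' = regular_const * b%:R * tol k' + 4 * (m%:R * tol k') + 8 * (n%:R * tol k').
  by rewrite /degenerate_tol; ring.
split.
  move=> i.
  have H := ball_linearization U c k' F x sF cU tF erefl cx x y xx yx3.
  have a2 := mx_entry_le ((y - x) *m jac F x) 0 i.
  have E : (F y - F x - (y - x) *m jac F x) 0 i = comp F i y - ((y - x) *m jac F x) 0 i.
    by rewrite Fx subr0 mxE; congr (_ + _); rewrite mxE.
  have a1 := mx_entry_le (F y - F x - (y - x) *m jac F x) 0 i; rewrite E in a1.
  have J0 := mulmx_norm_le (y - x) (jac F x).
  have J1 : `|jac F x| <= 2 ^+ k' + 3 * tol k'.
    apply: mx_norm_le => [|j i']; first by rewrite addr_ge0// mulr_ge0// ltW.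
    rewrite mxE; have := osc i' j; have := gy i' j.
    have := ler_normD (pd j (comp F i') x - pd j (comp F i') y) (pd j (comp F i') y).
    by rewrite subrK; lra.
  have J2 : `|y - x| * `|jac F x| <= 4 * tol k'.
    apply: (@le_trans _ _ (mesh k' * (2 ^+ k' + 3 * tol k'))); first by rewrite ler_pM.
    rewrite mulrDr [X in X + _]mulrC -/(tol k').
    have : mesh k' * (3 * tol k') <= 1 * (3 * tol k').
      by rewrite ler_wpM2r ?mesh_le1// mulr_ge0// ltW.
    rewrite /tol; lra.
  have H2 : 3 * n%:R * tol k' * `|y - x| <= 3 * n%:R * tol k' * 1.
    apply: ler_wpM2l; first by rewrite -mulrA; lra.
    by rewrite (le_trans yx)// mesh_le1.
  have J3 := ler_wpM2l nR J2.
  have := ler_normD (comp F i y - ((y - x) *m jac F x) 0 i) (((y - x) *m jac F x) 0 i).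
  rewrite subrK C1E; move: H2; rewrite mulr1 -mulrA => H2.
  move: J3; rewrite mulrCA => J3; lra.
have [u Hu] : exists u : 'cV[R]_m, `|jac F x *m u| < regular_const * tol k * `|u|.
  apply: contrapT => H; apply: nreg => u; rewrite leNgt; apply/negP => Hu.
  by apply: H; exists u.
have u0 : u != 0 by apply/eqP => u0; move: Hu; rewrite u0 mulmx0 !normr0 mulr0 ltxx.
have [i ui0 uE] := normalize_cV u u0.
pose v := (u i 0)^-1 *: u.
have vi : v i 0 = 1 by rewrite mxE mulVf.
have v1 : `|v| = 1 by rewrite normrZ uE normfV mulVf// normr_eq0.
have Hv : `|jac F x *m v| <= regular_const * tol k.
  rewrite -scalemxAr normrZ normfV mulrC ler_pdivrMr ?normr_gt0//.
  by apply/ltW; rewrite -uE.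
have [p Hp] := netvec_approx k' v i vi (eq_ind _ (fun z => z <= 1) (lexx _) _ (esym v1)).
exists i, p => j; apply: le_trans (mx_entry_le _ _ _) _.
have -> : jac F y *m netvec k' i p = jac F x *m v + (jac F y - jac F x) *m v - jac F y *m (v - netvec k' i p).
  by rewrite mulmxBl mulmxBr [X in X - _]addrC subrK opprB addrC subrK.
have B1 : `|(jac F y - jac F x) *m v| <= m%:R * (3 * tol k' * 1).
  apply: le_trans (mulmx_norm_le _ _) _; apply: ler_wpM2l => //.
  rewrite v1 !mulr1; apply: mx_norm_le => [|j' i']; first by rewrite mulr_ge0// ltW.
  by rewrite !mxE distrC; exact: osc.
have B2 : `|jac F y *m (v - netvec k' i p)| <= m%:R * (2 ^+ k' * mesh k').
  apply: le_trans (mulmx_norm_le _ _) _; apply: ler_wpM2l => //.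
  apply: ler_pM => //; apply: mx_norm_le => [|j' i']; first by rewrite exprn_ge0.
  by rewrite mxE.
apply: le_trans (ler_normB _ _) _.
have := ler_normD (jac F x *m v) ((jac F y - jac F x) *m v).
move: B2; rewrite -/(tol k') => B2; move: Hv; rewrite -(tolS D D2 k).
have -> : regular_const * (2^-1 * b%:R * tol k.+1) = 2^-1 * (regular_const * b%:R * tol k') by rewrite /k'; ring.
move: B1; rewrite mulr1 mulrCA C1E => B1 Hv; lra.
Qed.

End LocalCount.

(** * Charging the components in the cube to bad cells *)

Section GlobalCount.
Context {R : realType} {n m : nat}.
Variable D : nat.
Hypothesis D4 : (4 <= D)%N.
Hypothesis m0 : (0 < m)%N.
Hypothesis n0 : (0 < n)%N.
Implicit Types (F : 'rV[R]_n -> 'rV[R]_m) (x y c : 'rV[R]_n).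

Let D2 : (2 <= D)%N. Proof. exact: leq_trans D4. Qed.

(** Take the least good level [k]. Either [k = 1], or level [k - 1] fails to be good by roughness or
    by irregularity of [x]; in each case the cell of [x] at level [k] is bad. Without any good
    level, failures occur arbitrarily deep. *)
Lemma zero_level_dichotomy U c F x : smooth_on U F -> unit_box c `<=` U ->
  core c x -> F x = 0 ->
  (forall K, exists k t, (K <= k)%N /\ bad D c k t F) \/
  (exists k, [/\ (0 < k)%N, tame D c k F, regular D x k F &
     forall t, cell D c k t x -> bad D c k t F]).
Proof.
move=> sF cU cx Fx.
pose good k := [/\ (0 < k)%N, tame D c k F & regular D x k F].
have tameS k : tame D c k F -> tame D c k.+1 F by move=> H j /ltnW; exact: H.
have [[k0 gk0]|nog] := pselect (exists k, good k).
  right; have ex : exists k, `[< good k >] by exists k0; exact/asboolP.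
  pose k := ex_minn ex; exists k; rewrite /k; case: ex_minnP => {}k /asboolP gk mink.
  have [kp tk rk] := gk; split => // t ct.
  case: k {gk} kp mink tk rk t ct => // -[|k] _ mink tk rk t ct.
    by constructor.
  have [rf|nrf] := pselect (rough D c k.+1 F); first by constructor 2.
  have tk1 : tame D c k.+1 F.
    move=> j; rewrite leq_eqVlt => /orP[/eqP<-//|]; exact: tk.
  apply: (irregular_bad D D4 U c k.+1 F x) => // rk1.
  have /mink : `[< good k.+1 >] by apply/asboolP.
  by rewrite ltnn.
(* Beyond level [K] either some level is rough, or the box is tame there and [x] has to be
   irregular. *)
left => K; have [[j [Kj rj]]|ntm] := pselect (exists j, (K.+1 <= j)%N /\ rough D c j F).
  have [t ct] := cell_exists D D2 c j.+1 x (core_box _ _ cx).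
  by exists j.+1, t; split; [exact: leq_trans (ltnW Kj) _|constructor 2].
have tK : tame D c K.+1 F by move=> j Kj rj; apply: ntm; exists j.
have [t ct] := cell_exists D D2 c K.+2 x (core_box _ _ cx).
exists K.+2, t; split; first exact: leq_trans (leqnSn _) _.
apply: (irregular_bad D D4 U c K.+1 F x) => //; first exact: tameS.
by move=> rK; apply: nog; exists K.+1.
Qed.

Variable r : R.
Hypothesis r1 : 1 < r.

Definition nbox : nat := (Num.truncn (4 * r)).+1.
(** The spacing [1/2] is the side of a core, so the cores tile, and the shift by [1/4] starts them
    at [- r]. Indices are at most [4 r], so the unit boxes end at most at [r + 3/4]. *)
Definition corner (l : {ffun 'I_n -> 'I_nbox}) : 'rV[R]_n :=
  \row_j (- r - 4^-1 + (l j)%:R / 2).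

Lemma corner_core x : cube r x -> exists l, core (corner l) x.
Proof.
move=> cx.
have y0 j : 0 <= 2 * (x 0 j + r) by have := cx j; lra.
have lt (j : 'I_n) : (Num.truncn (2 * (x 0 j + r))%R < nbox)%N.
  by rewrite ltnS; apply: le_truncn; have := cx j; lra.
exists [ffun j => Ordinal (lt j)] => j; rewrite mxE ffunE/=.
have /andP[h1 h2] := truncn_itv (y0 j); rewrite -natr1 in h2.
have := cx j; lra.
Qed.

Lemma corner_box l : unit_box (corner l) `<=` cube (r + 1).
Proof.
move=> x cx j; have := cx j; rewrite mxE.
have : (l j)%:R <= 4 * r.
  apply: (@le_trans _ _ (Num.truncn (4 * r))%:R).
    by rewrite ler_nat -ltnS; case: (l j).
  by rewrite truncn_le mulr_ge0// ltW// (lt_trans _ r1).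
have : (0 : R) <= (l j)%:R by [].
lra.
Qed.

Definition nbad k F : nat :=
  #|[set p : {ffun 'I_n -> 'I_nbox} * {ffun 'I_n -> 'I_(base D ^ k)} |
      `[< bad D (corner p.1) k p.2 F >]]|.

Lemma nbad_le k F : (nbad k F <= nbox ^ n * base D ^ (k * n))%N.
Proof.
apply: leq_trans (max_card _) _.
by rewrite card_prod !card_ffun !card_ord -expnM.
Qed.

(** Pick a zero in each component and its least good level. Two components sharing level, unit box
    and cell have their zeros within [mesh k], where [close_zeros_connected] joins them inside the
    zero set; so distinct components are charged to distinct bad cells. The first alternative
    collects the fields with bad cells at arbitrarily deep levels. *)
Lemma components_le_nbad F (Z : set 'rV[R]_n) N (C : 'I_N -> set 'rV[R]_n) :
  smooth_on (cube (r + 1)) F ->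
  Z = [set x | cube (r + 1) x /\ F x = 0] ->
  injective C ->
  (forall j, exists x, Z x /\ C j = connected_component Z x /\ C j `<=` cube r) ->
  (forall K, exists2 k, (K <= k)%N & (0 < nbad k F)%N) \/
  (exists K, (N <= \sum_(k < K) nbad k F)%N).
Proof.
move=> sF ZE Cinj HC.
have [X HX] := choice HC.
have Xr j : cube r (X j).
  by have [Zx [E sub]] := HX j; apply: sub; rewrite E; exact: connected_component_refl.
have X0 j : F (X j) = 0 by have [+ _] := HX j; rewrite ZE => -[].
have [l Hl] := choice (fun j => corner_core (X j) (Xr j)).
have dich j := zero_level_dichotomy _ _ _ _ sF (corner_box (l j)) (Hl j) (X0 j).
have [[j Hj]|nio] := pselect (exists j, forall K, exists k t, (K <= k)%N /\ bad D (corner (l j)) k t F).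
  left => K; have [k [t [Kk bk]]] := Hj K; exists k => //.
  by apply/card_gt0P; exists (l j, t); rewrite inE; exact/asboolP.
right.
have good j : exists k, [/\ (0 < k)%N, tame D (corner (l j)) k F,
    regular D (X j) k F & forall t, cell D (corner (l j)) k t (X j) ->
    bad D (corner (l j)) k t F].
  by have [H|//] := dich j; exfalso; apply: nio; exists j.
have [kk Hkk] := choice good.
(* Cells are chosen for all levels at once because their type depends on the level; for components
   of equal level they can then be compared without casts. *)
have [t Ht] : exists t : forall k (j : 'I_N), {ffun 'I_n -> 'I_(base D ^ k)},
    forall k j, cell D (corner (l j)) k (t k j) (X j).
  have H k := choice (fun j => cell_exists D D2 _ k _ (core_box _ _ (Hl j))).
  by exists (fun k => projT1 (H k)) => k; exact: (projT2 (H k)).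
pose K := (\max_j kk j).+1.
have ltK j : (kk j < K)%N by rewrite ltnS; exact: leq_bigmax.
exists K.
rewrite -[X in (X <= _)%N](card_ord N) -sum1_card.
rewrite (partition_big (fun j => Ordinal (ltK j)) xpredT)//=.
apply: leq_sum => k _; rewrite sum1_card.
rewrite -(card_in_imset (f := fun j => (l j, t k j))).
  apply: subset_leq_card; apply/fintype.subsetP => p /imsetP[j]; rewrite unfold_in => /eqnP/= jk ->.
  rewrite inE; apply/asboolP => /=; have [_ _ _ H] := Hkk j.
  by move: H; rewrite jk; apply; exact: Ht.
move=> i j; rewrite !unfold_in => /eqnP/= ik /eqnP/= jk [lij tij].
apply: Cinj; have [Zi [-> _]] := HX i; have [Zj [-> _]] := HX j.
have [k0 tk rk _] := Hkk i; rewrite ik in k0 tk rk.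
have d : `|X j - X i| <= mesh D k.
  apply: mx_norm_le => [|a c]; first exact/ltW/mesh_gt0.
  have := Ht k i c; have := Ht k j c; rewrite -lij -tij ord1 !mxE.
  set u := _ + _; move=> /andP[? ?] /andP[? ?]; rewrite ler_norml; lra.
have [B [cB Bi Bj HB]] := close_zeros_connected D D4 m0 n0 _ _ _ _ _ _ sF
   (corner_box (l i)) tk k0 (Hl i) rk (X0 i) (X0 j) d.
apply: same_connected_component.
apply: (connected_component_max Bi) => //.
by move=> y /HB; rewrite ZE.
Qed.

End GlobalCount.

(** * Gaussian integrals *)

Section GaussianIntegrals.
Context {R : realType}.
Local Notation leb := (@lebesgue_measure R).
Local Notation gam := (@normal_prob R 0 1).

(** The density enters as a Radon-Nikodym derivative, which agrees with [normal_pdf] almost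
    everywhere because both have the same integral over every measurable set. *)
Lemma ge0_integral_normal_prob (m s : R) (g : R -> R) : measurable_fun setT g ->
  (forall x, 0 <= g x) ->
  (\int[normal_prob m s]_x (g x)%:E = \int[leb]_x (g x * normal_pdf m s x)%:E)%E.
Proof.
move=> mg g0; set nu := normal_prob m s; have dom : nu `<< leb := normal_prob_dominates m s.
have mg' : measurable_fun setT (fun x : R => (g x)%:E) by apply/measurable_EFinP.
have mpdf := measurable_normal_pdf m s.
rewrite -(@Radon_Nikodym_SigmaFinite.change_of_variables _ _ _ nu leb dom (EFin \o g))//.
have fi := Radon_Nikodym_SigmaFinite.f_integrable dom.
apply: ae_eq_integral => //.
- by apply: emeasurable_funM => //; exact: measurable_int fi.
- by apply/measurable_EFinP; apply: measurable_funM.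
- have : ae_eq leb setT (Radon_Nikodym_SigmaFinite.f nu leb) (EFin \o normal_pdf m s).
    apply: integral_ae_eq => //; first exact/measurable_EFinP.
    by move=> E _ mE; rewrite -Radon_Nikodym_SigmaFinite.f_integral.
  by apply: filterS => x H _ /=; rewrite H// EFinM.
Qed.

Lemma integral_normal_prob (m s : R) (g : R -> R) : measurable_fun setT g ->
  (\int[normal_prob m s]_x (g x)%:E = \int[leb]_x (g x * normal_pdf m s x)%:E)%E.
Proof.
move=> mg; rewrite [LHS]integralE [RHS]integralE.
have pos (f : R -> R) : (EFin \o f)^\+%E = (fun x => (Num.max (f x) 0)%:E).
  by apply/funext => x; rewrite funeposE /= EFin_max.
have neg (f : R -> R) : (EFin \o f)^\-%E = (fun x => (Num.max (- f x) 0)%:E).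
  by apply/funext => x; rewrite funenegE /= EFin_max.
rewrite -![(fun x => (_)%:E)]/(EFin \o _) !pos !neg.
rewrite !ge0_integral_normal_prob//.
- congr (_ - _)%E; apply: eq_integral => x _; congr EFin.
    by rewrite maxr_pMl ?normal_pdf_ge0// mul0r.
  by rewrite maxr_pMl ?normal_pdf_ge0// mul0r mulNr.
- by apply: measurable_maxr => //; exact: measurableT_comp.
- by move=> x; rewrite le_max lexx orbT.
- by apply: measurable_maxr.
- by move=> x; rewrite le_max lexx orbT.
Qed.

Lemma normal_pdf01 (x : R) : normal_pdf 0 1 x = normal_peak 1 * expR (- (x ^+ 2 / 2)).
Proof.
by rewrite normal_pdfE ?oner_neq0// /normal_fun subr0 expr1n mulNr.
Qed.

Let mX k : measurable_fun setT (fun x : R => (x ^+ k)%:E).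
Proof. by apply/measurable_EFinP; exact: measurable_funX. Qed.

Let mE (c : R) : measurable_fun setT (fun x : R => (expR (- (c * x ^+ 2 / 2)))%:E).
Proof.
apply/measurable_EFinP; apply: measurableT_comp => //; apply: measurableT_comp => //.
by apply: measurable_funM => //; apply: measurable_funM => //; exact: measurable_funX.
Qed.

(** The integrand times the standard density is [s] times the density of variance [s^2], with
    [s = (1 + c)^(-1/2)]. Negative [c] serves for the moments, positive [c] for the small ball
    estimate. *)
Lemma normal_exp_sq (c : R) : -1 < c ->
  (\int[gam]_x (expR (- (c * x ^+ 2 / 2)))%:E = ((Num.sqrt (1 + c))^-1)%:E)%E.
Proof.
move=> c1; have c0 : 0 < 1 + c by lra.
rewrite ge0_integral_normal_prob; last 2 first.
- apply: measurableT_comp => //; apply: measurableT_comp => //.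
  by apply: measurable_funM => //; apply: measurable_funM => //; exact: measurable_funX.
- by move=> x; exact: expR_ge0.
pose s := (Num.sqrt (1 + c))^-1.
have s0 : 0 < s by rewrite invr_gt0 sqrtr_gt0.
have s2 : s ^+ 2 = (1 + c)^-1 by rewrite exprVn sqr_sqrtr// ltW.
have -> : (\int[leb]_x (expR (- (c * x ^+ 2 / 2)) * normal_pdf 0 1 x)%:E =
  \int[leb]_x (s%:E * (normal_pdf 0 s x)%:E))%E.
  apply: eq_integral => x _; rewrite -EFinM; congr EFin.
  rewrite normal_pdf01 normal_pdfE ?gt_eqF// /normal_fun subr0 s2.
  rewrite mulrCA -expRD.
  have -> : - (c * x ^+ 2 / 2) + - (x ^+ 2 / 2) = - x ^+ 2 / ((1 + c)^-1 *+ 2) :> R.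
    by field; rewrite gt_eqF.
  rewrite [RHS]mulrA; congr GRing.mul.
  rewrite /normal_peak s2 expr1n mul1r.
  rewrite -mulrnAr sqrtrM ?invr_ge0 ?(ltW c0)// sqrtrV ?(ltW c0)// invfM invrK.
  by rewrite /s mulrA mulVf ?mul1r// gt_eqF// sqrtr_gt0.
rewrite integralZl//=; last exact: integrable_normal_pdf.
by rewrite integral_normal_pdf mule1.
Qed.

Lemma le_expR_quarter_sq (p : nat) (x : R) :
  x ^+ (2 * p) <= (p`! * 4 ^ p)%:R * expR (x ^+ 2 / 4).
Proof.
case: p => [|p].
  by rewrite expr0 mul1r -[leLHS]expR0 ler_expR divr_ge0// sqr_ge0.
have u0 : 0 <= x ^+ 2 / 4 by rewrite divr_ge0// sqr_ge0.
have := expR_ge1Dxn p u0; rewrite expr_div_n -exprM => H.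
have f0 : (0 : R) < (p.+1)`!%:R by rewrite ltr0n fact_gt0.
have q0 : (0 : R) < 4 ^+ p.+1 by rewrite exprn_gt0.
have := le_trans (ler_wpDl ler01 (lexx _)) H.
rewrite ler_pdivrMr// ler_pdivrMr// natrM natrX => /le_trans; apply.
by rewrite le_eqVlt; apply/orP; left; apply/eqP; ring.
Qed.

(** A term of the exponential series bounds [x^(2p)] by [p! 4^p exp (x^2 / 4)], and the mean of
    [exp (x^2 / 4)] is the square root of 2. *)
Lemma normal_moment (p : nat) :
  (\int[gam]_x (x ^+ (2 * p))%:E <= (2 * (p`! * 4 ^ p)%:R)%:E)%E.
Proof.
have c1 : -1 < - 2^-1 :> R by lra.
apply: (@le_trans _ _ (\int[gam]_x ((p`! * 4 ^ p)%:R%:E * (expR (- (- 2^-1 * x ^+ 2 / 2)))%:E))%E).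
  apply: ge0_le_integral => //=.
  - by move=> x _; rewrite lee_fin exprM exprn_ge0// sqr_ge0.
  - exact: mX.
  - by apply: emeasurable_funM => //; exact: mE.
  - move=> x _; rewrite -EFinM lee_fin; apply: le_trans (le_expR_quarter_sq p x) _.
    by rewrite ler_wpM2l// ler_expR; lra.
rewrite ge0_integralZl//; do ?exact: mE.
rewrite normal_exp_sq// -EFinM lee_fin mulrC ler_wpM2r//.
have q2 : (2^-1 : R) = 1 + - 2^-1 by lra.
rewrite -[leRHS]invrK lef_pV2 ?posrE ?sqrtr_gt0//; last by lra.
rewrite -(ler_pXn2r (n := 2)) ?nnegrE ?sqrtr_ge0// sqr_sqrtr; last by lra.
by rewrite exprVn; lra.
Qed.

Lemma normal_integrable (h : R -> R) (C : R) : measurable_fun setT h ->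
  (forall x, `|h x| <= C * (1 + x ^+ 2)) ->
  gam.-integrable setT (EFin \o h).
Proof.
move=> mh hC; apply/integrableP; split; first exact/measurable_EFinP.
apply: (@le_lt_trans _ _ (\int[gam]_x (C%:E * ((x ^+ (2 * 0))%:E + (x ^+ (2 * 1))%:E)))%E).
  apply: ge0_le_integral => //=.
  - by do 2 apply: measurableT_comp => //.
  - by apply: emeasurable_funM => //; apply: emeasurable_funD; exact: mX.
  - by move=> x _; rewrite lee_fin muln0 expr0 muln1; exact: hC.
have C0 : 0 <= C by have := le_trans (normr_ge0 _) (hC 0); rewrite expr0n/=; lra.
have X0 k (x : R) : [set: R] x -> (0 <= (x ^+ (2 * k))%:E)%E.
  by move=> _; rewrite lee_fin exprM exprn_ge0// sqr_ge0.
rewrite ge0_integralZl//; [|by apply: emeasurable_funD; exact: mX|by move=> x _; rewrite adde_ge0// X0].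
rewrite ge0_integralD//; do ?exact: mX; do ?by move=> x _; exact: X0.
apply: (@le_lt_trans _ _ (C%:E * ((2 * (0`! * 4 ^ 0)%:R)%:E + (2 * (1`! * 4 ^ 1)%:R)%:E)))%E; last exact: ltry.
by apply: lee_wpmul2l => //; apply: leeD; exact: normal_moment.
Qed.

End GaussianIntegrals.

(** * Integration by parts and the cosine transform *)

Section GaussianStein.
Context {R : realType}.
Local Notation leb := (@lebesgue_measure R).
Local Notation gam := (@normal_prob R 0 1).

(* [h' - x h] times the Gaussian density is the derivative of [h] times it. *)
Lemma normal_stein (h dh : R -> R) (C : R) : (forall x : R, is_derive x (1 : R) h (dh x)) ->
  continuous dh -> (forall x, `|h x| <= C * (1 + `|x|)) -> (forall x, `|dh x| <= C) ->
  (\int[gam]_x (dh x - x * h x)%:E = 0)%E.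
Proof.
move=> Dh cdh hC dhC.
have ch : continuous h by move=> x; apply: differentiable_continuous; apply/derivable1_diffP.
have C0 : 0 <= C by apply: le_trans (dhC 0).
pose k := fun x : R => dh x - x * h x.
have ck : continuous k.
  by move=> x; apply: cvgB; [exact: cdh|apply: cvgM => //; exact: ch].
have mk : measurable_fun setT k by exact: continuous_measurable_fun.
have kC x : `|k x| <= 3 * C * (1 + x ^+ 2).
  apply: le_trans (ler_normB _ _) _; rewrite normrM.
  have := ler_wpM2l (normr_ge0 x) (hC x); have := dhC x.
  have : 0 <= (1 - `|x|) ^+ 2 by exact: sqr_ge0.
  have xx : `|x| ^+ 2 = x ^+ 2 by rewrite real_normK// num_real.
  have := mulr_ge0 C0 (normr_ge0 x); have := mulr_ge0 C0 (sqr_ge0 x).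
  rewrite -xx => h1 h2 h3 h4 h5.
  have h6 := mulr_ge0 C0 h3.
  have e1 : C * (1 - `|x|) ^+ 2 = C - 2 * (C * `|x|) + C * `|x| ^+ 2 by ring.
  have e2 : `|x| * (C * (1 + `|x|)) = C * `|x| + C * `|x| ^+ 2 by ring.
  have e3 : 3 * C * (1 + `|x| ^+ 2) = 3 * C + 3 * (C * `|x| ^+ 2) by ring.
  rewrite e1 in h6; rewrite e2 in h5; rewrite e3.
  move: h1 h2 h4 h5 h6 C0; set a := C * `|x|; set b := C * `|x| ^+ 2; lra.
have ik := normal_integrable k (3 * C) mk kC.
pose G := fun x : R => normal_peak 1 * (h x * expR (- (x ^+ 2 / 2))).
pose g := fun x : R => k x * normal_pdf 0 1 x.
have dG x : is_derive x (1 : R) G (g x).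
  have De : is_derive x (1:R) (fun y : R => expR (- (y ^+ 2 / 2))) (- x * expR (- (x ^+ 2 / 2))).
    apply: is_derive_eq; rewrite /GRing.scale/=; by field.
  rewrite /G; apply: is_derive_eq; rewrite /GRing.scale/= /g /k normal_pdf01; ring.
rewrite (integral_normal_prob 0 1 k mk) -/(g _).
have mg : measurable_fun setT g.
  by apply: measurable_funM => //; exact: measurable_normal_pdf.
have cg : continuous g.
  by move=> x; apply: cvgM; [exact: ck|exact: continuous_normal_pdf (oner_neq0 _) _].
have ig : leb.-integrable setT (EFin \o g).
  apply/integrableP; split; first exact/measurable_EFinP.
  have /integrableP[_] := ik.
  under eq_integral do rewrite /=.
  rewrite (integral_normal_prob 0 1 (fun x => `|k x|)); last exact: measurableT_comp.
  by under eq_integral => x _ do rewrite -(ger0_norm (normal_pdf_ge0 0 1 x)) -normrM.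
pose f_ (N : nat) := (EFin \o g) \_ `[(- N%:R : R), N%:R].
have int_f N : (\int[leb]_x f_ N.+1 x = (G N.+1%:R - G (- N.+1%:R))%:E)%E.
  rewrite -integral_mkcond; apply: continuous_FTC2.
  - by rewrite (lt_trans _ (ltr0Sn _ _))// oppr_lt0 ltr0Sn.
  - exact: continuous_subspaceT.
  - have cG : continuous G by move=> x; apply: differentiable_continuous; apply/derivable1_diffP.
    split.
    + by move=> x _; have [] := dG x.
    + by apply: cvg_at_right_filter; exact: cG.
    + by apply: cvg_at_left_filter; exact: cG.
  - by move=> x _; rewrite derive1E; have := dG x => -[_ ->].
have [|||||_ _ cv] := @dominated_convergence _ _ _ leb setT measurableT f_ (EFin \o g) (abse \o (EFin \o g)).
- by move=> n; apply/(measurable_restrictT _ _).1 => //; apply/measurable_funTS; apply/measurable_EFinP.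
- by apply/measurable_EFinP.
- apply: aeW => x _; apply: cvg_near_cst; near=> n.
  rewrite /f_ patchE mem_set//= in_itv/= -ler_norml.
  by near: n; exact: nbhs_infty_ger.
- by apply: integrable_abse.
- apply: aeW => x n _; rewrite /f_ patchE; case: ifP => // _.
  by rewrite -[point]/(0%E : \bar R) abse0 abse_ge0.
(* The boundary terms vanish: [(1 + x^2 / 2) exp (- x^2 / 2) <= 1] and the linear growth of [h]
   leave a decay of order [1 / |x|]. *)
have bG (x : R) : 0 < `|x| -> `|G x| <= 4 * C * normal_peak 1 * `|x|^-1.
  move=> x0; rewrite /G normrM (ger0_norm (normal_peak_ge0 1)) normrM (ger0_norm (expR_ge0 _)).
  rewrite ler_pdivlMr//; set E := expR _.
  have xx : `|x| ^+ 2 = x ^+ 2 by rewrite real_normK// num_real.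
  have E1 : (1 + x ^+ 2 / 2) * E <= 1.
    by rewrite /E expRN ler_pdivrMr ?expR_gt0// mul1r expR_ge1Dx.
  have E0 : 0 <= E by exact: expR_ge0.
  have H : `|h x| * `|x| <= 4 * C * (1 + x ^+ 2 / 2).
    apply: le_trans (ler_wpM2r (normr_ge0 x) (hC x)) _.
    have -> : C * (1 + `|x|) * `|x| = C * (`|x| + `|x| ^+ 2) by ring.
    have -> : 4 * C * (1 + x ^+ 2 / 2) = C * (4 + 2 * `|x| ^+ 2) by rewrite xx; by field.
    apply: ler_wpM2l => //; have : 0 <= (1 - `|x|) ^+ 2 by exact: sqr_ge0.
    have -> : (1 - `|x|) ^+ 2 = 1 - 2 * `|x| + `|x| ^+ 2 by ring.
    have := sqr_ge0 `|x|; lra.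
  have -> : normal_peak 1 * (`|h x| * E) * `|x| = normal_peak 1 * (`|h x| * `|x| * E) by ring.
  have -> : 4 * C * normal_peak 1 = normal_peak 1 * (4 * C * 1) :> R by ring.
  apply: ler_wpM2l; first exact: normal_peak_ge0.
  apply: le_trans (ler_wpM2r E0 H) _; rewrite -[leLHS]mulrA; apply: ler_wpM2l => //.
  by rewrite mulr_ge0.
have c0 : (G N.+1%:R - G (- N.+1%:R)) @[N --> \oo] --> (0 : R).
  pose K := 8 * C * normal_peak 1 : R.
  have K0 : K * harmonic N @[N --> \oo] --> (0 : R).
    by rewrite -(mulr0 K); apply: cvgM; [exact: cvg_cst|exact: cvg_harmonic].
  apply: (@squeeze_cvgr _ _ _ _ (fun N => - (K * harmonic N)) (fun N => K * harmonic N)) => //.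
    apply: nearW => N; rewrite -ler_norml; apply: le_trans (ler_normB _ _) _.
    have N0 : (0 : R) < `|N.+1%:R| by rewrite normr_gt0.
    have := bG _ N0; have := bG (- N.+1%:R); rewrite normrN => /(_ N0).
    rewrite (ger0_norm (_ : 0 <= N.+1%:R)) // -[N.+1%:R^-1]/(harmonic N) /K; lra.
  by rewrite -oppr0; apply: cvgN.
have c1 : (\int[leb]_x f_ N.+1 x)%E @[N --> \oo] --> 0%E.
  under eq_fun do rewrite int_f.
  apply: cvg_EFin => /=; [exact: nearW|exact: c0].
have c2 : (\int[leb]_x f_ N.+1 x)%E @[N --> \oo] --> (\int[leb]_x (EFin \o g) x)%E.
  by move: cv; rewrite -cvg_shiftS.
by have := cvg_unique _ c2 c1; apply.
Unshelve. all: by end_near. Qed.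

Lemma normal_mean : (\int[gam]_x x%:E = 0)%E.
Proof.
have := @normal_stein (fun=> -1) (fun=> 0) 1; rewrite /=.
under eq_integral do rewrite sub0r mulrN1 opprK.
apply.
- by move=> x; exact: cvg_cst.
- by move=> x; rewrite normrN1 mul1r lerDl.
- by move=> x; rewrite normr0.
Qed.

Let normal_one : (\int[gam]_x (1 : R)%:E = 1)%E.
Proof.
rewrite integral_cst// mul1e.
exact: (@probability_setT _ _ _ (normal_prob (0 : R) 1)).
Qed.

Lemma normal_second_moment : (\int[gam]_x (x ^+ 2)%:E = 1)%E.
Proof.
have H : (\int[gam]_x (1 - x * x)%:E = 0)%E.
  apply: (@normal_stein id (fun=> 1) 1).
  - by move=> x; exact: cvg_cst.
  - by move=> x; rewrite mul1r lerDr.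
  - by move=> x; rewrite normr1.
have i2 : gam.-integrable setT (EFin \o (fun x : R => x ^+ 2)).
  apply: (normal_integrable _ 1); first exact: measurable_funX.
  by move=> x; rewrite mul1r ger0_norm ?sqr_ge0// lerDr.
have i1 : gam.-integrable setT (EFin \o (fun x : R => 1)).
  apply: (normal_integrable _ 1); first exact: measurable_cst.
  by move=> x; rewrite mul1r normr1 lerDl sqr_ge0.
have := H; under eq_integral => x _ do rewrite -expr2 EFinB.
rewrite integralB// normal_one => E.
have fin : (\int[gam]_x (x ^+ 2)%:E)%E \is a fin_num by exact: integrable_fin_num i2.
by move/eqP : E; rewrite sube_eq// ?fin_num_adde_defr// add0e => /eqP <-.
Qed.

(** The mean [phi s] of [cos (s x)] solves [phi' = - s phi]: differentiate under the integral and
    apply [normal_stein] to [sin (s x)]. Hence [phi s * exp (s^2 / 2)] is constant, with value 1 at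
    [s = 0]. *)
Lemma normal_cos (t : R) : (\int[gam]_x (cos (t * x))%:E = (expR (- (t ^+ 2 / 2)))%:E)%E.
Proof.
have mcos (s : R) : measurable_fun setT (fun x : R => cos (s * x)).
  apply: continuous_measurable_fun => x; apply: continuous_comp; last exact: continuous_cos.
  by apply: cvgM; [exact: cvg_cst|exact: cvg_id].
have icos (s : R) : gam.-integrable setT (EFin \o (fun x : R => cos (s * x))).
  apply: (normal_integrable _ 1) => // x; rewrite mul1r; apply: le_trans (cos_max _) _.
  by rewrite lerDl sqr_ge0.
pose phi (s : R) := (\int[gam]_x cos (s * x))%R.
have Dphi (s : R) : is_derive s (1 : R) phi (- s * phi s).
  have Df (u x : R) : is_derive u (1 : R) (fun v : R => cos (v * x)) (- (x * sin (u * x))).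
    apply: is_derive_eq; rewrite /GRing.scale/=; ring.
  have int_ : forall x, `]s - 1, s + 1[%classic x -> gam.-integrable setT (EFin \o (fun y => cos (x * y))).
    by move=> x _; exact: icos.
  have Is : `]s - 1, s + 1[%classic s by rewrite /= in_itv/=; lra.
  have iabs : gam.-integrable setT (EFin \o (fun x : R => `|x|)).
    apply: (normal_integrable _ 1); first exact: measurableT_comp.
    move=> x; rewrite mul1r normr_id; have : 0 <= (1 - `|x|) ^+ 2 by exact: sqr_ge0.
    have -> : (1 - `|x|) ^+ 2 = 1 - 2 * `|x| + x ^+ 2.
      by rewrite -[x ^+ 2]real_normK ?num_real//; ring.
    have := normr_ge0 x; lra.
  have bd : forall x y, `]s - 1, s + 1[%classic x -> setT y ->
      `|partial1of2 (fun v y : R => cos (v * y)) x y| <= `|y|.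
    move=> x y _ _; rewrite partial1of2E; have -> := @derive_val _ _ _ _ _ _ _ (Df x y).
    by rewrite normrN normrM ler_piMr// sin_max.
  have dd : forall x y, `]s - 1, s + 1[%classic x -> setT y ->
      derivable (fun v : R => cos (v * y)) x 1 by move=> x y _ _; have [] := Df x y.
  have g0 : forall y : R, 0 <= `|y| by [].
  have dphi := @derivable_under_integral R _ _ gam _ setT measurableT s _ _ Is int_ dd _ g0 iabs bd.
  have vphi := @differentiation_under_integral R _ _ gam _ setT measurableT s _ _ Is int_ dd _ g0 iabs bd.
  split => //; rewrite -derive1E vphi.
  have st : (\int[gam]_x (s * cos (s * x) - x * sin (s * x))%:E = 0)%E.
    apply: (@normal_stein (fun x => sin (s * x)) (fun x => s * cos (s * x)) (1 + `|s|)).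
    - move=> x; apply: is_derive_eq; rewrite /GRing.scale/=; ring.
    - move=> x; apply: cvgM; first exact: cvg_cst.
      apply: continuous_comp; last exact: continuous_cos.
      by apply: cvgM; [exact: cvg_cst|exact: cvg_id].
    - move=> x; apply: le_trans (sin_max _) _; rewrite -[leLHS]mulr1.
      by apply: ler_pM => //; rewrite lerDl.
    - move=> x; rewrite normrM; have := cos_max (s * x); have := normr_ge0 s => a b.
      have := ler_wpM2l a b; lra.
  have isin : gam.-integrable setT (EFin \o (fun x : R => x * sin (s * x))).
    apply: (le_integrable measurableT _ _ iabs).
      apply/measurable_EFinP; apply: measurable_funM => //.
      apply: continuous_measurable_fun => x; apply: continuous_comp; last exact: continuous_sin.
      by apply: cvgM; [exact: cvg_cst|exact: cvg_id].
    by move=> x _; rewrite /= lee_fin normr_id normrM ler_piMr// sin_max.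
  have isc : gam.-integrable setT (EFin \o (fun x : R => s * cos (s * x))).
    by have := @integrableZl _ _ _ gam setT measurableT s _ (icos s); under eq_fun do rewrite -EFinM.
  have := congr1 fine st; rewrite -[fine _]/(\int[gam]_x _)%R RintegralB// RintegralZl// => /eqP.
  rewrite subr_eq0 => /eqP E; rewrite mulNr /phi E.
  have -> : (fun y : R => partial1of2 (fun v y : R => cos (v * y)) s y) = (fun y => -1 * (y * sin (s * y))).
    by apply/funext => y; rewrite partial1of2E; have -> := @derive_val _ _ _ _ _ _ _ (Df s y); ring.
  by rewrite RintegralZl// mulN1r.
have dcst (s : R) : is_derive s (1 : R) (fun s : R => phi s * expR (s ^+ 2 / 2)) 0.
  apply: is_derive_eq; rewrite /GRing.scale/=; by field.
have := @is_derive_0_is_cst _ _ t 0 dcst.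
rewrite expr0n/= mul0r expR0 mulr1.
have -> : phi 0 = 1.
  rewrite /phi /Rintegral; under eq_integral do rewrite mul0r cos0.
  by rewrite normal_one.
move=> E; have phiE : phi t = expR (- (t ^+ 2 / 2)).
  apply: (@mulIf _ (expR (t ^+ 2 / 2))); first by rewrite gt_eqF ?expR_gt0.
  by rewrite E -expRD addNr expR0.
by rewrite -phiE /phi /Rintegral fineK//; exact: integrable_fin_num (icos t).
Qed.

End GaussianStein.

Section GaussianVariables.
Context {R : realType}.
Local Notation leb := (@lebesgue_measure R).
Local Notation gam := (@normal_prob R 0 1).

Lemma ge0_integral_normal_affine (m s : R) (g : R -> R) : s != 0 ->
  continuous g -> (forall x, 0 <= g x) ->
  (\int[normal_prob m s]_x (g x)%:E = \int[gam]_y (g (m + `|s| * y))%:E)%E.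
Proof.
move=> s0 cg g0; have sp : 0 < `|s| by rewrite normr_gt0.
pose F := fun y : R => m + `|s| * y.
have dF y : is_derive y (1 : R) F `|s|.
  rewrite /F; apply: is_derive_eq; rewrite /GRing.scale/=; ring.
have F'E : F^`()%classic = cst `|s|.
  by apply/funext => y; rewrite derive1E; have [_ ->] := dF y.
have cF : continuous F by move=> y; apply: differentiable_continuous; apply/derivable1_diffP.
have mg : measurable_fun setT g by exact: continuous_measurable_fun.
have cgF : continuous (fun y => g (F y)).
  by move=> y; apply: continuous_comp; [exact: cF|exact: cg].
have mgF : measurable_fun setT (fun y => g (F y)) by exact: continuous_measurable_fun.
have E1 := ge0_integral_normal_prob m s g mg g0.
have E2 := ge0_integral_normal_prob 0 1 _ mgF (fun y => g0 _).
apply: (etrans E1); apply: (etrans _ (esym E2)).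
apply: (etrans (@increasing_ge0_integration_by_substitutionT R F (fun x => g x * normal_pdf m s x) _ _ _ _ _ _ _ _ _)).
- by move=> x y xy; rewrite /F ltrD2l ltr_pM2l.
- by rewrite F'E => y; exact: cvg_cst.
- by rewrite F'E; exact: is_cvg_cst.
- by rewrite F'E; exact: is_cvg_cst.
- by move=> y; have [] := dF y.
- apply/cvgrNyPle => A; near=> y.
  have : y <= (A - m) / `|s| by near: y; exact: nbhs_ninfty_le (num_real _).
  by rewrite ler_pdivlMr// /F; lra.
- apply/cvgryPge => A; near=> y.
  have : (A - m) / `|s| <= y by near: y; exact: nbhs_pinfty_ge (num_real _).
  by rewrite ler_pdivrMr// /F; lra.
- by move=> x; apply: cvgM; [exact: cg|exact: continuous_normal_pdf].
- by move=> x; rewrite mulr_ge0// normal_pdf_ge0.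
apply: eq_integral => y _; rewrite F'E /= !fctE/=; congr EFin.
rewrite -mulrA; congr (_ * _).
rewrite normal_pdf01 normal_pdfE// /normal_fun /F addrAC subrr add0r.
have E : - (`|s| * y) ^+ 2 / (s ^+ 2 *+ 2) = - (y ^+ 2 / 2) :> R.
  rewrite exprMn real_normK ?num_real//; field.
  by rewrite s0.
rewrite E mulrAC; congr (_ * _).
rewrite /normal_peak expr1n mul1r -mulrnAr sqrtrM ?sqr_ge0// sqrtr_sqr invfM.
by rewrite mulrAC mulVf ?mul1r// gt_eqF.
Unshelve. all: by end_near. Qed.

Lemma eq_integral_continuous {d1 d2} {T1 : measurableType d1} {T2 : measurableType d2}
    (m1 : {measure set T1 -> \bar R}) (m2 : {measure set T2 -> \bar R})
    (f1 : T1 -> R) (f2 : T2 -> R) :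
  (forall g : R -> R, continuous g -> (forall x, 0 <= g x) ->
     (\int[m1]_w (g (f1 w))%:E = \int[m2]_w (g (f2 w))%:E)%E) ->
  forall g : R -> R, continuous g ->
     (\int[m1]_w (g (f1 w))%:E = \int[m2]_w (g (f2 w))%:E)%E.
Proof.
move=> H g cg; rewrite [LHS]integralE [RHS]integralE.
have pos (U : Type) (f : U -> R) : (fun x => (f x)%:E)^\+%E = (fun x => (Num.max (f x) 0)%:E).
  by apply/funext => x; rewrite funeposE /= EFin_max.
have neg (U : Type) (f : U -> R) : (fun x => (f x)%:E)^\-%E = (fun x => (Num.max (- f x) 0)%:E).
  by apply/funext => x; rewrite funenegE /= EFin_max.
rewrite !pos !neg; congr (_ - _)%E.
- apply: (H (fun x => Num.max (g x) 0)).
    by move=> x; apply: continuous_max; [exact: cg|exact: cvg_cst].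
  by move=> x; rewrite le_max lexx orbT.
- pose h := fun x => - g x; apply: (H (fun x => Num.max (h x) 0)).
    by move=> x; apply: continuous_max; [apply: cvgN; exact: cg|exact: cvg_cst].
  by move=> x; rewrite le_max lexx orbT.
Qed.

Context {d : measure_display} {T : measurableType d}.
Variable P : probability T R.

(** The law tested on continuous functions. Point masses are included as [s = 0], so that degenerate
    variables need no separate treatment afterwards. *)
Lemma gaussian_rv_integral (X : T -> R) : gaussian_rv P X ->
  exists m s : R, 0 <= s /\ forall g : R -> R, continuous g ->
  (\int[P]_w (g (X w))%:E = \int[gam]_y (g (m + s * y))%:E)%E.
Proof.
move=> [mX [m [s HX]]]; exists m, `|s|; split => //.
apply: eq_integral_continuous => g cg g0.
have mg : measurable_fun setT (EFin \o g).
  by apply/measurable_EFinP; exact: continuous_measurable_fun.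
pose X' : T -> measurableTypeR R := X.
have mX' : measurable_fun setT X' by exact: mX.
have E := @ge0_integral_pushforward _ _ T (measurableTypeR R) R X' mX' P setT (EFin \o g) measurableT mg (fun y _ => g0 y).
rewrite preimage_setT in E; apply: (etrans (esym E)).
have [s0|s0] := eqVneq s 0.
  pose nu : {measure set (measurableTypeR R) -> \bar R} := \d_(m : measurableTypeR R).
  have H (A : set (measurableTypeR R)) : measurable A -> A `<=` setT -> pushforward P X' A = nu A.
    by move=> mA _; apply: (etrans (HX A mA)); rewrite s0 eqxx.
  apply: (etrans (eq_measure_integral nu H)); first exact: mX'.
  rewrite s0 normr0 integral_dirac// diracT mul1e/=.
  under eq_integral do rewrite mul0r addr0.
  rewrite integral_cst//.
  by rewrite [X in (_ * X)%E](@probability_setT _ _ _ (normal_prob (0 : R) 1)) mule1.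
pose nu : {measure set (measurableTypeR R) -> \bar R} := normal_prob m s.
have H (A : set (measurableTypeR R)) : measurable A -> A `<=` setT -> pushforward P X' A = nu A.
  by move=> mA _; apply: (etrans (HX A mA)); rewrite (negbTE s0).
apply: (etrans (eq_measure_integral nu H)); first exact: mX'.
exact: ge0_integral_normal_affine.
Qed.

End GaussianVariables.

(** * Square integrable random variables *)

Section SquareIntegrable.
Context {R : realType} {d : measure_display} {T : measurableType d}.
Variable P : probability T R.
Implicit Types (X Y : T -> R).

Local Notation integrableP X := (P.-integrable setT (EFin \o (X : T -> R))).

Lemma bounded_integrable X (C : R) : measurable_fun setT X ->
  (forall w, `|X w| <= C) -> integrableP X.
Proof.
move=> mX XC.
have ic : integrableP (fun=> C) by exact: finite_measure_integrable_cst.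
apply: (le_integrable measurableT _ _ ic); first exact/measurable_EFinP.
by move=> w _; rewrite /= lee_fin (le_trans (XC w))// ler_norm.
Qed.

Lemma ExD X Y : integrableP X -> integrableP Y ->
  Ex P (fun w => X w + Y w) = Ex P X + Ex P Y.
Proof. by move=> iX iY; exact: (RintegralD measurableT iX iY). Qed.

Lemma ExZ (a : R) X : integrableP X -> Ex P (fun w => a * X w) = a * Ex P X.
Proof. by move=> iX; exact: (RintegralZl a measurableT iX). Qed.

Lemma ExB X Y : integrableP X -> integrableP Y ->
  Ex P (fun w => X w - Y w) = Ex P X - Ex P Y.
Proof. by move=> iX iY; exact: (RintegralB measurableT iX iY). Qed.

Lemma Ex_ge0 X : (forall w, 0 <= X w) -> 0 <= Ex P X.
Proof. by move=> X0; apply: Rintegral_ge0. Qed.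

Lemma Ex_le X Y : integrableP X -> integrableP Y -> (forall w, X w <= Y w) ->
  Ex P X <= Ex P Y.
Proof. by move=> iX iY XY; apply: le_Rintegral. Qed.

Lemma Ex_norm X : integrableP X -> `|Ex P X| <= Ex P (fun w => `|X w|).
Proof. by move=> iX; exact: (le_normr_Rintegral measurableT iX). Qed.

Lemma Ex_cst (c : R) : Ex P (fun=> c) = c.
Proof.
rewrite -[LHS]/(\int[P]_w c)%R Rintegral_cst//.
by apply: (etrans (congr1 (fun z => c * fine z) (@probability_setT _ _ _ P))); rewrite mulr1.
Qed.

Lemma Ex_EFin X : integrableP X -> (\int[P]_w (X w)%:E = (Ex P X)%:E)%E.
Proof. by move=> iX; rewrite fineK//; exact: integrable_fin_num iX. Qed.

Lemma integrable_fD X Y : integrableP X -> integrableP Y ->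
  integrableP (fun w => X w + Y w).
Proof. by move=> iX iY; have := integrableD measurableT iX iY; under eq_fun do rewrite -EFinD. Qed.

Lemma integrable_fZ (a : R) X : integrableP X -> integrableP (fun w => a * X w).
Proof. by move=> iX; have := integrableZl measurableT a iX; under eq_fun do rewrite -EFinM. Qed.

Definition L2 X := measurable_fun setT X /\ integrableP (fun w => X w ^+ 2).

Lemma L2_meas X : L2 X -> measurable_fun setT X. Proof. by case. Qed.

Lemma L2_sq X : L2 X -> integrableP (fun w => X w ^+ 2). Proof. by case. Qed.

Lemma L2_mul X Y : L2 X -> L2 Y -> integrableP (fun w => X w * Y w).
Proof.
move=> [mX iX] [mY iY].
apply: (le_integrable measurableT _ _ (integrable_fD _ _ iX iY)).
  by apply/measurable_EFinP; apply: measurable_funM.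
move=> w _; rewrite /= lee_fin [leRHS]ger0_norm ?addr_ge0 ?sqr_ge0//.
rewrite normrM; have : 0 <= (`|X w| - `|Y w|) ^+ 2 by exact: sqr_ge0.
have -> : (`|X w| - `|Y w|) ^+ 2 = X w ^+ 2 - 2 * (`|X w| * `|Y w|) + Y w ^+ 2.
  by rewrite -[X w ^+ 2]real_normK ?num_real// -[Y w ^+ 2]real_normK ?num_real//; ring.
have := mulr_ge0 (normr_ge0 (X w)) (normr_ge0 (Y w)); lra.
Qed.

Lemma L2_lin (a : R) X Y : L2 X -> L2 Y -> L2 (fun w => a * X w + Y w).
Proof.
move=> LX LY; split.
  by apply: measurable_funD; [apply: measurable_funM => //; exact: L2_meas|exact: L2_meas].
rewrite (_ : (fun w => _) = fun w => (a ^+ 2 * X w ^+ 2 + 2 * a * (X w * Y w)) + Y w ^+ 2).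
  apply: integrable_fD; last exact: L2_sq.
  by apply: integrable_fD; apply: integrable_fZ; [exact: L2_sq|exact: L2_mul].
by apply/funext => w; ring.
Qed.

Lemma L2_cst (c : R) : L2 (fun=> c).
Proof. by split => //; exact: finite_measure_integrable_cst. Qed.

Lemma L2_integrable X : L2 X -> integrableP X.
Proof.
by move=> LX; have := L2_mul _ _ LX (L2_cst 1); under eq_fun do rewrite mulr1.
Qed.

Lemma L2_sub X Y : L2 X -> L2 Y -> L2 (fun w => X w - Y w).
Proof.
move=> LX LY; have := L2_lin (-1) _ _ LY LX.
by under eq_fun do rewrite mulN1r addrC.
Qed.

Lemma L2_add X Y : L2 X -> L2 Y -> L2 (fun w => X w + Y w).
Proof. by move=> LX LY; have := L2_lin 1 _ _ LX LY; under eq_fun do rewrite mul1r. Qed.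

Lemma L2_scale (a : R) X : L2 X -> L2 (fun w => a * X w).
Proof.
move=> LX; have := L2_lin a _ _ LX (L2_cst 0).
by under eq_fun do rewrite addr0.
Qed.

Definition nrm2 X : R := Ex P (fun w => X w ^+ 2).

Lemma nrm2_ge0 X : 0 <= nrm2 X.
Proof. by apply: Ex_ge0 => w; exact: sqr_ge0. Qed.

Lemma nrm2_lin (a : R) X Y : L2 X -> L2 Y ->
  nrm2 (fun w => a * X w + Y w) =
  a ^+ 2 * nrm2 X + 2 * a * Ex P (fun w => X w * Y w) + nrm2 Y.
Proof.
move=> LX LY; rewrite /nrm2.
have -> : (fun w => (a * X w + Y w) ^+ 2) =
  fun w => (a ^+ 2 * X w ^+ 2 + 2 * a * (X w * Y w)) + Y w ^+ 2 by apply/funext => w; ring.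
have i1 := L2_sq _ LX; have i2 := L2_mul _ _ LX LY; have i3 := L2_sq _ LY.
rewrite ExD//; last by apply: integrable_fD; exact: integrable_fZ.
rewrite ExD ?ExZ//; exact: integrable_fZ.
Qed.

Lemma cauchy_schwarz X Y : L2 X -> L2 Y ->
  (Ex P (fun w => X w * Y w)) ^+ 2 <= nrm2 X * nrm2 Y.
Proof.
move=> LX LY; set e := Ex P _.
have H (a : R) : 0 <= a ^+ 2 * nrm2 X + 2 * a * e + nrm2 Y.
  by rewrite -nrm2_lin//; exact: nrm2_ge0.
have := nrm2_ge0 X; rewrite le_eqVlt => /orP[/eqP nX0|nX].
  have [->|e0] := eqVneq e 0; first by rewrite expr0n/= -nX0 mul0r.
  exfalso; have := H (- (nrm2 Y + 1) / (2 * e)); rewrite -nX0 mulr0 add0r.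
  have -> : 2 * (- (nrm2 Y + 1) / (2 * e)) * e = - (nrm2 Y + 1) by field.
  lra.
have := H (- e / nrm2 X).
have -> : (- e / nrm2 X) ^+ 2 * nrm2 X + 2 * (- e / nrm2 X) * e + nrm2 Y =
   (nrm2 X * nrm2 Y - e ^+ 2) / nrm2 X by field; rewrite gt_eqF.
by rewrite pmulr_lge0 ?invr_gt0// subr_ge0.
Qed.

Lemma Ex_mul_le X Y : L2 X -> L2 Y ->
  `|Ex P (fun w => X w * Y w)| <= Num.sqrt (nrm2 X) * Num.sqrt (nrm2 Y).
Proof.
move=> LX LY; rewrite -sqrtrM ?nrm2_ge0// -sqrtr_sqr ler_sqrt ?mulr_ge0 ?nrm2_ge0//.
exact: cauchy_schwarz.
Qed.

Lemma nrm2_triangle X Y : L2 X -> L2 Y ->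
  Num.sqrt (nrm2 (fun w => X w + Y w)) <= Num.sqrt (nrm2 X) + Num.sqrt (nrm2 Y).
Proof.
move=> LX LY; have := nrm2_lin 1 _ _ LX LY.
under [X in nrm2 X]eq_fun do rewrite mul1r.
have s0 : 0 <= Num.sqrt (nrm2 X) + Num.sqrt (nrm2 Y) by rewrite addr_ge0 ?sqrtr_ge0.
move=> E; rewrite -[leRHS](ger0_norm s0) -sqrtr_sqr ler_sqrt ?sqr_ge0// E.
have := ler_norm (Ex P (fun w => X w * Y w)); have := Ex_mul_le _ _ LX LY.
have -> : (Num.sqrt (nrm2 X) + Num.sqrt (nrm2 Y)) ^+ 2 =
  nrm2 X + 2 * (Num.sqrt (nrm2 X) * Num.sqrt (nrm2 Y)) + nrm2 Y.
  transitivity (Num.sqrt (nrm2 X) ^+ 2 + 2 * (Num.sqrt (nrm2 X) * Num.sqrt (nrm2 Y)) +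
    Num.sqrt (nrm2 Y) ^+ 2); first by ring.
  by rewrite !sqr_sqrtr ?nrm2_ge0.
lra.
Qed.

Lemma nrm2_sub_le X Y : L2 X -> L2 Y -> nrm2 (fun w => X w + Y w) <= 2 * nrm2 X + 2 * nrm2 Y.
Proof.
move=> LX LY; rewrite /nrm2.
have i1 := L2_sq _ LX; have i3 := L2_sq _ LY.
rewrite -!ExZ// -ExD; [|exact: integrable_fZ|exact: integrable_fZ].
apply: Ex_le => [||w].
- exact: (L2_sq _ (L2_add _ _ LX LY)).
- by apply: integrable_fD; exact: integrable_fZ.
- have := sqr_ge0 (X w - Y w).
  have -> : (X w - Y w) ^+ 2 = 2 * X w ^+ 2 + 2 * Y w ^+ 2 - (X w + Y w) ^+ 2 by ring.
  lra.
Qed.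

Lemma nrm2_scale (a : R) X : L2 X -> nrm2 (fun w => a * X w) = a ^+ 2 * nrm2 X.
Proof.
move=> LX; rewrite /nrm2 -ExZ; last exact: L2_sq.
by congr Ex; apply/funext => w; rewrite exprMn.
Qed.

Lemma Ex_abs_le X : L2 X -> Ex P (fun w => `|X w|) <= Num.sqrt (nrm2 X).
Proof.
move=> LX; have LaX : L2 (fun w => `|X w|).
  split; first by apply: measurableT_comp => //; exact: L2_meas.
  by under eq_fun do rewrite real_normK ?num_real//; exact: L2_sq.
have := Ex_mul_le _ _ LaX (L2_cst 1).
have -> : nrm2 (fun=> 1) = 1 by rewrite /nrm2 expr1n Ex_cst.
have -> : nrm2 (fun w => `|X w|) = nrm2 X.
  by rewrite /nrm2; congr Ex; apply/funext => w; rewrite real_normK ?num_real.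
rewrite sqrtr1 mulr1; under [X in `|Ex P X|]eq_fun do rewrite mulr1.
by apply: le_trans; exact: ler_norm.
Qed.

Lemma measurable_gt X (a : R) : measurable_fun setT X -> measurable [set w | a < `|X w|].
Proof.
move=> mX; have mnX : measurable_fun setT (fun w => `|X w|) by exact: measurableT_comp.
rewrite (_ : [set w | _] = setT `&` (fun w => `|X w|) @^-1` `]a, +oo[%classic).
  by apply: mnX => //; exact: measurable_itv.
by rewrite setTI; apply/seteqP; split => w /=; rewrite in_itv/= andbT.
Qed.

Lemma markov_even X (p : nat) (a : R) : 0 < a -> measurable_fun setT X ->
  integrableP (fun w => X w ^+ (2 * p)) ->
  (P [set w | (a < `|X w|)%R] <= (a ^- (2 * p) * Ex P (fun w => X w ^+ (2 * p)))%:E)%E.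
Proof.
move=> a0 mX iX; have mA := measurable_gt _ a mX.
have X0 w : 0 <= X w ^+ (2 * p) by rewrite exprM exprn_ge0// sqr_ge0.
have ap : 0 < a ^+ (2 * p) by rewrite exprn_gt0.
rewrite -[leLHS]mul1e -integral_cst//.
apply: (@le_trans _ _ (\int[P]_(w in [set w | (a < `|X w|)%R]) (a ^- (2 * p) * X w ^+ (2 * p))%:E)%E).
  apply: ge0_le_integral => //=.
  - apply/measurable_funTS; apply/measurable_EFinP; apply: measurable_funM => //.
    exact: measurable_funX.
  - move=> w /= aX; rewrite lee_fin mulrC ler_pdivlMr// mul1r.
    rewrite !exprM -[X w ^+ 2]real_normK ?num_real//.
    by rewrite -!exprM; apply: lerXn2r; rewrite ?nnegrE ?(ltW a0)// ltW.
apply: (@le_trans _ _ (\int[P]_w (a ^- (2 * p) * X w ^+ (2 * p))%:E)%E).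
  apply: ge0_subset_integral => //=.
    by apply/measurable_EFinP; apply: measurable_funM => //; exact: measurable_funX.
  by move=> w _; rewrite lee_fin mulr_ge0// invr_ge0 ltW.
by rewrite Ex_EFin ?ExZ//; exact: integrable_fZ.
Qed.

End SquareIntegrable.

(** * Gaussian Hilbert spaces *)

Section GaussianHilbertSpace.
Context {R : realType} {d : measure_display} {T : measurableType d}.
Variable P : probability T R.
Implicit Types (X Y : T -> R).

Local Notation intgP X := (P.-integrable setT (EFin \o (X : T -> R))).
Local Notation L2 := (L2 P).
Local Notation nrm2 := (nrm2 P).

Lemma limn_einf_le (u : (\bar R)^nat) (e : \bar R) : (forall k, (u k <= e)%E) ->
  (limn_einf u <= e)%E.
Proof.
move=> ue; rewrite limn_einf_lim; apply: lime_le; first exact: is_cvg_einfs.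
by apply: nearW => k; apply: le_trans (ue k); apply: ereal_inf_lbound; exists k => /=.
Qed.

Lemma fatou_sq (X_ : (T -> R)^nat) X (e : R) : (forall k, L2 (X_ k)) ->
  (forall w, X_ k w @[k --> \oo] --> X w) -> (forall k, nrm2 (X_ k) <= e) ->
  L2 X /\ nrm2 X <= e.
Proof.
move=> LX cX Xe.
have mX : measurable_fun setT X.
  by apply: (measurable_fun_cvg (h := X_)) => [k|w _]; [exact: L2_meas (LX k)|exact: cX].
have H : (\int[P]_w (X w ^+ 2)%:E <= e%:E)%E.
  have := @fatou _ _ _ P setT measurableT (fun k w => (X_ k w ^+ 2)%:E).
  have m k : measurable_fun setT (fun w => (X_ k w ^+ 2)%:E).
    by apply/measurable_EFinP; apply: measurable_funX; exact: L2_meas (LX k).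
  have p k w : setT w -> (0 <= (X_ k w ^+ 2)%:E)%E by move=> _; rewrite lee_fin sqr_ge0.
  move=> /(_ m p).
  have -> : (\int[P]_w limn_einf (fun k => (X_ k w ^+ 2)%:E) = \int[P]_w (X w ^+ 2)%:E)%E.
    apply: eq_integral => w _; apply: (cvg_limn_einf_sup _).1.
    apply: cvg_EFin; first exact: nearW.
    by apply: cvgM; exact: cX.
  move=> /le_trans; apply; apply: limn_einf_le => k.
  by rewrite Ex_EFin ?lee_fin; [exact: Xe|exact: L2_sq (LX k)].
have LX' : L2 X.
  split => //; apply/integrableP; split.
    by apply/measurable_EFinP; exact: measurable_funX.
  under eq_integral do rewrite /= ger0_norm ?sqr_ge0//.
  by apply: le_lt_trans H _; exact: ltry.
by split => //; rewrite -lee_fin /nrm2 -Ex_EFin//; exact: L2_sq.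
Qed.

Lemma Ex_cvg_bounded (f_ : (T -> R)^nat) (f : T -> R) (C : R) :
  (forall k, measurable_fun setT (f_ k)) ->
  (forall w, f_ k w @[k --> \oo] --> f w) -> (forall k w, `|f_ k w| <= C) ->
  Ex P (f_ k) @[k --> \oo] --> Ex P f.
Proof.
move=> mf cf fC.
have mf' : measurable_fun setT f.
  by apply: (measurable_fun_cvg (h := f_)) => [k|w _]; [exact: mf|exact: cf].
have fC' w : `|f w| <= C.
  have cn : `|f_ k w| @[k --> \oo] --> `|f w| by apply: cvg_norm; exact: cf.
  by apply: (cvgr_to_le cn); exact: nearW.
have [|||||_ _ cv] := @dominated_convergence _ _ _ P setT measurableT
   (fun k w => (f_ k w)%:E) (fun w => (f w)%:E) (fun=> C%:E).
- by move=> k; apply/measurable_EFinP.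
- exact/measurable_EFinP.
- by apply: aeW => w _; apply: cvg_EFin; [exact: nearW|exact: cf].
- exact: finite_measure_integrable_cst.
- by apply: aeW => w k _; rewrite /= lee_fin.
have := cv; rewrite (Ex_EFin P f); last exact: (bounded_integrable P _ C).
by move=> /fine_cvg.
Qed.

Definition moment_const (p : nat) : R := 2 * (p`! * 4 ^ p)%:R.

(** A linear space of centered Gaussian variables, described by the cosine transform and the even
    moments. Both are expressed through the variance, which behaves well under mean square
    limits. *)
Definition gaussian_space (S : (T -> R) -> Prop) := [/\
  forall X, S X -> L2 X,
  forall (a : R) X Y, S X -> S Y -> S (fun w => a * X w + Y w),
  forall X, S X -> Ex P (fun w => cos (X w)) = expR (- (nrm2 X / 2)) &
  forall p X, S X -> intgP (fun w => X w ^+ (2 * p)) /\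
    Ex P (fun w => X w ^+ (2 * p)) <= moment_const p * nrm2 X ^+ p].

Variable S : (T -> R) -> Prop.
Hypothesis GS : gaussian_space S.

Definition hull X := L2 X /\ forall e : R, 0 < e -> exists2 Y, S Y & nrm2 (fun w => X w - Y w) <= e.

Lemma hull_L2 X : hull X -> L2 X. Proof. by case. Qed.

Lemma hull_sub X : S X -> hull X.
Proof.
move=> SX; have [SL _ _ _] := GS; split; first exact: SL.
move=> e e0; exists X => //; rewrite /nrm2.
under eq_fun do rewrite subrr expr0n/=.
by rewrite Ex_cst ltW.
Qed.

Lemma hull_lin (a : R) X Y : hull X -> hull Y -> hull (fun w => a * X w + Y w).
Proof.
move=> [LX HX] [LY HY]; split; first exact: L2_lin.
have [SL Slin _ _] := GS; move=> e e0.
have a0 : 0 < a ^+ 2 + 1 by rewrite ltr_wpDl// sqr_ge0.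
have [|X' SX' HX'] := HX (e / (4 * (a ^+ 2 + 1))); first by rewrite divr_gt0// mulr_gt0.
have [|Y' SY' HY'] := HY (e / 4); first by rewrite divr_gt0.
exists (fun w => a * X' w + Y' w); first exact: Slin.
have LXX : L2 (fun w => X w - X' w) by apply: L2_sub => //; exact: SL.
have LYY : L2 (fun w => Y w - Y' w) by apply: L2_sub => //; exact: SL.
have -> : (fun w => a * X w + Y w - (a * X' w + Y' w)) =
   (fun w => a * (X w - X' w) + (Y w - Y' w)) by apply/funext => w; ring.
apply: le_trans (nrm2_sub_le P _ _ (L2_scale P a _ LXX) LYY) _.
rewrite nrm2_scale//.
have h1 : a ^+ 2 * nrm2 (fun w => X w - X' w) <= (a ^+ 2 + 1) * (e / (4 * (a ^+ 2 + 1))).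
  by apply: ler_pM => //; [exact: sqr_ge0|exact: nrm2_ge0|rewrite lerDl].
have h2 : (a ^+ 2 + 1) * (e / (4 * (a ^+ 2 + 1))) = e / 4 by field; rewrite gt_eqF.
rewrite h2 in h1; lra.
Qed.

Lemma hull_scale (a : R) X : hull X -> hull (fun w => a * X w).
Proof.
move=> HX; have -> : (fun w => a * X w) = (fun w => (a - 1) * X w + X w).
  by apply/funext => w; ring.
exact: hull_lin.
Qed.

Lemma hull_sub2 X Y : hull X -> hull Y -> hull (fun w => X w - Y w).
Proof.
move=> HX HY; have := hull_lin (-1) _ _ HY HX.
by under eq_fun do rewrite mulN1r addrC.
Qed.

Lemma hull_add X Y : hull X -> hull Y -> hull (fun w => X w + Y w).
Proof. by move=> HX HY; have := hull_lin 1 _ _ HX HY; under eq_fun do rewrite mul1r. Qed.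

Lemma hull_sum (I : finType) (F : I -> T -> R) : (0 < #|I|)%N -> (forall i, hull (F i)) ->
  hull (fun w => \sum_i F i w).
Proof.
move=> /card_gt0P[i0 _] HF.
have : hull (fun w => \sum_(i <- enum I) F i w).
  elim: (enum I) => [|i s IH].
    under eq_fun do rewrite big_nil.
    have := hull_scale 0 _ (HF i0); under eq_fun do rewrite mul0r; exact.
  by under eq_fun do rewrite big_cons; exact: hull_add.
by under eq_fun do rewrite big_enum.
Qed.

Lemma cos_dist (x y : R) : `|cos x - cos y| <= `|x - y|.
Proof.
wlog xy : x y / y <= x.
  by move=> H; have [/H//|/ltW/H] := leP y x; rewrite distrC [leRHS]distrC.
have [|z _ ->] := @MVT_segment R cos (fun z => - sin z) y x xy.
  exact/continuous_subspaceT/continuous_cos.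
by rewrite normrM normrN ler_piMl// sin_max.
Qed.

Lemma measurable_cos X : measurable_fun setT X -> measurable_fun setT (fun w => cos (X w)).
Proof.
move=> mX; apply: (measurableT_comp (f := cos)) => //.
by apply: continuous_measurable_fun; exact: continuous_cos.
Qed.

Lemma expR_dist (x y : R) : 0 <= x -> 0 <= y -> `|expR (- x) - expR (- y)| <= `|x - y|.
Proof.
wlog xy : x y / y <= x.
  move=> H x0 y0; have [yx|/ltW yx] := leP y x; first exact: H.
  by rewrite [X in X <= _]distrC [X in _ <= X]distrC; exact: H.
move=> x0 y0; rewrite distrC (distrC x) ger0_norm ?subr_ge0 ?ler_expR ?lerN2// distrC ger0_norm ?subr_ge0//.
have -> : expR (- x) = expR (- y) * expR (- (x - y)) by rewrite -expRD; congr expR; ring.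
have := expR_ge1Dx (- (x - y)) => h.
have y1 : expR (- y) <= 1 by rewrite expR_le1 oppr_le0.
have : expR (- y) * (1 - expR (- (x - y))) <= 1 * (x - y).
  apply: ler_pM => //.
    by rewrite subr_ge0 expR_le1 oppr_le0 subr_ge0.
  lra.
by rewrite mul1r mulrBr mulr1.
Qed.

Lemma nrm2_dist X Y : L2 X -> L2 Y ->
  `|nrm2 X - nrm2 Y| <= Num.sqrt (nrm2 (fun w => X w - Y w)) *
     (2 * Num.sqrt (nrm2 X) + Num.sqrt (nrm2 (fun w => X w - Y w))).
Proof.
move=> LX LY; have LZ := L2_sub P _ _ LX LY.
have E := nrm2_lin P (-1) _ _ LZ LX.
have -> : nrm2 Y = nrm2 (fun w => -1 * (X w - Y w) + X w).
  by rewrite /nrm2; congr Ex; apply/funext => w; ring.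
rewrite E; set s := Num.sqrt _; have s2 : s ^+ 2 = nrm2 (fun w => X w - Y w).
  by rewrite sqr_sqrtr ?nrm2_ge0.
rewrite -s2; have := Ex_mul_le P _ _ LZ LX; rewrite -/s; set u := Num.sqrt _; set e := Ex P _.
move=> h; have -> : nrm2 X - ((-1) ^+ 2 * s ^+ 2 + 2 * -1 * e + nrm2 X) = 2 * e - s ^+ 2 by ring.
apply: le_trans (ler_normB _ _) _.
have -> : `|2 * e| = 2 * `|e| by rewrite normrM ger0_norm.
have -> : `|s ^+ 2| = s ^+ 2 by rewrite ger0_norm ?sqr_ge0.
have -> : s * (2 * u + s) = 2 * (s * u) + s ^+ 2 by ring.
lra.
Qed.

Lemma eq_of_le_small (a b : R) : (forall e, 0 < e -> e <= 1 -> `|a| <= e * b) -> a = 0.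
Proof.
move=> H; apply/eqP; rewrite -normr_eq0 eq_le normr_ge0 andbT.
apply/ler_addgt0Pr => e e0; rewrite add0r.
have b0 : 0 <= b by have := H 1 ltr01 (lexx _); rewrite mul1r; exact: le_trans.
have m0 : 0 < Num.min 1 (e / (b + 1)) by rewrite lt_min ltr01 divr_gt0//; lra.
have m1 : Num.min 1 (e / (b + 1)) <= 1 by rewrite ge_min lexx.
apply: (le_trans (H _ m0 m1)).
apply: (@le_trans _ _ (e / (b + 1) * b)).
  by apply: ler_wpM2r => //; rewrite ge_min lexx orbT.
rewrite mulrAC ler_pdivrMr; last lra.
by rewrite ler_pM2l//; lra.
Qed.

(** Both sides are continuous in mean square: the cosine is 1-Lipschitz, and so is [exp (- v)] for
    [v >= 0]. *)
Lemma hull_cos X : hull X -> Ex P (fun w => cos (X w)) = expR (- (nrm2 X / 2)).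
Proof.
move=> [LX HX]; have [SL _ Scos _] := GS; apply/eqP; rewrite -subr_eq0; apply/eqP.
apply: (@eq_of_le_small _ (2 + 2 * Num.sqrt (nrm2 X))) => e e0 e1.
have [|Y SY HY] := HX (e ^+ 2); first by rewrite exprn_gt0.
have LY := SL _ SY; set s := Num.sqrt (nrm2 (fun w => X w - Y w)).
have se : s <= e by rewrite /s -[e]ger0_norm ?(ltW e0)// -sqrtr_sqr ler_sqrt ?sqr_ge0.
have icos Z : L2 Z -> intgP (fun w => cos (Z w)).
  move=> LZ; apply: (bounded_integrable P _ 1); last by move=> w; exact: cos_max.
  by apply: measurable_cos; exact: (L2_meas P _ LZ).
have h1 : `|Ex P (fun w => cos (X w)) - Ex P (fun w => cos (Y w))| <= s.
  rewrite -ExB; [|exact: icos|exact: icos].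
  have LZ := L2_sub P _ _ LX LY; have iZ := L2_integrable P _ LZ.
  have iC : intgP (fun w => cos (X w) - cos (Y w)).
    apply: (bounded_integrable P _ 2).
      by apply: measurable_funB; apply: measurable_cos; [exact: (L2_meas P _ LX)|exact: (L2_meas P _ LY)].
    by move=> w; apply: le_trans (ler_normB _ _) _; have := cos_max (X w); have := cos_max (Y w); lra.
  apply: le_trans (Ex_norm P _ iC) _; apply: le_trans (Ex_abs_le P _ LZ).
  apply: Ex_le; [exact: integrable_norm iC|exact: integrable_norm iZ|].
  by move=> w; exact: cos_dist.
have h2 : `|expR (- (nrm2 Y / 2)) - expR (- (nrm2 X / 2))| <= s * (2 * Num.sqrt (nrm2 X) + s) / 2.
  apply: le_trans (expR_dist _ _ _ _) _; rewrite ?divr_ge0 ?nrm2_ge0//.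
  rewrite -mulrBl normrM (ger0_norm (_ : 0 <= 2^-1))// ler_wpM2r// distrC.
  exact: nrm2_dist.
have := ler_normD (Ex P (fun w => cos (X w)) - Ex P (fun w => cos (Y w))) (expR (- (nrm2 Y / 2)) - expR (- (nrm2 X / 2))).
rewrite -(Scos _ SY) in h2 *; rewrite addrA subrK => /le_trans; apply.
apply: le_trans (lerD h1 h2) _.
have s0 : 0 <= s by exact: sqrtr_ge0.
have q0 : 0 <= Num.sqrt (nrm2 X) by exact: sqrtr_ge0.
have : s * (2 * Num.sqrt (nrm2 X) + s) <= e * (2 * Num.sqrt (nrm2 X) + 1).
  by apply: ler_pM => //; lra.
move: q0 se e0; set q := Num.sqrt (nrm2 X) => q0 se e0 h.
have := mulr_ge0 (ltW e0) q0; have -> : e * (2 + 2 * q) = 2 * e + 2 * (e * q) by ring.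
have : e * (2 * q + 1) = 2 * (e * q) + e by ring.
lra.
Qed.

Lemma hull_tail X (p : nat) (V a : R) : hull X -> nrm2 X <= V -> 0 < V -> 0 < a ->
  (P [set w | (a < `|X w|)%R] <= ((2 / a) ^+ (2 * p) * (moment_const p * (4 * V) ^+ p))%:E)%E.
Proof.
move=> [LX HX] XV V0 a0; have [SL _ _ Smom] := GS.
have mX := L2_meas P _ LX; have a2 : 0 < a / 2 by rewrite divr_gt0.
apply/lee_addgt0Pr => e e0; rewrite -EFinD.
pose e' := Num.min V (e * (a / 2) ^+ 2).
have e'0 : 0 < e' by rewrite lt_min V0 mulr_gt0// exprn_gt0.
have [Y SY HY] := HX e' e'0.
have LY := SL _ SY; have mY := L2_meas P _ LY; have LZ := L2_sub P _ _ LX LY.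
have mZ := L2_meas P _ LZ.
have sub : [set w | (a < `|X w|)%R] `<=` [set w | (a / 2 < `|Y w|)%R] `|` [set w | (a / 2 < `|X w - Y w|)%R].
  move=> w /= aX; have [h|h] := ltP (a / 2) `|Y w|; [by left|right].
  by have := ler_normD (X w - Y w) (Y w); rewrite subrK; lra.
apply: le_trans (le_measure P _ _ sub) _.
- by rewrite inE; exact: measurable_gt.
- by rewrite inE; apply: measurableU; exact: measurable_gt.
apply: le_trans (measureU2 P (measurable_gt _ _ mY) (measurable_gt _ _ mZ)) _.
rewrite EFinD; apply: leeD.
  have [iY EY] := Smom p _ SY.
  apply: le_trans (markov_even P _ p _ a2 mY iY) _; rewrite lee_fin.
  have -> : (a / 2) ^- (2 * p) = (2 / a) ^+ (2 * p) by rewrite -exprVn invf_div.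
  apply: ler_wpM2l; first by rewrite exprn_ge0// divr_ge0// ltW.
  apply: le_trans EY _; apply: ler_wpM2l; first by rewrite mulr_ge0.
  apply: lerXn2r; rewrite ?nnegrE ?nrm2_ge0//; first by rewrite mulr_ge0// ltW.
  have := nrm2_sub_le P _ _ LX (L2_scale P (-1) _ LZ).
  have -> : (fun w => X w + -1 * (X w - Y w)) = Y by apply/funext => w; ring.
  rewrite nrm2_scale//; have : e' <= V by rewrite ge_min lexx.
  by rewrite sqrrN expr1n mul1r; lra.
have iZ := L2_sq P _ LZ.
apply: le_trans (markov_even P _ 1 _ a2 mZ iZ) _; rewrite lee_fin muln1 mulrC.
rewrite ler_pdivrMr ?exprn_gt0//; apply: (le_trans HY).
by rewrite ge_min lexx orbT.
Qed.

(** If the sequence were not Cauchy in mean square, some differences of squared norm above [e] would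
    tend to 0 pointwise. Their mean cosine would tend to 1 by bounded convergence, although
    [hull_cos] keeps it below [exp (- e / 2)]. Fatou's lemma then identifies the mean square limit
    with the pointwise one. *)
Lemma hull_limit (X_ : (T -> R)^nat) X : (forall k, hull (X_ k)) ->
  (forall w, X_ k w @[k --> \oo] --> X w) ->
  hull X /\ forall e : R, 0 < e -> exists N, forall k, (N <= k)%N ->
    nrm2 (fun w => X_ k w - X w) <= e.
Proof.
move=> HX cX.
have LX k : L2 (X_ k) by exact: hull_L2.
have cauchy e : 0 < e -> exists N, forall k l, (N <= k)%N -> (N <= l)%N ->
    nrm2 (fun w => X_ k w - X_ l w) <= e.
  move=> e0; apply: contrapT => H.
  have /choice[kl Hkl] : forall N, exists kl : nat * nat, [/\ (N <= kl.1)%N, (N <= kl.2)%N &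
      e < nrm2 (fun w => X_ kl.1 w - X_ kl.2 w)].
    move=> N; apply: contrapT => HN; apply: H; exists N => k l Nk Nl.
    by rewrite leNgt; apply/negP => h; apply: HN; exists (k, l).
  pose W N w := X_ (kl N).1 w - X_ (kl N).2 w.
  have HW N : hull (W N) by exact: hull_sub2.
  have cW w : cos (W N w) @[N --> \oo] --> (1 : R).
    have sub (f : nat -> nat) : (forall N, (N <= f N)%N) -> X_ (f N) w @[N --> \oo] --> X w.
      move=> fN; apply: (cvg_comp f (fun k => X_ k w) _ (cX w)).
      move=> A [N _ NA]; exists N => // k /= Nk; apply: NA => /=.
      exact: leq_trans (fN k).
    have c0 : W N w @[N --> \oo] --> (0 : R).
      rewrite -(subrr (X w)); apply: cvgB; apply: sub => N; by have [] := Hkl N.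
    rewrite -(@cos0 R); apply: (cvg_comp _ _ c0); exact: continuous_cos.
  have := Ex_cvg_bounded (fun N w => cos (W N w)) (fun=> 1) 1.
  move=> /(_ (fun N => measurable_cos _ (L2_meas P _ (hull_L2 _ (HW N)))) cW (fun N w => cos_max _)).
  rewrite Ex_cst => c1.
  have : 1 <= expR (- (e / 2)).
    apply: (cvgr_to_le c1); apply: nearW => N.
    rewrite hull_cos// ler_expR lerN2 ler_wpM2r//.
    by have [_ _ /ltW] := Hkl N.
  by rewrite leNgt expR_lt1 oppr_lt0 divr_gt0.
have key e : 0 < e -> exists N, forall k, (N <= k)%N ->
    L2 (fun w => X_ k w - X w) /\ nrm2 (fun w => X_ k w - X w) <= e.
  move=> /cauchy[N HN]; exists N => k Nk.
  apply: (fatou_sq (fun l w => X_ k w - X_ (N + l)%N w)).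
  - by move=> l; exact: L2_sub.
  - move=> w; apply: cvgB; first exact: cvg_cst.
    by have := cX w; rewrite -(cvg_shiftn N); under eq_fun do rewrite addnC.
  - by move=> l; apply: HN => //; exact: leq_addr.
have LXX : L2 X.
  have [N HN] := key 1 ltr01; have [LN _] := HN N (leqnn _).
  have := L2_sub P _ _ (LX N) LN.
  by under eq_fun do rewrite opprB addrC subrK.
split; last by move=> e /key[N HN]; exists N => k /HN[].
split => // e e0.
have [|N HN] := key (e / 4); first by rewrite divr_gt0.
have [LN nN] := HN N (leqnn _).
have [_ /(_ (e / 4))[|Y SY HY]] := HX N; first by rewrite divr_gt0.
exists Y => //; have [SL _ _ _] := GS.
have := nrm2_sub_le P _ _ (L2_scale P (-1) _ LN) (L2_sub P _ _ (LX N) (SL _ SY)).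
have -> : (fun w => -1 * (X_ N w - X w) + (X_ N w - Y w)) = (fun w => X w - Y w).
  by apply/funext => w; ring.
by rewrite nrm2_scale// sqrrN expr1n mul1r; lra.
Qed.

End GaussianHilbertSpace.

(** * Small ball probabilities by Gaussian smoothing *)

Section ExFubini.
Context {R : realType} {d d' : measure_display}.
Context {T : measurableType d} {T' : measurableType d'}.
Variables (P : probability T R) (Q : probability T' R).

Variables (f : T * T' -> R) (C : R).
Hypothesis mf : measurable_fun setT f.
Hypothesis fC : forall z, `|f z| <= C.

Let mfx x : measurable_fun setT (fun y => f (x, y)).
Proof. exact: measurableT_comp (pair1_measurable x). Qed.

Let mfy y : measurable_fun setT (fun x => f (x, y)).
Proof. exact: measurableT_comp (pair2_measurable y). Qed.

Let ifx x : Q.-integrable setT (EFin \o (fun y => f (x, y))).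
Proof. by apply: (bounded_integrable Q _ C). Qed.

Let ify y : P.-integrable setT (EFin \o (fun x => f (x, y))).
Proof. by apply: (bounded_integrable P _ C). Qed.

Let iprod : (P \x Q)%E.-integrable setT (EFin \o f).
Proof.
apply/integrable12ltyP; first exact/measurable_EFinP.
have C0 : 0 <= C := le_trans (normr_ge0 _) (fC (point, point)).
apply: (@le_lt_trans _ _ (\int[P]_x (C%:E))%E); last first.
  rewrite integral_cst//; apply: (@le_lt_trans _ _ (C%:E * 1)%E); last by rewrite mule1 ltry.
  by apply: lee_wpmul2l; [rewrite lee_fin|exact: probability_le1].
apply: ge0_le_integral => //=.
- by move=> x _; apply: integral_ge0.
- apply: (measurable_fun_fubini_tonelli_F (fun z => `|(f z)%:E|%E)) => //.
  by apply: measurableT_comp => //; exact/measurable_EFinP.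
- move=> x _; apply: (@le_trans _ _ (\int[Q]_y (C%:E))%E).
    apply: ge0_le_integral => //=.
      by apply/measurable_EFinP; exact: measurableT_comp (mfx x).
    by move=> y _; rewrite lee_fin; exact: fC.
  rewrite integral_cst//; apply: (@le_trans _ _ (C%:E * 1)%E); last by rewrite mule1.
  by apply: lee_wpmul2l; [rewrite lee_fin|exact: probability_le1].
Qed.

Lemma Ex_section_integrable : Q.-integrable setT (EFin \o (fun y => Ex P (fun x => f (x, y)))).
Proof.
have E y : fubini_G P (EFin \o f) y = (Ex P (fun x => f (x, y)))%:E.
  by rewrite /fubini_G -(Ex_EFin P (fun x => f (x, y))).
apply: (bounded_integrable Q _ C).
  apply/measurable_EFinP; have := measurable_fubini_G iprod.
  by apply: eq_measurable_fun => y _; exact: E.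
move=> y; apply: le_trans (Ex_norm P _ (ify y)) _.
rewrite -[leRHS](Ex_cst P); apply: Ex_le => //.
  exact: (integrable_norm (ify y)).
exact: finite_measure_integrable_cst.
Qed.

Lemma Ex_fubini : Ex P (fun x => Ex Q (fun y => f (x, y))) = Ex Q (fun y => Ex P (fun x => f (x, y))).
Proof.
rewrite /Ex; congr fine; have := Fubini iprod.
under eq_integral do rewrite /= (Ex_EFin Q (fun y => f (_, y)))//.
move=> ->; apply: eq_integral => y _.
by rewrite /= (Ex_EFin P (fun x => f (x, y))).
Qed.

End ExFubini.

Section SmallBall.
Context {R : realType} {d : measure_display} {T : measurableType d}.
Variable P : probability T R.
Variables (S : (T -> R) -> Prop) (GS : gaussian_space P S).
Local Notation gam := (@normal_prob R 0 1).
Local Notation nrm2 := (nrm2 P).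

Variables (N : nat) (X : 'I_N -> T -> R) (kap alpha : R).
Hypothesis HX : forall i, hull P S (X i).
Hypothesis kap0 : 0 < kap.
Hypothesis alpha0 : 0 < alpha.
Hypothesis nondeg : forall c : 'I_N -> R,
  kap * \sum_i c i ^+ 2 <= nrm2 (fun w => \sum_i c i * X i w).

(** The mean of [exp (- kap z^2 / (2 alpha^2))] for a standard normal [z]: the gain from each factor
    of [G]. *)
Let rho := (Num.sqrt (1 + kap / alpha ^+ 2))^-1.
Let g (x : R) := expR (- (x ^+ 2 / 2)).
Let G (k : nat) (w : T) := \prod_(i < N | (i < k)%N) g (X i w / alpha).

Let mX i : measurable_fun setT (X i). Proof. exact: L2_meas (hull_L2 _ _ _ (HX i)). Qed.

Let mG k : measurable_fun setT (G k).
Proof.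
rewrite /G; under eq_fun do rewrite big_mkcond.
apply: (measurable_prod (s := index_enum 'I_N)
  (h := fun i w => if (i < k)%N then g (X i w / alpha) else 1)) => i _.
case: (i < k)%N => //; rewrite /g.
apply: measurableT_comp => //; apply: measurableT_comp => //.
by apply: measurable_funM => //; apply: measurable_funX; apply: measurable_funM.
Qed.

Let G01 k w : 0 <= G k w <= 1.
Proof.
apply/andP; split; first by apply: prodr_ge0 => i _; exact: expR_ge0.
apply: prodr_ile1 => i _; rewrite expR_ge0 expR_le1 oppr_le0.
by rewrite divr_ge0// sqr_ge0.
Qed.

Let mS (y : 'I_N -> R) : measurable_fun setT (fun w => \sum_i y i * X i w).
Proof. by apply: measurable_sum => i; apply: measurable_funM. Qed.

(* Gaussian smoothing: [exp (-x^2/2)] is the mean of [cos (Z x)] for a standard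
   normal [Z], so each factor of [G] adds one random coefficient to the phase. *)
Lemma smoothed_cos_le k (y : 'I_N -> R) : (k <= N)%N ->
  (forall i : 'I_N, (i < k)%N -> y i = 0) ->
  `|Ex P (fun w => G k w * cos (\sum_i y i * X i w))| <=
  rho ^+ k * expR (- (kap * (\sum_i y i ^+ 2) / 2)).
Proof.
elim: k y => [|k IH] y kN y0.
  rewrite expr0 mul1r.
  have -> : (fun w => G 0 w * cos (\sum_i y i * X i w)) = (fun w => cos (\sum_i y i * X i w)).
    by apply/funext => w; rewrite /G big_pred0// mul1r.
  (* The empty family is separate, because [hull_sum] builds the zero variable from a member of the
     family. *)
  have [N0|N0] := posnP N.
    rewrite [X in expR (- (kap * X / 2))]big1 => [|[i Hi]]; last by exfalso; rewrite N0 in Hi.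
    rewrite mulr0 mul0r oppr0 expR0; apply: le_trans (Ex_norm P _ _) _.
      by apply: (bounded_integrable P _ 1) => [|w]; [exact/measurable_cos|exact: cos_max].
    rewrite -[leRHS](Ex_cst P); apply: Ex_le.
    - apply: integrable_norm.
      by apply: (bounded_integrable P _ 1) => [|w]; [exact/measurable_cos|exact: cos_max].
    - exact: finite_measure_integrable_cst.
    - by move=> w; exact: cos_max.
  rewrite (hull_cos P S GS); last first.
    by apply: (hull_sum P S GS) => [|i]; [rewrite card_ord|exact: hull_scale].
  by rewrite ger0_norm ?expR_ge0// ler_expR lerN2 ler_wpM2r.
pose ik := Ordinal kN.
pose Y w := \sum_i y i * X i w.
pose f (p : T * g_sigma_algebraType (R.-ocitv.-measurable)) : R := G k p.1 * cos (Y p.1) * cos ((X ik p.1 / alpha) * p.2).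
have mf : measurable_fun setT f.
  apply: measurable_funM.
    by apply: measurable_funM; [exact: measurableT_comp (mG k) measurable_fst|
       apply: measurable_cos; exact: measurableT_comp (mS y) measurable_fst].
  apply: measurable_cos; apply: measurable_funM; last exact: measurable_snd.
  by apply: measurable_funM => //; exact: measurableT_comp (mX ik) measurable_fst.
have fC p : `|f p| <= 1.
  rewrite /f !normrM; have /andP[? ?] := G01 k p.1.
  rewrite (ger0_norm (_ : 0 <= G k p.1))// -[leRHS]mulr1; apply: ler_pM => //; last exact: cos_max.
    by rewrite mulr_ge0.
  by rewrite -[leRHS]mulr1; apply: ler_pM => //; exact: cos_max.
have F := Ex_fubini P gam f 1 mf fC.
have E1 : Ex P (fun w => G k.+1 w * cos (\sum_i y i * X i w)) = Ex P (fun x => Ex gam (fun z => f (x, z))).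
  congr Ex; apply/funext => w; rewrite /f/=.
  rewrite ExZ; last first.
    apply: (bounded_integrable gam _ 1); last by move=> z; exact: cos_max.
    by apply: measurable_cos; apply: measurable_funM.
  have -> : Ex gam (fun z : R => cos (X ik w / alpha * z)) = g (X ik w / alpha).
    by rewrite /Ex normal_cos.
  have -> : G k.+1 w = g (X ik w / alpha) * G k w.
    rewrite /G (bigD1 ik)//=; congr (_ * _).
    apply: eq_bigl => i; rewrite ltnS leq_eqVlt -(inj_eq val_inj)/=.
    by have [->|] := eqVneq (i : nat) k; rewrite ?ltnn ?andbT.
  by rewrite -/(Y w); ring.
rewrite E1 F.
(* The new coefficient enters at the index [k], where [y] vanishes, so its square is simply added to
   the sum of squares. The two signs come from [cos u * cos v = (cos (u + v) + cos (u - v)) / 2]. *)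
pose ypm (s : R) i := y i + (if i == ik then s else 0).
have Yp s w : \sum_i ypm s i * X i w = Y w + s * X ik w.
  rewrite /Y (bigD1 ik)//= [in RHS](bigD1 ik)//= /ypm eqxx.
  rewrite (eq_bigr (fun i => y i * X i w)); first by ring.
  by move=> i /negbTE ->; rewrite addr0.
have sq s : \sum_i ypm s i ^+ 2 = \sum_i y i ^+ 2 + s ^+ 2.
  rewrite (bigD1 ik)//= [in RHS](bigD1 ik)//= /ypm eqxx (y0 ik)//=.
  rewrite (eq_bigr (fun i => y i ^+ 2)); first by ring.
  by move=> i /negbTE ->; rewrite addr0.
have zero s (i : 'I_N) : (i < k)%N -> ypm s i = 0.
  move=> ik'; rewrite /ypm y0; last exact: ltnW.
  by rewrite ifF ?addr0//; apply/negbTE/eqP => E; rewrite E/= ltnn in ik'.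
have E2 z : Ex P (fun x => f (x, z)) =
   2^-1 * (Ex P (fun w => G k w * cos (\sum_i ypm (z / alpha) i * X i w)) +
           Ex P (fun w => G k w * cos (\sum_i ypm (- (z / alpha)) i * X i w))).
  have int s : P.-integrable setT (EFin \o (fun w => G k w * cos (\sum_i ypm s i * X i w))).
    apply: (bounded_integrable P _ 1).
      by apply: measurable_funM => //; apply: measurable_cos; exact: mS.
    move=> w; rewrite normrM; have /andP[? ?] := G01 k w.
    rewrite ger0_norm// -[leRHS]mulr1; apply: ler_pM => //; exact: cos_max.
  rewrite -ExD// -ExZ; last exact: integrable_fD.
  congr Ex; apply/funext => w; rewrite /f/= !Yp mulNr cosB cosD.
  have -> : X ik w / alpha * z = z / alpha * X ik w by ring.
  by field.
apply: le_trans (Ex_norm gam _ (Ex_section_integrable P gam f 1 mf fC)) _.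
have B z : `|Ex P (fun x => f (x, z))| <= rho ^+ k * expR (- (kap * (\sum_i y i ^+ 2) / 2)) *
     expR (- (kap / alpha ^+ 2 * z ^+ 2 / 2)).
  rewrite E2 normrM ger0_norm// -mulrA -expRD.
  have -> : - (kap * (\sum_i y i ^+ 2) / 2) + - (kap / alpha ^+ 2 * z ^+ 2 / 2) =
     - (kap * (\sum_i y i ^+ 2 + (z / alpha) ^+ 2) / 2) by field; rewrite gt_eqF.
  have := IH _ (ltnW kN) (zero (z / alpha)); have := IH _ (ltnW kN) (zero (- (z / alpha))).
  rewrite !sq sqrrN; set U := rho ^+ k * _; set a := Ex P _; set b := Ex P _ => h1 h2.
  by have := ler_normD b a; lra.
have cK : -1 < kap / alpha ^+ 2.
  by apply: (@lt_trans _ _ 0) => //; rewrite divr_gt0// exprn_gt0.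
have iB : gam.-integrable setT (EFin \o (fun z : R => expR (- (kap / alpha ^+ 2 * z ^+ 2 / 2)))).
  apply: (bounded_integrable gam _ 1).
    apply: measurableT_comp => //; apply: measurableT_comp => //.
    by apply: measurable_funM => //; apply: measurable_funM => //; exact: measurable_funX.
  move=> z; rewrite ger0_norm ?expR_ge0// expR_le1 oppr_le0 divr_ge0// mulr_ge0 ?sqr_ge0//.
  by rewrite divr_ge0 ?sqr_ge0// ltW.
apply: le_trans (Ex_le gam _ _ _ _ B) _.
- exact/integrable_norm/Ex_section_integrable.
- exact: integrable_fZ.
rewrite ExZ// /(Ex gam) normal_exp_sq//= exprSr -/rho.
by rewrite [rho ^+ k.+1]exprSr mulrAC.
Qed.

(** On the event every factor of [G N] is at least [exp (- 1/2)], so the probability is at most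
    [exp (N / 2)] times the mean of [G N]. The case [y = 0] of [smoothed_cos_le] bounds that mean by
    [rho ^+ N], and [rho <= alpha / sqrt kap]. *)
Lemma small_ball :
  (P [set w | forall i, (`|X i w| <= alpha)%R] <= ((expR 1 * alpha / Num.sqrt kap) ^+ N)%:E)%E.
Proof.
have y00 (i : 'I_N) : (i < N)%N -> (fun=> 0 : R) i = 0 by [].
have := smoothed_cos_le N (fun=> 0) (leqnn N) y00.
have -> : (fun w => G N w * cos (\sum_i 0 * X i w)) = G N.
  by apply/funext => w; rewrite big1 ?cos0 ?mulr1// => i _; rewrite mul0r.
rewrite big1 => [|i _]; last by rewrite expr0n.
rewrite mulr0 mul0r oppr0 expR0 mulr1 => H.
have iG : P.-integrable setT (EFin \o G N).
  apply: (bounded_integrable P _ 1); first exact: mG.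
  by move=> w; have /andP[? ?] := G01 N w; rewrite ger0_norm.
set A := [set w | _].
have mA : measurable A.
  have -> : A = \bigcap_(i in [set: 'I_N]) (~` [set w | alpha < `|X i w|]).
    apply/seteqP; split => w; first by move=> Aw i _ /=; apply/negP; rewrite -leNgt.
    by move=> Aw i; rewrite leNgt; apply/negP; exact: Aw.
  by apply: fin_bigcap_measurable => // i _; apply: measurableC; exact: measurable_gt.
have GA w : A w -> expR (- 2^-1) ^+ N <= G N w.
  move=> Aw; rewrite /G (eq_bigl xpredT); last by move=> i; rewrite ltn_ord.
  rewrite -[X in _ ^+ X](card_ord N) -prodr_const; apply: ler_prod => i _.
  rewrite expR_ge0/= ler_expR lerN2 -[leRHS]mul1r ler_wpM2r//.
  rewrite -real_normK ?num_real// exprn_ile1// normrM normfV (gtr0_norm alpha0).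
  by rewrite ler_pdivrMr// mul1r.
apply: (@le_trans _ _ (expR 2^-1 ^+ N * Ex P (G N))%:E); last first.
  rewrite lee_fin exprMn -!exprMn.
  apply: (@le_trans _ _ (expR 2^-1 ^+ N * rho ^+ N)).
    by apply: ler_wpM2l; [rewrite exprn_ge0// expR_ge0|apply: le_trans H; exact: ler_norm].
  rewrite -exprMn; apply: lerXn2r; rewrite ?nnegrE.
  - by rewrite mulr_ge0 ?expR_ge0// invr_ge0 sqrtr_ge0.
  - by rewrite divr_ge0 ?sqrtr_ge0// mulr_ge0 ?expR_ge0// ltW.
  - rewrite -mulrA; apply: ler_pM.
    + exact: expR_ge0.
    + by rewrite invr_ge0 sqrtr_ge0.
    + by rewrite ler_expR; lra.
    + have p0 : 0 < 1 + kap / alpha ^+ 2 by rewrite addr_gt0// divr_gt0// exprn_gt0.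
      have -> : alpha / Num.sqrt kap = (Num.sqrt kap / alpha)^-1 by rewrite invf_div.
      rewrite /rho lef_pV2 ?posrE ?divr_gt0 ?sqrtr_gt0//.
      rewrite -[leLHS]ger0_norm ?divr_ge0 ?sqrtr_ge0 ?(ltW alpha0)//.
      rewrite -sqrtr_sqr ler_sqrt ?(ltW p0)// expr_div_n sqr_sqrtr ?(ltW kap0)//.
      by rewrite lerDr.
have c0 : 0 < expR (- 2^-1) ^+ N :> R by rewrite exprn_gt0// expR_gt0.
have -> : expR 2^-1 ^+ N = (expR (- 2^-1) ^+ N)^-1 :> R by rewrite expRN exprVn invrK.
rewrite -(ExZ P)// -(Ex_EFin P); last exact: integrable_fZ.
rewrite -[leLHS]mul1e -integral_cst//.
apply: (@le_trans _ _ (\int[P]_(w in A) ((expR (- 2^-1) ^+ N)^-1 * G N w)%:E)%E).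
  apply: ge0_le_integral => //=.
  - by apply/measurable_funTS; apply/measurable_EFinP; apply: measurable_funM.
  - by move=> w Aw; rewrite lee_fin mulrC ler_pdivlMr// mul1r GA.
apply: ge0_subset_integral => //=.
  by apply/measurable_EFinP; apply: measurable_funM.
by move=> w _; rewrite lee_fin mulr_ge0 ?invr_ge0 ?(ltW c0)//; have /andP[] := G01 N w.
Qed.

End SmallBall.

(** * Centered Gaussian variables and the linear span of the field *)

Section CenteredGaussian.
Context {R : realType} {d : measure_display} {T : measurableType d}.
Variable P : probability T R.
Local Notation gam := (@normal_prob R 0 1).
Local Notation L2 := (L2 P).
Local Notation nrm2 := (nrm2 P).
Local Notation intgP X := (P.-integrable setT (EFin \o (X : T -> R))).

Lemma gaussian_rv_L2 (X : T -> R) : gaussian_rv P X -> L2 X.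
Proof.
move=> gX; have [mX _] := gX; split => //.
have mX2 : measurable_fun setT (fun w => X w ^+ 2) by exact: measurable_funX.
have [m [s [s0 H]]] := gaussian_rv_integral P X gX.
apply/integrableP; split; first exact/measurable_EFinP.
under eq_integral do rewrite /= ger0_norm ?sqr_ge0//.
have cg : continuous (fun x : R => x ^+ 2) by move=> x; exact: exprn_continuous.
rewrite (H _ cg).
have mh : measurable_fun setT (fun y : R => (m + s * y) ^+ 2).
  by apply: measurable_funX; apply: measurable_funD => //; exact: measurable_funM.
have i2 : gam.-integrable setT (EFin \o (fun y : R => (m + s * y) ^+ 2)).
  apply: (normal_integrable _ (2 * (m ^+ 2 + s ^+ 2)) mh) => x.
  rewrite ger0_norm ?sqr_ge0//.
  have := sqr_ge0 (m - s * x); have := sqr_ge0 (m * x); have := sqr_ge0 s.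
  have := sqr_ge0 m.
  by rewrite !expr2; lra.
have /integrableP[_] := i2.
by under eq_integral do rewrite /= ger0_norm ?sqr_ge0//.
Qed.

Lemma gaussian_rv_centered (X : T -> R) : gaussian_rv P X -> Ex P X = 0 ->
  exists2 s : R, 0 <= s & forall g : R -> R, continuous g ->
    (\int[P]_w (g (X w))%:E = \int[gam]_y (g (s * y))%:E)%E.
Proof.
move=> gX X0; have [m [s [s0 H]]] := gaussian_rv_integral P X gX.
exists s => // g cg; rewrite (H _ cg).
suff -> : m = 0 by under eq_integral do rewrite add0r.
have cid : continuous (fun x : R => x) by move=> x; exact: cvg_id.
have iy : gam.-integrable setT (EFin \o (fun y : R => y)).
  apply: (normal_integrable _ 1) => // x; rewrite mul1r.
  have := sqr_ge0 (`|x| - 1); have := real_normK (num_real x).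
  by rewrite !expr2; have := normr_ge0 x; lra.
have := congr1 fine (H _ cid); rewrite -/(Ex P X) X0 -[RHS]/(Ex gam (fun y => m + s * y)).
rewrite ExD; last 2 first.
- exact: finite_measure_integrable_cst.
- exact: (integrable_fZ gam s _ iy).
by rewrite Ex_cst ExZ// [X in s * X]/Ex normal_mean/= mulr0 addr0.
Qed.

Lemma centered_gaussian_laws (X : T -> R) : gaussian_rv P X -> Ex P X = 0 ->
  Ex P (fun w => cos (X w)) = expR (- (nrm2 X / 2)) /\
  forall p, intgP (fun w => X w ^+ (2 * p)) /\
    Ex P (fun w => X w ^+ (2 * p)) <= moment_const p * nrm2 X ^+ p.
Proof.
move=> gX X0; have [s s0 H] := gaussian_rv_centered X gX X0.
have mX : measurable_fun setT X by case: gX.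
have cX k : continuous (fun x : R => x ^+ k) by move=> x; exact: exprn_continuous.
have N2 : nrm2 X = s ^+ 2.
  rewrite -[nrm2 X]/(Ex P (fun w => X w ^+ 2)) /Ex (H _ (cX 2%N)).
  under eq_integral do rewrite exprMn EFinM.
  rewrite ge0_integralZl//.
  - by rewrite normal_second_moment mule1.
  - by apply/measurable_EFinP; exact: measurable_funX.
  - by move=> y _; rewrite lee_fin sqr_ge0.
  - by rewrite lee_fin sqr_ge0.
split.
  by rewrite /Ex (H _ (@continuous_cos R)) normal_cos N2.
move=> p.
have mom : (\int[P]_w (X w ^+ (2 * p))%:E <= (moment_const p * nrm2 X ^+ p)%:E)%E.
  rewrite (H _ (cX (2 * p)%N)).
  under eq_integral do rewrite exprMn EFinM.
  rewrite ge0_integralZl//.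
  - rewrite N2 -exprM mulrC EFinM; apply: lee_wpmul2l; last exact: normal_moment.
    by rewrite lee_fin exprn_ge0.
  - by apply/measurable_EFinP; exact: measurable_funX.
  - by move=> y _; rewrite lee_fin exprM exprn_ge0// sqr_ge0.
  - by rewrite lee_fin exprn_ge0.
have ip : intgP (fun w => X w ^+ (2 * p)).
  apply/integrableP; split; first by apply/measurable_EFinP; exact: measurable_funX.
  apply: le_lt_trans (ltry (moment_const p * nrm2 X ^+ p)); apply: le_trans mom.
  rewrite le_eqVlt; apply/orP; left; apply/eqP; apply: eq_integral => w _ /=.
  by rewrite ger0_norm// exprM exprn_ge0// sqr_ge0.
by split => //; rewrite -lee_fin -(Ex_EFin P).
Qed.

Lemma Ex_sum (I : Type) (s : seq I) (F : I -> T -> R) : (forall i, intgP (F i)) ->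
  intgP (fun w => \sum_(i <- s) F i w) /\
  Ex P (fun w => \sum_(i <- s) F i w) = \sum_(i <- s) Ex P (F i).
Proof.
move=> iF; elim: s => [|i s [i1 IH]].
  under eq_fun do rewrite big_nil; rewrite big_nil Ex_cst; split => //.
  exact: finite_measure_integrable_cst.
under [X in Ex P X]eq_fun do rewrite big_cons.
rewrite big_cons ExD// IH; split => //.
by apply: eq_integrable (integrable_fD P _ _ (iF i) i1) => // w _ /=; rewrite big_cons.
Qed.

End CenteredGaussian.

Section FieldSpace.
Context {R : realType} {n m : nat} {d : measure_display} {T : measurableType d}.
Variables (P : probability T R) (F : T -> 'rV[R]_n -> 'rV[R]_m) (U : set 'rV[R]_n).
Hypothesis GF : gaussian_field P F U.
Hypothesis F0 : forall i x, U x -> Ex P (fun w => fc F i w x) = 0.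

Definition field_span (X : T -> R) : Prop :=
  exists (k : nat) (c : 'I_k -> R) (idx : 'I_k -> 'I_m) (pts : 'I_k -> 'rV[R]_n),
    (forall j, U (pts j)) /\ X = fun w => \sum_j c j * F w (pts j) ord0 (idx j).

Lemma field_span_gaussian X : field_span X -> gaussian_rv P X.
Proof. by move=> [k [c [idx [pts [Up ->]]]]]; exact: GF. Qed.

Lemma field_span_val i x : U x -> field_span (fun w => fc F i w x).
Proof.
move=> Ux; exists 1%N, (fun=> 1), (fun=> i), (fun=> x); split => //.
by apply/funext => w; rewrite big_ord1 mul1r.
Qed.

Lemma field_span_centered X : field_span X -> Ex P X = 0.
Proof.
move=> [k [c [idx [pts [Up ->]]]]].
have int j : P.-integrable setT (EFin \o (fun w => F w (pts j) ord0 (idx j))).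
  apply: L2_integrable; apply: gaussian_rv_L2.
  exact: field_span_gaussian (field_span_val (idx j) (pts j) (Up j)).
have [|_ ->] := Ex_sum P _ (index_enum 'I_k) (fun j w => c j * F w (pts j) ord0 (idx j)).
  by move=> j; exact: integrable_fZ.
by rewrite big1// => j _; rewrite ExZ// [X in _ * X]F0 ?mulr0.
Qed.

Lemma field_span_lin (a : R) X Y : field_span X -> field_span Y ->
  field_span (fun w => a * X w + Y w).
Proof.
move=> [k [c [i [p [Up ->]]]]] [k' [c' [i' [p' [Up' ->]]]]].
pose glue (A : Type) (f : 'I_k -> A) (f' : 'I_k' -> A) (j : 'I_(k + k')) :=
  match fintype.split j with inl l => f l | inr l => f' l end.
exists (k + k')%N, (glue R (fun l => a * c l) c'), (glue 'I_m i i'), (glue 'rV[R]_n p p'); split.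
  by move=> j; rewrite /glue; case: fintype.split.
apply/funext => w; rewrite big_split_ord/= mulr_sumr; congr (_ + _); apply: eq_bigr => j _.
  by rewrite /glue; case: split_ordP => l /eqP; rewrite ?eq_lshift ?eq_lrshift// => /eqP <-; rewrite mulrA.
by rewrite /glue; case: split_ordP => l /eqP; rewrite ?eq_rshift ?eq_rlshift// => /eqP <-.
Qed.

Lemma field_span_space : gaussian_space P field_span.
Proof.
have laws X : field_span X -> _ := fun SX =>
  centered_gaussian_laws P X (field_span_gaussian X SX) (field_span_centered X SX).
split.
- by move=> X /field_span_gaussian; exact: gaussian_rv_L2.
- exact: field_span_lin.
- by move=> X /laws[].
- by move=> p X /laws[].
Qed.

End FieldSpace.

(** * Mean square derivatives of the field *)

Section MeanSquareDerivative.
Context {R : realType} {n : nat} {d : measure_display} {T : measurableType d}.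
Variable P : probability T R.
Local Notation L2 := (L2 P).
Local Notation nrm2 := (nrm2 P).
Implicit Types (W : 'rV[R]_n -> T -> R) (v x u : 'rV[R]_n) (DW Z : T -> R).

Definition diffq W v x (h : R) (w : T) : R := h^-1 * (W (h *: v + x) w - W x w).

Definition L2deriv W v x DW := [/\ L2 (W x), L2 DW & forall e : R, 0 < e ->
  exists2 delta : R, 0 < delta & forall h : R, 0 < `|h| < delta ->
    L2 (W (h *: v + x)) /\ nrm2 (fun w => diffq W v x h w - DW w) <= e].

Lemma L2_diffq W v x h : L2 (W (h *: v + x)) -> L2 (W x) -> L2 (diffq W v x h).
Proof. by move=> L1 L0; apply: L2_scale; exact: L2_sub. Qed.

(** Pairing with a fixed [Z] is continuous in mean square and hence commutes with the derivative. In
    this way derivatives of the field are read off the covariance. *)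
Lemma L2deriv_Ex W v x DW Z : L2deriv W v x DW -> L2 Z ->
  is_derive x v (fun y => Ex P (fun w => W y w * Z w) : R^o) (Ex P (fun w => DW w * Z w)).
Proof.
move=> [LW LD H] LZ.
suff C : (fun h : R => h^-1 *: (((fun y => Ex P (fun w => W y w * Z w) : R^o) \o shift x) (h *: v)
    - Ex P (fun w => W x w * Z w))) h @[h --> 0^'] --> (Ex P (fun w => DW w * Z w) : R^o).
  by apply: DeriveDef; [exact: cvgP C|exact: cvg_lim C].
apply/cvgrPdist_le => e e0; set q := Num.sqrt (nrm2 Z).
have q0 : 0 <= q by exact: sqrtr_ge0.
have q1 : 0 < 1 + q by rewrite ltr_pwDl.
have [|delta delta0 Hd] := H ((e / (1 + q)) ^+ 2); first by rewrite exprn_gt0// divr_gt0.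
near=> h.
have h0 : 0 < `|h| by rewrite normr_gt0; near: h; exact: nbhs_dnbhs_neq.
have hd : `|h| < delta by near: h; apply: dnbhs0_lt.
have [|LWh nh] := Hd h; first by rewrite h0 hd.
have Lq := L2_diffq _ _ _ _ LWh LW.
have E : h^-1 * (Ex P (fun w => W (h *: v + x) w * Z w) - Ex P (fun w => W x w * Z w)) =
    Ex P (fun w => diffq W v x h w * Z w).
  rewrite -(ExB P) ?(L2_mul P)//.
  have -> : (fun w => W (h *: v + x) w * Z w - W x w * Z w) = (fun w => (W (h *: v + x) w - W x w) * Z w).
    by apply/funext => w; ring.
  rewrite -(ExZ P); last by apply: L2_mul => //; exact: L2_sub.
  by congr Ex; apply/funext => w; rewrite /diffq mulrA.
rewrite /= -[X in _ - X]/(h^-1 * (Ex P _ - Ex P _)) E distrC -(ExB P) ?(L2_mul P)//.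
have -> : (fun w => diffq W v x h w * Z w - DW w * Z w) = (fun w => (diffq W v x h w - DW w) * Z w).
  by apply/funext => w; ring.
apply: le_trans (Ex_mul_le P _ _ (L2_sub P _ _ Lq LD) LZ) _.
apply: (@le_trans _ _ (e / (1 + q) * q)).
  apply: ler_wpM2r => //; rewrite -[leRHS]ger0_norm; last by rewrite divr_ge0// ltW.
  by rewrite -sqrtr_sqr ler_sqrt// sqr_ge0.
by rewrite -mulrA ler_piMr ?(ltW e0)// ler_pdivrMl// mulr1; lra.
Unshelve. all: by end_near. Qed.

(** A mean value inequality in a Hilbert space by duality: pair with the increment [Z] itself, apply
    the scalar inequality, and divide by the norm of [Z]. *)
Lemma L2_mvt W v u (DW : R -> T -> R) (h B : R) : 0 <= B ->
  (forall t : R, (0 <= t <= h) || (h <= t <= 0) ->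
     L2deriv W v (t *: v + u) (DW t) /\ nrm2 (DW t) <= B) ->
  nrm2 (fun w => W (h *: v + u) w - W u w) <= h ^+ 2 * B.
Proof.
move=> B0 H; pose Z w := W (h *: v + u) w - W u w.
have [|[Lh _ _] _] := H h; first by rewrite lexx andbT le_total.
have [|[Lu _ _] _] := H 0; first by rewrite lexx/= andbT le_total.
rewrite scale0r add0r in Lu.
have LZ : L2 Z by exact: L2_sub.
pose q := Num.sqrt (nrm2 Z).
have q0 : 0 <= q by exact: sqrtr_ge0.
have := @coord_mvt _ _ (fun y => Ex P (fun w => W y w * Z w)) u v h 0 (Num.sqrt B * q).
move=> /(_ _)/wrap[].
  move=> t /H[Dt Bt]; have [dt et] := L2deriv_Ex _ _ _ _ _ Dt LZ; split => //.
  have [_ LD _] := Dt.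
  rewrite et subr0; apply: le_trans (Ex_mul_le P _ _ LD LZ) _.
  by apply: ler_wpM2r => //; rewrite ler_sqrt.
rewrite mulr0 subr0 -(ExB P) ?(L2_mul P)//.
have -> : (fun w => W (h *: v + u) w * Z w - W u w * Z w) = (fun w => Z w ^+ 2).
  by apply/funext => w; rewrite /Z; ring.
rewrite -/(nrm2 Z) ger0_norm ?nrm2_ge0//.
rewrite -{1}(sqr_sqrtr (nrm2_ge0 P Z)) -/q => E.
have : q <= Num.sqrt B * `|h|.
  have [->|qp] := eqVneq q 0; first by rewrite mulr_ge0 ?sqrtr_ge0.
  by have qq : 0 < q; [rewrite lt_def qp|rewrite -(ler_pM2r qq) -expr2 mulrAC].
move=> qB; have : q ^+ 2 <= (Num.sqrt B * `|h|) ^+ 2.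
  by apply: lerXn2r => //; rewrite nnegrE// mulr_ge0 ?sqrtr_ge0.
by rewrite exprMn !sqr_sqrtr ?nrm2_ge0// real_normK ?num_real// mulrC.
Qed.

Lemma L2deriv_shift_sub W v x a DW DW' : L2deriv W v x DW -> L2deriv W v (a + x) DW' ->
  L2deriv (fun y w => W (a + y) w - W y w) v x (fun w => DW' w - DW w).
Proof.
move=> [L1 L2' H] [L3 L4 H']; split; [exact: L2_sub|exact: L2_sub|] => e e0.
have e4 : 0 < e / 4 by rewrite divr_gt0.
have [d1 d10 H1] := H _ e4; have [d2 d20 H2] := H' _ e4.
exists (Num.min d1 d2); first by rewrite lt_min d10.
move=> h; rewrite lt_min => /and3P[h0 h1 h2].
have [|La Na] := H1 h; first by rewrite h0.
have [|Lb Nb] := H2 h; first by rewrite h0.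
have E : a + (h *: v + x) = h *: v + (a + x) by rewrite addrCA.
rewrite E; split; first exact: L2_sub.
have La' := L2_sub P _ _ (L2_diffq _ _ _ _ La L1) L2'.
have Lb' := L2_sub P _ _ (L2_diffq _ _ _ _ Lb L3) L4.
have := nrm2_sub_le P _ _ (L2_scale P (-1) _ La') Lb'; rewrite nrm2_scale//.
have -> : (fun w => -1 * (diffq W v x h w - DW w) + (diffq W v (a + x) h w - DW' w)) =
  (fun w => diffq (fun y w => W (a + y) w - W y w) v x h w - (DW' w - DW w)).
  by apply/funext => w; rewrite /diffq E; ring.
by rewrite sqrrN expr1n; lra.
Qed.

Lemma L2deriv_nrm2_le W v x DW (B e0 : R) : 0 <= B -> 0 < e0 -> L2deriv W v x DW ->
  (forall h : R, 0 < `|h| < e0 -> nrm2 (fun w => W (h *: v + x) w - W x w) <= h ^+ 2 * B) ->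
  nrm2 DW <= B.
Proof.
move=> B0 e00 [LW LD H] HB.
suff S : Num.sqrt (nrm2 DW) <= Num.sqrt B by move: S; rewrite ler_sqrt.
apply/ler_addgt0Pr => e ep.
have [|delta d0 Hd] := H (e ^+ 2); first by rewrite exprn_gt0.
pose h := Num.min delta e0 / 2.
have m0 : 0 < Num.min delta e0 by rewrite lt_min d0.
have h0 : 0 < h by rewrite divr_gt0.
have hm : h < Num.min delta e0 by rewrite /h; lra.
move: hm; rewrite lt_min => /andP[h1 h2].
have [|Lh Nh] := Hd h; first by rewrite gtr0_norm// h0.
have Lq := L2_diffq _ _ _ _ Lh LW.
have := nrm2_triangle P _ _ Lq (L2_scale P (-1) _ (L2_sub P _ _ Lq LD)).
have -> : (fun w => diffq W v x h w + -1 * (diffq W v x h w - DW w)) = DW.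
  by apply/funext => w; ring.
move=> K; apply: le_trans K _; apply: lerD.
  rewrite ler_sqrt// /diffq (nrm2_scale P _ _ (L2_sub P _ _ Lh LW)).
  rewrite exprVn ler_pdivrMl ?exprn_gt0//.
  by apply: HB; rewrite gtr0_norm// h0.
rewrite (nrm2_scale P _ _ (L2_sub P _ _ Lq LD)) sqrrN expr1n mul1r.
by rewrite -[leRHS](gtr0_norm ep) -sqrtr_sqr ler_sqrt// sqr_ge0.
Qed.

End MeanSquareDerivative.

Section GaussianDerivative.
Context {R : realType} {n : nat} {d : measure_display} {T : measurableType d}.
Variables (P : probability T R) (S : (T -> R) -> Prop).
Hypothesis GS : gaussian_space P S.
Local Notation hull := (hull P S).
Variables (W : 'rV[R]_n -> T -> R) (x v : 'rV[R]_n) (e : R).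
Hypothesis e0 : 0 < e.
Hypothesis HW : forall h : R, `|h| < e -> hull (W (h *: v + x)).
Hypothesis dW : forall w, derivable (fun y => W y w : R^o) x v.

Let DW w : R := 'D_v (fun y => W y w : R^o) x.

Let Wx : hull (W x).
Proof. by have := HW 0; rewrite normr0 scale0r add0r; exact. Qed.

Let diffq_limit (h : R^nat) : (forall k, h k != 0) -> (forall k, `|h k| < e * harmonic k) ->
  hull DW /\ forall eps : R, 0 < eps -> exists N, forall k, (N <= k)%N ->
    nrm2 P (fun w => diffq W v x (h k) w - DW w) <= eps.
Proof.
move=> hn0 hk.
have he k : `|h k| < e.
  apply: lt_le_trans (hk k) _; rewrite ler_piMr ?(ltW e0)//.
  by rewrite /harmonic invf_le1// ler1n.
apply: (hull_limit P S GS (fun k => diffq W v x (h k))).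
  by move=> k; apply: (hull_scale P S GS); apply: (hull_sub2 P S GS) => //; exact: HW.
move=> w; have C := dW w.
have := (@cvgr_dnbhsP R (fun t => diffq W v x t w) 0 (DW w)).1 C h; apply; split => //.
apply/cvgr0Pnorm_lt => eps eps0.
have c0 : e * harmonic k @[k --> \oo] --> (0 : R).
  by rewrite -(mulr0 e); apply: cvgM; [exact: cvg_cst|exact: cvg_harmonic].
move/cvgr0Pnorm_lt : c0 => /(_ eps eps0); apply: filterS => k.
by apply: lt_trans; apply: lt_le_trans (hk k) _; exact: ler_norm.
Qed.

(** Along any sequence of steps tending to 0 the difference quotients lie in the hull and converge
    pointwise, so [hull_limit] applies. If mean square convergence failed, it would fail along such
    a sequence. *)
Lemma gaussian_derivative : hull DW /\ L2deriv P W v x DW.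
Proof.
have hDW : hull DW.
  have [| |//] := diffq_limit (fun k => e / 2 * harmonic k).
  - by move=> k; rewrite mulf_neq0// ?mulf_neq0 ?gt_eqF//; exact: harmonic_gt0.
  - move=> k; have := harmonic_gt0 (R := R) k => k0.
    have k1 : 0 < e * harmonic k by exact: mulr_gt0.
    have -> : e / 2 * harmonic k = e * harmonic k / 2 by ring.
    by rewrite gtr0_norm ?divr_gt0// ltr_pdivrMr//; lra.
split => //; split; [exact: hull_L2 Wx|exact: hull_L2 hDW|] => eps eps0.
apply: contrapT => H.
have /choice[h Hh] : forall k, exists t : R, [/\ t != 0, `|t| < e * harmonic k &
    eps < nrm2 P (fun w => diffq W v x t w - DW w)].
  move=> k; apply: contrapT => Hk; apply: H; exists (e * harmonic k).
    by rewrite mulr_gt0//; exact: harmonic_gt0.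
  move=> t /andP[t0 tk]; split.
    apply: (hull_L2 _ S); apply: HW; apply: lt_le_trans tk _; rewrite ler_piMr ?(ltW e0)//.
    by rewrite /harmonic invf_le1// ler1n.
  by rewrite leNgt; apply/negP => ht; apply: Hk; exists t; split => //; rewrite -normr_gt0.
have [||_ /(_ eps eps0)[N HN]] := diffq_limit h; [by move=> k; have [] := Hh k|by move=> k; have [] := Hh k|].
by have := HN N (leqnn N); have [_ _] := Hh N; rewrite ltNge => /negbTE ->.
Qed.

End GaussianDerivative.

Lemma cube_nbhs {R : realType} {n : nat} (r : R) (x : 'rV[R]_n) : cube r x -> nbhs x (cube r).
Proof.
move=> cx.
apply: (@filter_forall _ _ (fun (j : 'I_n) (y : 'rV[R]_n) => is_true (- r < y 0 j < r)) (nbhs x)) => j.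
have /andP[x1 x2] := cx j.
have C : continuous (fun y : 'rV[R]_n => y 0 j) by exact: coord_continuous.
by near=> y; apply/andP; split; near: y; [exact: (cvgr_gt _ (C x))|exact: (cvgr_lt _ (C x))].
Unshelve. all: by end_near. Qed.

Lemma cube_box_convex {R : realType} {n : nat} (r : R) : box_convex (cube (n := n) r).
Proof.
move=> u v w cu cv H j; have := cu j; have := cv j.
by have /orP[/andP[]|/andP[]] := H j; lra.
Qed.

Lemma nbhs_line {R : realType} {n : nat} (U : set 'rV[R]_n) (x v : 'rV[R]_n) : nbhs x U ->
  exists2 e : R, 0 < e & forall h, `|h| < e -> U (h *: v + x).
Proof.
move=> Ux; have C : h *: v + x @[h --> (0 : R)] --> x.
  rewrite -[X in _ --> X]add0r -(scale0r v); apply: cvgD; last exact: cvg_cst.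
  by apply: cvgZr_tmp; exact: cvg_id.
have /nbhs_normP[e /= e0 He] := C _ Ux.
by exists e => // h he; apply: He; rewrite /= sub0r normrN.
Qed.

Section FieldDerivatives.
Context {R : realType} {n m : nat} {d : measure_display} {T : measurableType d}.
Variables (P : probability T R) (F : T -> 'rV[R]_n -> 'rV[R]_m) (U : set 'rV[R]_n).
Hypothesis GF : gaussian_field P F U.
Hypothesis F0 : forall i x, U x -> Ex P (fun w => fc F i w x) = 0.
Hypothesis Uo : forall x, U x -> nbhs x U.
Hypothesis smF : forall w i s, (size s <= 2)%N -> pds_ok U s (fc F i w).
Local Notation hull := (hull P (field_span F U)).
Local Notation L2 := (L2 P).
Local Notation nrm2 := (nrm2 P).

Let GS := field_span_space P F U GF F0.

Lemma pds_derivative j s i x : (size s <= 1)%N -> U x ->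
  (forall y, U y -> hull (fun w => pds s (fc F i w) y)) ->
  hull (fun w => pds (j :: s) (fc F i w) x) /\
  L2deriv P (fun y w => pds s (fc F i w) y) (ev j) x (fun w => pds (j :: s) (fc F i w) x).
Proof.
move=> s1 Ux Hs; have [e e0 He] := nbhs_line U x (ev j) (Uo x Ux).
apply: (gaussian_derivative P _ GS (fun y w => pds s (fc F i w) y) x (ev j) e e0).
  by move=> h /He; exact: Hs.
by move=> w; have [_ H] := smF w i (j :: s) s1; exact: H.
Qed.

Lemma pds_hull s i x : (size s <= 2)%N -> U x -> hull (fun w => pds s (fc F i w) x).
Proof.
elim: s x => [|j s IH] x s2 Ux.
  by apply: (hull_sub P _ GS); exact: field_span_val.
have [y Uy|//] := pds_derivative j s i x s2 Ux.
by apply: IH => //; exact: ltnW.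
Qed.

Lemma pds_L2deriv j s i x : (size s <= 1)%N -> U x ->
  L2deriv P (fun y w => pds s (fc F i w) y) (ev j) x (fun w => pds (j :: s) (fc F i w) x).
Proof.
move=> s1 Ux; have [|//] := pds_derivative j s i x s1 Ux => y Uy.
by apply: pds_hull => //; exact: leq_trans s1 _.
Qed.

(** One derivative at a time is moved inside the expectation. The formula for [g] is known on [U]
    only, which is enough for derivatives because [U] is open. *)
Lemma pds_Ex s (g : 'rV[R]_n -> R^o) Z i x : (size s <= 2)%N -> L2 Z ->
  (forall y, U y -> g y = Ex P (fun w => fc F i w y * Z w)) -> U x ->
  pds s g x = Ex P (fun w => pds s (fc F i w) x * Z w).
Proof.
move=> s2 LZ gE; elim: s s2 x => [|j s IH] s2 x Ux; first exact: gE.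
rewrite /= /pd (@near_eq_derive _ _ _ _ (fun y => Ex P (fun w => pds s (fc F i w) y * Z w) : R^o)).
  by have [_ ->] := L2deriv_Ex P _ _ _ _ Z (pds_L2deriv j s i x s2 Ux) LZ.
by apply: filterS (Uo x Ux) => y; apply: IH; exact: ltnW.
Qed.

(* [F'] may differ from [F] outside of [U] and on a null set. *)
Lemma DxDyK_nrm2 (F' : T -> 'rV[R]_n -> 'rV[R]_m) s i x :
  (forall y z, U y -> U z -> cov_kernel P F' i i y z = cov_kernel P F i i y z) ->
  (size s <= 2)%N -> U x -> DxDyK P F' s i i x x = nrm2 (fun w => pds s (fc F i w) x).
Proof.
move=> FF' s2 Ux; have LX t y : (size t <= 2)%N -> U y -> L2 (fun w => pds t (fc F i w) y).
  by move=> t2 Uy; exact: hull_L2 (pds_hull t i y t2 Uy).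
(* The inner derivatives are taken with the value of the field at [y] as partner, the outer ones
   with the derivative at [x] already produced. *)
rewrite /DxDyK (pds_Ex s _ (fun w => pds s (fc F i w) x) i) //; first exact: LX.
move=> y Uy; rewrite /DyK (pds_Ex s _ (fun w => fc F i w y) i) //.
- by congr Ex; apply/funext => w; rewrite mulrC.
- exact: (LX [::]).
- by move=> z Uz; rewrite FF'// /cov_kernel; congr Ex; apply/funext => w; rewrite mulrC.
Qed.

Variable M : R.
Hypothesis cU : box_convex U.
Hypothesis HM : forall i s, multi_index s -> (size s <= 2)%N -> forall x, U x ->
  nrm2 (fun w => pds s (fc F i w) x) <= M.

Lemma segment_in x (h t : R) l : U x -> U (h *: ev l + x) ->
  (0 <= t <= h) || (h <= t <= 0) -> U (t *: ev l + x).
Proof.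
move=> Ux Uh th; apply: (cU x (h *: ev l + x)) => // j; rewrite !mxE eqxx/=.
by have [->|_] := eqVneq j l; rewrite ?mulr1 ?mulr0 ?add0r ?lexx//; have /orP[/andP[]|/andP[]] := th; lra.
Qed.

Hypothesis M0 : 0 <= M.

(** The variance bounds concern derivatives listed in nondecreasing order; [l <= j] is the case in
    which the second derivative met along the segment is so listed. *)
Lemma pd_increment_sorted i (l j : 'I_n) h x : (l <= j)%N -> U x -> U (h *: ev l + x) ->
  nrm2 (fun w => pd j (fc F i w) (h *: ev l + x) - pd j (fc F i w) x) <= h ^+ 2 * M.
Proof.
move=> lj Ux Uh.
apply: (L2_mvt P (fun y w => pd j (fc F i w) y) (ev l) x
  (fun t w => pds [:: l; j] (fc F i w) (t *: ev l + x)) h M M0) => t th.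
have Ut := segment_in x h t l Ux Uh th; split; first exact: (pds_L2deriv l [:: j]).
by apply: (HM i [:: l; j]) => //; rewrite /multi_index/= lj.
Qed.

(* For [j < l] the mixed derivatives are exchanged through the symmetric second difference. *)
Lemma pd_increment i (l j : 'I_n) h x : U x -> U (h *: ev l + x) ->
  nrm2 (fun w => pd j (fc F i w) (h *: ev l + x) - pd j (fc F i w) x) <= h ^+ 2 * M.
Proof.
move=> Ux Uh; have [lj|/ltnW jl] := leqP l j; first exact: pd_increment_sorted.
have [e1 e10 He1] := nbhs_line U _ (ev j) (Uo _ Ux).
have [e2 e20 He2] := nbhs_line U _ (ev j) (Uo _ Uh).
have hM : 0 <= h ^+ 2 * M by rewrite mulr_ge0// sqr_ge0.
have e0 : 0 < Num.min e1 e2 by rewrite lt_min e10.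
apply: (L2deriv_nrm2_le P (fun y w => fc F i w (h *: ev l + y) - fc F i w y) (ev j) x _ _ _ hM e0).
  by apply: (L2deriv_shift_sub P (fun y w => fc F i w y)); exact: (pds_L2deriv j [::]).
move=> t /andP[_]; rewrite lt_min => /andP[t1 t2].
have Ut := He1 t t1; have Uht := He2 t t2.
(* The double difference, reached as an increment in direction [j], is reread as an increment in
   direction [l]. The derivative to be bounded is then the [l]-th one, moved in direction [j], which
   is the sorted case. *)
have -> : (fun w => fc F i w (h *: ev l + (t *: ev j + x)) - fc F i w (t *: ev j + x)
    - (fc F i w (h *: ev l + x) - fc F i w x)) =
  (fun w => (fc F i w (t *: ev j + (h *: ev l + x)) - fc F i w (h *: ev l + x))
    - (fc F i w (t *: ev j + x) - fc F i w x)).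
  by apply/funext => w; rewrite addrCA; ring.
have -> : t ^+ 2 * (h ^+ 2 * M) = h ^+ 2 * (t ^+ 2 * M) by ring.
have tM : 0 <= t ^+ 2 * M by rewrite mulr_ge0// sqr_ge0.
have := L2_mvt P (fun y w => fc F i w (t *: ev j + y) - fc F i w y) (ev l) x
  (fun s w => pd l (fc F i w) (t *: ev j + (s *: ev l + x)) - pd l (fc F i w) (s *: ev l + x)) h _ tM.
apply => s sh.
have Us := segment_in x h s l Ux Uh sh.
have Uts : U (t *: ev j + (s *: ev l + x)).
  by rewrite addrCA; apply: (segment_in (t *: ev j + x) h) => //; rewrite addrCA.
split; last exact: pd_increment_sorted.
by apply: (L2deriv_shift_sub P (fun y w => fc F i w y)); exact: (pds_L2deriv l [::]).
Qed.

(** The root of [nrm2] satisfies the triangle inequality, so [box_path] reduces the claim to moves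
    of one coordinate. *)
Lemma pd_L2_lipschitz i j x y : U x -> U y ->
  nrm2 (fun w => pd j (fc F i w) y - pd j (fc F i w) x) <= M * (\sum_l `|y 0 l - x 0 l|) ^+ 2.
Proof.
move=> Ux Uy.
have L2pd z : U z -> L2 (fun w => pd j (fc F i w) z) by move=> Uz; exact: hull_L2 (pds_hull [:: j] i z isT Uz).
pose rho (u v : 'rV[R]_n) := Num.sqrt (nrm2 (fun w => pd j (fc F i w) v - pd j (fc F i w) u)).
have rhoS : rho x y <= Num.sqrt M * \sum_l `|y 0 l - x 0 l|.
  apply: (box_path U rho (Num.sqrt M) cU) => //.
  - move=> u; rewrite /rho; have -> : (fun w => pd j (fc F i w) u - pd j (fc F i w) u) = fun=> 0.
      by apply/funext => w; rewrite subrr.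
    by rewrite -[nrm2 _]/(Ex P (fun=> 0 ^+ 2)) expr0n Ex_cst sqrtr0.
  - move=> u v w Uu Uv Uw; rewrite /rho.
    have := nrm2_triangle P _ _ (L2_sub P _ _ (L2pd v Uv) (L2pd u Uu)) (L2_sub P _ _ (L2pd w Uw) (L2pd v Uv)).
    set a := nrm2 _; have -> // : a = nrm2 (fun w0 => pd j (fc F i w0) w - pd j (fc F i w0) u).
    by congr (nrm2 _); apply/funext => t; ring.
  - move=> u l h Uu Uh; rewrite /rho -(sqrtr_sqr h) -sqrtrM// ler_sqrt; last exact: mulr_ge0 M0 (sqr_ge0 h).
    by rewrite mulrC; exact: pd_increment.
rewrite -[M in leRHS](sqr_sqrtr M0) -exprMn -[leLHS]sqr_sqrtr ?nrm2_ge0//.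
by apply: lerXn2r; rewrite ?nnegrE ?sqrtr_ge0// mulr_ge0 ?sqrtr_ge0// sumr_ge0.
Qed.

End FieldDerivatives.

(** * Probability of a bad cell and moments *)

Section SmallEvents.
Context {R : realType} {d : measure_display} {T : measurableType d}.
Variable P : probability T R.
Implicit Types (A B : set T) (q : R).

Definition small_event A q := measurable A /\ (P A <= q%:E)%E.

Lemma small_event_le A q q' : small_event A q -> q <= q' -> small_event A q'.
Proof. by move=> [mA h] qq'; split => //; apply: le_trans h _; rewrite lee_fin. Qed.

Lemma small_event_or A B q q' : small_event A q -> small_event B q' ->
  small_event [set w | A w \/ B w] (q + q').
Proof.
move=> [mA hA] [mB hB]; split; first exact: measurableU.
by apply: le_trans (measureU2 P mA mB) _; rewrite EFinD; exact: leeD.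
Qed.

Lemma small_event_exists (I : finType) (E : I -> set T) q : (forall i, small_event (E i) q) ->
  small_event [set w | exists i, E i w] (#|I|%:R * q).
Proof.
move=> HE; have -> : [set w | exists i, E i w] = [set w | exists2 i, i \in enum I & E i w].
  by apply/seteqP; split => w; [move=> [i]|move=> [i _]]; exists i; rewrite ?mem_enum.
rewrite cardE; elim: (enum I) => [|i s IH].
  have -> : [set w | exists2 i : I, i \in [::] & E i w] = set0.
    by apply/seteqP; split => w // [].
  by split => //; rewrite measure0 mul0r.
have -> : [set w | exists2 j, j \in i :: s & E j w] =
    [set w | E i w \/ [set w | exists2 j, j \in s & E j w] w].
  apply/seteqP; split => w.
    by move=> [j]; rewrite inE => /predU1P[->|js] Ej; [left|right; exists j].
  by move=> [Ei|[j js Ej]]; [exists i; rewrite ?mem_head|exists j; rewrite ?inE ?js ?orbT].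
rewrite /= -natr1 addrC mulrDl mul1r.
exact: small_event_or (HE i) IH.
Qed.

Lemma small_event_cond A q (C : Prop) : 0 <= q -> (C -> small_event A q) ->
  small_event [set w | C /\ A w] q.
Proof.
move=> q0 H; have [c|nc] := pselect C.
  by have [mA hA] := H c; have -> : [set w | C /\ A w] = A by apply/seteqP; split => w // [].
have -> : [set w | C /\ A w] = set0 by apply/seteqP; split => w // [].
by split => //; rewrite measure0 lee_fin.
Qed.

End SmallEvents.

Section BadProbability.
Context {R : realType} {n m : nat} {d : measure_display} {T : measurableType d}.
Variables (P : probability T R) (F : T -> 'rV[R]_n -> 'rV[R]_m) (U : set 'rV[R]_n).
Hypothesis GF : gaussian_field P F U.
Hypothesis F0 : forall i x, U x -> Ex P (fun w => fc F i w x) = 0.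
Hypothesis Uo : forall x, U x -> nbhs x U.
Hypothesis smF : forall w i s, (size s <= 2)%N -> pds_ok U s (fc F i w).
Variable M : R.
Hypothesis cU : box_convex U.
Hypothesis HM : forall i s, multi_index s -> (size s <= 2)%N -> forall x, U x ->
  nrm2 P (fun w => pds s (fc F i w) x) <= M.
Hypothesis M0 : 0 <= M.
Variable k1 : R.
Hypothesis k10 : 0 < k1.
Hypothesis HA1 : forall x, U x -> forall (eta : 'I_m -> R) (xi : 'I_m -> 'I_n -> R),
  k1 * (\sum_i eta i ^+ 2 + \sum_i \sum_j xi i j ^+ 2) <=
  nrm2 P (fun w => \sum_i eta i * fc F i w x + \sum_i \sum_j xi i j * pd j (fc F i w) x).
Hypothesis n0 : (0 < n)%N.
Hypothesis m0 : (0 < m)%N.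

Local Notation hull := (hull P (field_span F U)).
Local Notation L2 := (L2 P).
Local Notation nrm2 := (nrm2 P).
Local Notation small_event := (small_event P).
Let GS := field_span_space P F U GF F0.
Let Hpds := pds_hull P F U GF F0 Uo smF.

(** The net has about [b^(k(m-1))] directions and [m + n] variables are below a multiple of [tol k],
    which leaves [b^(-k(n+1)) 2^(k(m+n))]. With this [D] the spare [b^-k] equals
    [2^(-k(m+n)) 16^-k]. *)
Definition depth : nat := (m + n + 4)%N.
Local Notation D := depth.
Let D2 : (2 <= D)%N. Proof. by rewrite /depth; lia. Qed.
Local Notation b := (base D).
Local Notation mesh := (@mesh R D).
Local Notation tol := (@tol R D).
Local Notation half := (2^-1 : R).

(** This is [b^(-kn) 16^-k]: the first factor offsets the number of cells in a unit box, the second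
    pays for the sum over levels. *)
Definition decay (k : nat) : R := half ^+ ((D * n + 4) * k).
(** A moment of order [2p] gains [2^(-2pk)]. Of the exponent [2p = 4Dn + 4], the part [2Dn] pays for
    the pairs of grid points, and the rest is at least the [Dn + 4] of [decay]. *)
Definition moment_order : nat := (2 * (D * n) + 2)%N.
Local Notation p := moment_order.

Lemma mesh_half k : mesh k = half ^+ (D * k).
Proof. by rewrite -[mesh k]/((b ^ k)%:R^-1) /base -expnM natrX exprVn. Qed.

Lemma tol_half_pow k : tol k = 2 ^+ k * half ^+ (D * k).
Proof. by rewrite -[tol k]/(2 ^+ k * mesh k) mesh_half. Qed.

Lemma half_anti i j : (i <= j)%N -> half ^+ j <= half ^+ i.
Proof. by move=> ij; apply: ler_wiXn2l => //; lra. Qed.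

Lemma pow2_half k : 2 ^+ k * half ^+ k = 1 :> R.
Proof. by rewrite -exprMn mulfV// expr1n. Qed.

Lemma decay_ge0 k : 0 <= decay k. Proof. by rewrite exprn_ge0. Qed.

Let mc0 q : 0 <= moment_const q :> R. Proof. by rewrite mulr_ge0. Qed.

Definition steep_const : R := (m * n)%:R * (moment_const p * (16 * (M + 1)) ^+ p).

Let C0 : 0 <= moment_const p * (16 * (M + 1)) ^+ p :> R.
Proof. by rewrite mulr_ge0// exprn_ge0// mulr_ge0// addr_ge0. Qed.

Lemma steep_small y k : U y -> small_event [set w | steep y k (F w)] (steep_const * decay k).
Proof.
move=> Uy.
pose E (ij : 'I_m * 'I_n) := [set w | 2 ^+ k < `|pd ij.2 (fc F ij.1 w) y|].
have -> : [set w | steep y k (F w)] = [set w | exists ij, E ij w].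
  by apply/seteqP; split => w; [move=> [i [j h]]; exists (i, j)|move=> [[i j] h]; exists i, j].
have HE ij : small_event (E ij) (moment_const p * (16 * (M + 1)) ^+ p * decay k).
  have hX := Hpds [:: ij.2] ij.1 y isT Uy.
  split; first by apply: measurable_gt; exact: L2_meas (hull_L2 _ _ _ hX).
  have NV : nrm2 (fun w => pds [:: ij.2] (fc F ij.1 w) y) <= M + 1.
    apply: (@le_trans _ _ M); last by rewrite lerDl.
    exact: (HM ij.1 [:: ij.2]).
  have V0 : 0 < M + 1 by rewrite ltr_wpDl.
  have a0 : 0 < (2 : R) ^+ k by rewrite exprn_gt0.
  apply: le_trans (hull_tail P _ GS _ p _ _ hX NV V0 a0) _; rewrite lee_fin.
  have -> : (2 / 2 ^+ k : R) ^+ (2 * p) = 4 ^+ p * half ^+ (k * (2 * p)).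
    by rewrite exprMn -exprVn -[half ^+ k ^+ _]exprM exprM; congr (_ ^+ _ * _); ring.
  have -> : 4 ^+ p * half ^+ (k * (2 * p)) * (moment_const p * (4 * (M + 1)) ^+ p) =
     moment_const p * (16 * (M + 1)) ^+ p * half ^+ (k * (2 * p)).
    have -> : 16 * (M + 1) = 4 * (4 * (M + 1)) by ring.
    by rewrite [(4 * (4 * _)) ^+ _]exprMn; ring.
  apply: ler_wpM2l => //; apply: half_anti.
  by rewrite mulnC leq_mul2l; apply/orP; right; rewrite /moment_order; lia.
have := small_event_exists P _ E _ HE; rewrite card_prod !card_ord.
by rewrite /steep_const mulrA.
Qed.

Definition rough_const : R :=
  (m * n)%:R * (moment_const p * (16 * ((M + 1) * (n%:R * b%:R) ^+ 2)) ^+ p).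

(** The increment between neighbours has standard deviation of order [mesh k] and must exceed
    [2 ^+ k * mesh k]. The spacing cancels, so only the factor [2 ^+ k] enters the tail bound. *)
Lemma rough_small c k : unit_box c `<=` U ->
  small_event [set w | rough D c k (F w)] (rough_const * decay k).
Proof.
move=> cU'.
pose I := ({ffun 'I_n -> 'I_(b ^ k)} * {ffun 'I_n -> 'I_(b ^ k)} * ('I_m * 'I_n))%type.
pose C (z : I) : Prop := `|gridpt D c k z.1.1 - gridpt D c k z.1.2| <= b%:R * mesh k.
pose A (z : I) := [set w | tol k < `|pd z.2.2 (fc F z.2.1 w) (gridpt D c k z.1.1)
   - pd z.2.2 (fc F z.2.1 w) (gridpt D c k z.1.2)|].
have -> : [set w | rough D c k (F w)] = [set w | exists z, C z /\ A z w].
  apply/seteqP; split => w.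
    by move=> [t [t' [tt' [i [j h]]]]]; exists (t, t', (i, j)).
  by move=> [[[t t'] [i j]] [/= h1 h2]]; exists t, t'; split => //; exists i, j.
pose K := 16 * ((M + 1) * (n%:R * b%:R) ^+ 2).
have nb0 : (0 : R) < n%:R * b%:R.
  by rewrite mulr_gt0// ltr0n// (leq_trans _ (base_ge4 D D2)).
have M1 : 0 < M + 1 by rewrite ltr_wpDl.
have K0 : 0 <= K by rewrite mulr_ge0// mulr_ge0 ?sqr_ge0 ?(ltW M1).
pose q := moment_const p * K ^+ p * half ^+ (k * (2 * p)).
have q0 : 0 <= q by rewrite !mulr_ge0// exprn_ge0.
have HE z : small_event [set w | C z /\ A z w] q.
  apply: small_event_cond => // Cz.
  set u := gridpt D c k z.1.1; set v := gridpt D c k z.1.2.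
  have Uu : U u by apply: cU'; exact: gridpt_box.
  have Uv : U v by apply: cU'; exact: gridpt_box.
  have hX : hull (fun w => pd z.2.2 (fc F z.2.1 w) u - pd z.2.2 (fc F z.2.1 w) v).
    by apply: (hull_sub2 P _ GS); exact: (Hpds [:: z.2.2]).
  split; first by apply: measurable_gt; exact: L2_meas (hull_L2 _ _ _ hX).
  pose V := (M + 1) * (n%:R * b%:R * mesh k) ^+ 2.
  have mk := mesh_gt0 (R := R) D D2 k.
  have V0 : 0 < V by rewrite mulr_gt0// exprn_gt0// mulr_gt0.
  have NV : nrm2 (fun w => pd z.2.2 (fc F z.2.1 w) u - pd z.2.2 (fc F z.2.1 w) v) <= V.
    apply: le_trans (pd_L2_lipschitz P F U GF F0 Uo smF M cU HM M0 z.2.1 z.2.2 v u Uv Uu) _.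
    apply: ler_pM; rewrite ?sqr_ge0 ?lerDl//.
    apply: lerXn2r; rewrite ?nnegrE ?sumr_ge0 ?mulr_ge0 ?(ltW nb0) ?(ltW mk)//.
    apply: (@le_trans _ _ (\sum_(l < n) (b%:R * mesh k))).
      apply: ler_sum => l _; apply: le_trans Cz.
      by have := mx_entry_le (u - v) 0 l; rewrite !mxE.
    by rewrite sumr_const card_ord -[leLHS]mulr_natl mulrA.
  have t0 := tol_gt0 (R := R) D D2 k.
  apply: le_trans (hull_tail P _ GS _ p _ _ hX NV V0 t0) _; rewrite lee_fin /q.
  rewrite le_eqVlt; apply/orP; left; apply/eqP.
  rewrite mulrCA -[RHS]mulrA; congr (_ * _).
  rewrite exprM -exprMn mulnA mulnC exprM -exprM mulnC [half ^+ _]exprM -exprMn.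
  congr (_ ^+ _); rewrite /V /K -[tol k]/(2 ^+ k * mesh k).
  have k2 : (2 : R) ^+ k != 0 by rewrite expf_neq0.
  by rewrite exprM exprVn; field; rewrite k2 gt_eqF.
have := small_event_exists P _ _ _ HE => H.
apply: small_event_le H _.
rewrite !card_prod !card_ffun !card_ord /rough_const -/K.
have -> : (((b ^ k) ^ n * (b ^ k) ^ n * (m * n))%N%:R : R) = (m * n)%:R * 2 ^+ (2 * (D * n) * k).
  rewrite natrM mulrC; congr (_ * _); rewrite /base -!expnM -expnD natrX; congr (_ ^+ _); lia.
have -> : (m * n)%:R * 2 ^+ (2 * (D * n) * k) * q =
    (m * n)%:R * (moment_const p * K ^+ p) * (2 ^+ (2 * (D * n) * k) * half ^+ (k * (2 * p))).
  by rewrite /q; ring.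
apply: ler_wpM2l; first by rewrite !mulr_ge0// exprn_ge0.
have -> : (k * (2 * p) = 2 * (D * n) * k + (2 * (D * n) + 4) * k)%N by rewrite /moment_order; lia.
rewrite exprD mulrA pow2_half mul1r; apply: half_anti.
by rewrite leq_mul2r; apply/orP; right; lia.
Qed.

Definition degenerate_const : R :=
  m%:R * 3 ^+ m * (expR 1 * (degenerate_tol (R := R) (n := n) (m := m) D) / Num.sqrt k1) ^+ (m + n).

Lemma degenerate_tol_gt0 : 0 < degenerate_tol (R := R) (n := n) (m := m) D.
Proof.
rewrite /degenerate_tol ltr_wpDl ?mulr_gt0 ?ltr0n// addr_ge0// mulr_ge0//.
Qed.

(** For a fixed net vector [u], the components of [F] and of [u . DF] at [y] are [m + n] variables.
    Their combinations have the form of [HA1] with [xi i j = c_j u_i], and the coordinate of [u]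
    equal to 1 keeps the sum of squares at least that of [c]. Hence [small_ball] applies with [k1],
    uniformly in the net. *)
Lemma degenerate_small y k : U y ->
  small_event [set w | degenerate D k y (F w)] (degenerate_const * decay k).
Proof.
move=> Uy.
pose I := ('I_m * {ffun 'I_m.-1 -> 'I_(2 * b ^ k).+1})%type.
pose al := degenerate_tol (R := R) (n := n) (m := m) D * tol k.
have al0 : 0 < al by rewrite mulr_gt0 ?degenerate_tol_gt0 ?tol_gt0.
pose u (z : I) := netvec D k z.1 z.2 : 'cV[R]_m.
pose X (z : I) (a : 'I_(m + n)) (w : T) : R := match fintype.split a with
  | inl i => fc F i w y | inr j => \sum_i pd j (fc F i w) y * u z i 0 end.
pose E (z : I) := [set w | forall a, `|X z a w| <= al].
have -> : [set w | degenerate D k y (F w)] = [set w | exists z, E z w].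
  apply/seteqP; split => w.
    move=> [h1 [i [q h2]]]; exists (i, q) => a; rewrite /X; case: fintype.split => [i'|j].
      exact: h1.
    have := h2 j; rewrite mxE /al; congr (`|_| <= _); apply: eq_bigr => l _.
    by rewrite mxE.
  move=> [[i q] H]; split => [i'|].
    by have := H (lshift n i'); rewrite /X (unsplitK (inl i')).
  exists i, q => j; have := H (rshift m j); rewrite /X (unsplitK (inr j)) mxE /al.
  by congr (`|_| <= _); apply: eq_bigr => l _; rewrite [jac _ _ _ _]mxE.
have hX z a : hull (X z a).
  rewrite /X; case: fintype.split => [i|j]; first exact: (Hpds [::]).
  apply: (hull_sum P _ GS); first by rewrite card_ord.
  move=> i; under eq_fun do rewrite mulrC.
  by apply: (hull_scale P _ GS); exact: (Hpds [:: j]).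
have nd z (c : 'I_(m + n) -> R) : k1 * \sum_a c a ^+ 2 <= nrm2 (fun w => \sum_a c a * X z a w).
  have := HA1 y Uy (fun i => c (lshift n i)) (fun i j => c (rshift m j) * u z i 0).
  have -> : (fun w => \sum_i c (lshift n i) * fc F i w y +
      \sum_i \sum_j c (rshift m j) * u z i 0 * pd j (fc F i w) y) =
      (fun w => \sum_a c a * X z a w).
    apply/funext => w; rewrite big_split_ord/=; congr (_ + _).
      by apply: eq_bigr => i _; rewrite /X (unsplitK (inl i)).
    rewrite exchange_big/=; apply: eq_bigr => j _; rewrite /X (unsplitK (inr j)) mulr_sumr.
    by apply: eq_bigr => i _; ring.
  apply: le_trans; apply: ler_wpM2l; first exact: ltW.
  rewrite big_split_ord/=; apply: lerD => //.
  rewrite [leRHS]exchange_big/=; apply: ler_sum => j _.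
  rewrite (bigD1 z.1)//= /u mxE; case: unliftP => [l /eqP|_]; first by rewrite (negbTE (neq_lift _ _)).
  by rewrite mulr1 lerDl sumr_ge0// => i _; exact: sqr_ge0.
have HE z : small_event (E z) ((expR 1 * al / Num.sqrt k1) ^+ (m + n)).
  split; last exact: (small_ball P _ GS _ _ _ _ (hX z) k10 al0 (nd z)).
  have -> : E z = \bigcap_(a in [set: 'I_(m + n)]) ~` [set w | al < `|X z a w|].
    apply/seteqP; split => w; first by move=> Aw a _ /=; apply/negP; rewrite -leNgt.
    by move=> Aw a; rewrite leNgt; apply/negP; exact: Aw.
  apply: fin_bigcap_measurable => // a _; apply: measurableC; apply: measurable_gt.
  exact: L2_meas (hull_L2 _ _ _ (hX z a)).
apply: small_event_le (small_event_exists P _ _ _ HE) _.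
rewrite card_prod card_ffun !card_ord natrM.
have c0 : 0 <= expR 1 * degenerate_tol (R := R) (n := n) (m := m) D / Num.sqrt k1.
  by rewrite divr_ge0 ?sqrtr_ge0// mulr_ge0 ?expR_ge0// ltW// degenerate_tol_gt0.
have -> : expR 1 * al / Num.sqrt k1 = expR 1 * degenerate_tol (R := R) (n := n) (m := m) D / Num.sqrt k1 * tol k.
  by rewrite /al; ring.
rewrite exprMn /degenerate_const; set cc := (_ / Num.sqrt k1) ^+ (m + n).
have cc0 : 0 <= cc by exact: exprn_ge0.
have net : ((2 * b ^ k).+1 ^ m.-1)%N%:R <= 3 ^+ m * 2 ^+ (D * k * m.-1) :> R.
  have -> : 3 ^+ m * 2 ^+ (D * k * m.-1) = (3 ^ m * (b ^ k) ^ m.-1)%N%:R :> R.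
    by rewrite natrM /base -!expnM !natrX mulnA.
  rewrite ler_nat; apply: (@leq_trans (3 ^ m.-1 * (b ^ k) ^ m.-1)%N).
    have mono (s t e : nat) : (s <= t)%N -> (s ^ e <= t ^ e)%N.
      by case: e => // e st; rewrite leq_exp2r.
    by rewrite -expnMn; apply: mono; have := basek_gt0 D D2 k; lia.
  by rewrite leq_mul2r leq_exp2l// leq_pred orbT.
have tE : tol k ^+ (m + n) = 2 ^+ (k * (m + n)) * half ^+ (D * k * (m + n)).
  by rewrite tol_half_pow exprMn -!exprM.
have key : 2 ^+ (D * k * m.-1) * tol k ^+ (m + n) <= decay k.
  rewrite tE mulrA -exprD.
  have -> : (D * k * (m + n) = (D * k * m.-1 + k * (m + n)) + (D * n + 4) * k)%N.
    have [m' mE] : exists m', m = m'.+1 by exists m.-1; rewrite prednK.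
    by rewrite /depth mE/=; nia.
  by rewrite [half ^+ _]exprD mulrA pow2_half mul1r.
have -> : m%:R * ((2 * b ^ k).+1 ^ m.-1)%:R * (cc * tol k ^+ (m + n)) =
   m%:R * cc * (((2 * b ^ k).+1 ^ m.-1)%:R * tol k ^+ (m + n)) by ring.
have -> : m%:R * 3 ^+ m * cc * decay k = m%:R * cc * (3 ^+ m * decay k) by ring.
apply: ler_wpM2l; first exact: mulr_ge0.
apply: le_trans (ler_wpM2r _ net) _; first by rewrite exprn_ge0// ltW// tol_gt0.
by rewrite -mulrA; apply: ler_wpM2l => //; exact: exprn_ge0.
Qed.

(** The factor [2 ^+ (D * n + 4)] is the ratio of consecutive values of [decay]. It is due to
    roughness being tested one level up, and it raises the bound above 1 on levels 0 and 1, where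
    every cell is bad. *)
Definition bad_const : R := 2 ^+ (D * n + 4) * (1 + rough_const) + degenerate_const + steep_const.

Lemma decayS k : decay k = 2 ^+ (D * n + 4) * decay k.+1.
Proof. by rewrite /decay mulnS [X in _ = _ * X]exprD mulrA pow2_half mul1r. Qed.

Let RC0 : 0 <= rough_const.
Proof.
rewrite mulr_ge0// mulr_ge0// exprn_ge0// mulr_ge0// mulr_ge0 ?sqr_ge0//.
by rewrite addr_ge0.
Qed.

Let DC0 : 0 <= degenerate_const.
Proof.
rewrite mulr_ge0 ?mulr_ge0 ?exprn_ge0// divr_ge0 ?sqrtr_ge0// mulr_ge0 ?expR_ge0//.
by rewrite ltW// degenerate_tol_gt0.
Qed.

Let SC0 : 0 <= steep_const. Proof. by rewrite mulr_ge0. Qed.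

Lemma bad_const_gt0 : 0 < bad_const.
Proof.
rewrite /bad_const ltr_wpDr// ltr_wpDr// mulr_gt0 ?exprn_gt0// ltr_wpDr//.
Qed.

Lemma bad_small c k t : unit_box c `<=` U ->
  small_event [set w | bad D c k t (F w)] (bad_const * decay k).
Proof.
move=> cU'; have Uy : U (gridpt D c k t) by apply: cU'; exact: gridpt_box.
have -> : [set w | bad D c k t (F w)] = [set w | (((k <= 1)%N /\ setT w) \/ rough D c k.-1 (F w)) \/
    degenerate D k (gridpt D c k t) (F w) \/ steep (gridpt D c k t) k (F w)].
  apply/seteqP; split => w.
    by move=> [h|h|h|h]; [left; left|left; right|right; left|right; right].
  by move=> [[[h _]|h]|[h|h]]; [constructor 1|constructor 2|constructor 3|constructor 4].
have -> : bad_const * decay k = (2 ^+ (D * n + 4) * decay k + rough_const * (2 ^+ (D * n + 4) * decay k)) +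
   (degenerate_const * decay k + steep_const * decay k) by rewrite /bad_const; ring.
apply: small_event_or; apply: small_event_or.
- apply: small_event_cond => [|k1'].
    by rewrite mulr_ge0 ?exprn_ge0// decay_ge0.
  split => //; apply: le_trans (probability_le1 _ _) _ => //; rewrite lee_fin.
  case: k k1' {t Uy} => [|[|//]] _; last by rewrite -decayS /decay muln0 expr0.
  by rewrite /decay muln0 mulr1 exprn_ege1// ler1n.
- apply: small_event_le (rough_small c k.-1 cU') _; apply: ler_wpM2l => //.
  case: k {t Uy} => [|k] /=; last by rewrite -decayS.
  by rewrite ler_peMl ?decay_ge0// exprn_ege1// ler1n.
- exact: degenerate_small.
- exact: steep_small.
Qed.

End BadProbability.

(** * Summation over the levels *)

Section PowerSum.
Context {R : realType}.
Variables (e : R) (N : nat).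
Hypothesis N0 : (0 < N)%N.
Hypothesis eN : e = N%:R^-1.

Let e0 : 0 <= e. Proof. by rewrite eN invr_ge0. Qed.
Let e1 : e <= 1. Proof. by rewrite eN invf_le1 ?ltr0n// ler1n. Qed.

Lemma pow2_root k : (2 ^+ (N * k)) `^ e = 2 ^+ k :> R.
Proof.
rewrite -powR_mulrn// -powRrM natrM mulrAC eN mulfV ?mul1r; last by rewrite pnatr_eq0 -lt0n.
by rewrite powR_mulrn.
Qed.

Lemma sum_half_le (K : nat) : \sum_(k < K) (2^-1 : R) ^+ k.+1 <= 1.
Proof.
suff -> : \sum_(k < K) (2^-1 : R) ^+ k.+1 = 1 - 2^-1 ^+ K by rewrite gerBl exprn_ge0.
elim: K => [|K IH]; first by rewrite big_ord0 expr0 subrr.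
by rewrite big_ord_recr/= IH exprS; field.
Qed.

(* The largest of the [2 ^ k.+1 * X k] dominates the sum of the [X k]; the
   growth bound then trades the exponent [1 + e] for a factor [2 ^ k]. *)
Lemma power_sum_le (X : nat -> R) (A : R) (K : nat) : 0 <= A -> (forall k, 0 <= X k) ->
  (forall k, X k <= A * 2 ^+ (N * k)) ->
  (\sum_(k < K) X k) `^ (1 + e) <= \sum_(k < K) 4 * A `^ e * 8 ^+ k * X k.
Proof.
move=> A0 X0 XA.
have term0 k : 0 <= 4 * A `^ e * 8 ^+ k * X k.
  by rewrite !mulr_ge0 ?powR_ge0// exprn_ge0.
have S0 : 0 <= \sum_(k < K) X k by exact: sumr_ge0.
have ee : 1 + e != 0 by rewrite gt_eqF// ltr_wpDr.
move: S0; rewrite le_eqVlt => /orP[/eqP <-|S0].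
  by rewrite powR0// sumr_ge0.
have [k Hk] : exists k : 'I_K, \sum_(k < K) X k <= 2 ^+ k.+1 * X k.
  apply: contrapT => H.
  have lt (k : 'I_K) : X k < 2^-1 ^+ k.+1 * \sum_(k < K) X k.
    rewrite exprVn -ltr_pdivrMl ?invr_gt0 ?exprn_gt0// invrK ltNge.
    by apply/negP => h; apply: H; exists k.
  have : \sum_(k < K) X k < \sum_(k < K) 2^-1 ^+ k.+1 * \sum_(k < K) X k.
    have [K0|K0] := posnP K; first by move: S0; rewrite K0 !big_ord0.
    rewrite [X in X < _](bigD1 (Ordinal K0))// [X in _ < X](bigD1 (Ordinal K0))//=.
    by apply: ltr_leD => //; [exact: (lt (Ordinal K0))|apply: ler_sum => k _; exact/ltW/lt].
  rewrite -mulr_suml => h; have := sum_half_le K => h'.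
  by have := lt_le_trans h (ler_wpM2r (ltW S0) h'); rewrite mul1r ltxx.
apply: (@le_trans _ _ (4 * A `^ e * 8 ^+ k * X k)); last first.
  by rewrite (bigD1 k)//= lerDl sumr_ge0.
have p0 : 0 <= (2 : R) ^+ k.+1 by exact: exprn_ge0.
apply: (@le_trans _ _ ((2 ^+ k.+1 * X k) `^ (1 + e))).
  by apply: ge0_ler_powR; rewrite ?nnegrE ?addr_ge0 ?(ltW S0) ?mulr_ge0.
rewrite powRM// [X k `^ _]powRD ?(negbTE ee)// powRr1//.
(* As [e <= 1], this factor costs at most [4 * 4 ^+ k]; the growth bound on [X k] contributes
   another [2 ^+ k]. *)
have h1 : (2 ^+ k.+1) `^ (1 + e) <= 4 * 4 ^+ k :> R.
  apply: (@le_trans _ _ ((2 ^+ k.+1 : R) `^ 2%:R)).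
    by apply: ler_powR; [rewrite exprn_ege1// ler1n|move: e1; lra].
  rewrite powR_mulrn// -exprM mulnC exprM -exprS le_eqVlt; apply/orP; left; apply/eqP.
  by congr (_ ^+ _); ring.
have h2 : X k `^ e <= A `^ e * 2 ^+ k.
  rewrite -pow2_root -powRM ?exprn_ge0//.
  by apply: ge0_ler_powR; rewrite ?nnegrE ?mulr_ge0 ?exprn_ge0.
have -> : 4 * A `^ e * 8 ^+ k * X k = 4 * 4 ^+ k * (X k * (A `^ e * 2 ^+ k)).
  have -> : (8 : R) = 4 * 2 by ring.
  by rewrite exprMn; ring.
apply: ler_pM; rewrite ?powR_ge0 ?mulr_ge0 ?powR_ge0//.
exact: ler_wpM2l.
Qed.

End PowerSum.

(** * Moments of the number of components *)

Section CountBound.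
Context {R : realType} {n m : nat} {d : measure_display} {T : measurableType d}.
Variables (P : probability T R) (F : T -> 'rV[R]_n -> 'rV[R]_m) (r : R).
Local Notation U := (cube (n := n) (r + 1)).
Local Notation D := (@depth n m).
Hypothesis n0 : (0 < n)%N.
Hypothesis m0 : (0 < m)%N.
Hypothesis r1 : 1 < r.
Hypothesis smF : forall w i s, (size s <= 2)%N -> pds_ok U s (fc F i w).
Hypothesis ctF : forall w i s, (size s <= 2)%N -> forall x, U x -> {for x, continuous (pds s (fc F i w))}.
Variable C : R.
Hypothesis C0 : 0 <= C.
Hypothesis badF : forall c k t, unit_box c `<=` U ->
  small_event P [set w | bad D c k t (F w)] (C * @decay R n m k).

(** Chosen so that [(b^(kn))^e = 2^k]. The resulting weight [8^k] still loses against the decay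
    [16^-k] of the means. *)
Definition moment_excess : R := (D * n)%N%:R^-1.
Local Notation e := moment_excess.

Let D4 : (4 <= D)%N. Proof. by rewrite /depth; lia. Qed.
Let Dn0 : (0 < D * n)%N. Proof. by rewrite muln_gt0 n0 (leq_trans _ D4). Qed.

Let A : R := (nbox r ^ n)%N%:R.
Let A0 : 0 < A. Proof. by rewrite ltr0n expn_gt0. Qed.
Let X k w : R := (nbad D r k (F w))%:R.

Let XA k w : X k w <= A * 2 ^+ (D * n * k).
Proof.
rewrite /X /A -natrX -natrM ler_nat; apply: leq_trans (nbad_le D r k (F w)) _.
by rewrite leq_mul2l /base -expnM; apply/orP; right; rewrite leq_exp2l//; lia.
Qed.

Let E k (p : {ffun 'I_n -> 'I_(nbox r)} * {ffun 'I_n -> 'I_(base D ^ k)}) : set T :=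
  [set w | bad D (corner r p.1) k p.2 (F w)].

Let smE k p : small_event P (E k p) (C * @decay R n m k).
Proof. by apply: badF; exact: corner_box. Qed.

Let X_sum k w : X k w = \sum_p \1_(E k p) w.
Proof.
rewrite /X /nbad -sum1_card natr_sum big_mkcond; apply: eq_bigr => p _.
rewrite -[p \in _]/(`[< `[< E k p w >] >]) asboolb indicE.
have [b|nb] := pselect (E k p w); first by rewrite mem_set// asboolT.
by rewrite memNset// asboolF.
Qed.

Let mX k : measurable_fun setT (X k).
Proof.
rewrite (_ : X k = fun w => \sum_p \1_(E k p) w); last by apply/funext => w; exact: X_sum.
by apply: measurable_sum => p; apply: measurable_indic; have [] := smE k p.
Qed.

Let X0 k w : 0 <= X k w. Proof. exact: ler0n. Qed.

(** There are [A * b^(kn)] cells, and [decay] cancels [b^(kn)]. *)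
Lemma mean_nbad k : (\int[P]_w (X k w)%:E <= (A * C * (16 ^+ k)^-1)%:E)%E.
Proof.
under eq_integral do rewrite X_sum -sumEFin.
rewrite ge0_integral_sum//; last first.
  by move=> p; apply/measurable_EFinP; apply: measurable_indic; have [] := smE k p.
apply: (@le_trans _ _ (\sum_(p : {ffun 'I_n -> 'I_(nbox r)} * {ffun 'I_n -> 'I_(base D ^ k)})
    (C * @decay R n m k)%:E)%E).
  apply: lee_sum => p _; have [mE PE] := smE k p.
  by rewrite integral_indic// setIT.
rewrite sumEFin lee_fin sumr_const card_prod !card_ffun !card_ord -[leLHS]mulr_natl natrM -/A.
rewrite -!mulrA; apply: ler_wpM2l; first exact: ltW.
rewrite mulrCA; apply: ler_wpM2l => //.
have -> : ((base D ^ k) ^ n)%N%:R = 2 ^+ (D * n * k) :> R.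
  by rewrite /base -!expnM natrX; congr (_ ^+ _); lia.
rewrite /decay mulnDl exprD mulrA -exprMn mulfV// expr1n mul1r exprM exprVn.
have -> : (2 : R) ^+ 4 = 16 by ring.
by rewrite exprVn.
Qed.

(** The estimates run through this function because it is visibly measurable, while [Ncomp] is a
    supremum over families of components. *)
Definition majorant (w : T) : \bar R := \sum_(0 <= k <oo) (4 * A `^ e * 8 ^+ k * X k w)%:E.

Let Z k w : R := 4 * A `^ e * 8 ^+ k * X k w.
Let c : R := 4 * A `^ e.
Let c0 : 0 < c. Proof. by rewrite mulr_gt0// powR_gt0. Qed.
Let Z0 k w : (0 <= (Z k w)%:E)%E.
Proof. by rewrite lee_fin mulr_ge0// mulr_ge0 ?(ltW c0)// exprn_ge0. Qed.
Let mZ k : measurable_fun setT (fun w => (Z k w)%:E).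
Proof. by apply/measurable_EFinP; exact: measurable_funM. Qed.

Lemma measurable_majorant : measurable_fun setT majorant.
Proof.
apply: (@ge0_emeasurable_sum _ _ _ setT (fun k w => (Z k w)%:E) xpredT) => [k w _ _|k _].
  exact: Z0.
exact: mZ.
Qed.

Lemma majorant_ge0 w : (0 <= majorant w)%E.
Proof. by apply: nneseries_ge0 => k _ _; exact: Z0. Qed.

Lemma majorant_integral : (\int[P]_w majorant w <= (8 * C * A `^ (1 + e))%:E)%E.
Proof.
rewrite /majorant integral_nneseries//; last by move=> k w _; exact: Z0.
have ZI k : (\int[P]_w (Z k w)%:E <= (c * A * C * 2^-1 ^+ k)%:E)%E.
  under eq_integral do rewrite /Z EFinM.
  rewrite ge0_integralZl//; last 3 first.
  - exact/measurable_EFinP.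
  - by move=> w _; rewrite lee_fin.
  - by rewrite lee_fin mulr_ge0 ?(ltW c0)// exprn_ge0.
  apply: le_trans (lee_wpmul2l _ (mean_nbad k)) _.
    by rewrite lee_fin mulr_ge0 ?(ltW c0)// exprn_ge0.
  rewrite -EFinM lee_fin le_eqVlt; apply/orP; left; apply/eqP.
  have -> : (16 : R) = 8 * 2 by ring.
  by rewrite exprMn exprVn /c; field; rewrite !expf_neq0.
apply: lime_le.
  by apply: is_cvg_nneseries => k _ _; apply: integral_ge0 => w _; exact: Z0.
apply: nearW => K.
apply: (@le_trans _ _ (\sum_(0 <= k < K) (c * A * C * 2^-1 ^+ k)%:E)%E).
  by apply: lee_sum => k _; exact: ZI.
rewrite sumEFin lee_fin big_mkord -mulr_sumr.
have H : \sum_(k < K) (2^-1 : R) ^+ k <= 2.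
  have -> : \sum_(k < K) (2^-1 : R) ^+ k = 2 * \sum_(k < K) (2^-1 : R) ^+ k.+1.
    by rewrite mulr_sumr; apply: eq_bigr => k _; rewrite exprS mulrA mulfV// mul1r.
  by rewrite -[leRHS]mulr1 ler_wpM2l// sum_half_le.
have cAC : 0 <= c * A * C by rewrite mulr_ge0// mulr_ge0 ?(ltW c0) ?(ltW A0).
apply: le_trans (ler_wpM2l cAC H) _.
have e1 : 1 + e != 0 by rewrite gt_eqF// ltr_wpDr// invr_ge0.
rewrite powRD ?(negbTE e1)// powRr1 ?(ltW A0)// /c.
by rewrite le_eqVlt; apply/orP; left; apply/eqP; ring.
Qed.

Let smooth w : smooth_on U (F w).
Proof.
move=> i j x Ux; split.
  by have [_ H] := smF w i [:: j] isT; exact: H.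
exact: (ctF w i [:: j] isT x Ux).
Qed.

(** Each level with a bad cell contributes at least the fixed amount [4 * A^e]. *)
Lemma majorant_infinite w : (forall K, exists2 k, (K <= k)%N & (0 < nbad D r k (F w))%N) ->
  majorant w = +oo%E.
Proof.
move=> H; have part K : (\sum_(0 <= k < K) (Z k w)%:E <= majorant w)%E.
  by apply: nneseries_lim_ge => k _ _; exact: Z0.
have step N : exists K, ((N%:R * c)%:E <= \sum_(0 <= k < K) (Z k w)%:E)%E.
  elim: N => [|N [K HK]].
    by exists 0%N; rewrite big_nil mul0r.
  have [k Kk bk] := H K; exists k.+1.
  rewrite big_nat_recr//= -natr1 mulrDl mul1r EFinD; apply: leeD.
    apply: le_trans HK _; rewrite (big_cat_nat (leq0n K) Kk)//=.
    by rewrite leeDl// sume_ge0.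
  rewrite lee_fin /Z -/c -mulrA ler_peMr ?(ltW c0)//.
  by rewrite mulr_ege1 ?exprn_ege1 ?ler1n.
apply/eqyP => y y0.
have [K HK] := step (Num.truncn (y / c)).+1.
apply: le_trans (part K); apply: le_trans HK; rewrite lee_fin.
rewrite -ler_pdivrMr//; apply/ltW.
by have /andP[] := truncn_itv (divr_ge0 (ltW y0) (ltW c0)).
Qed.

(** Every finite number [N] of components satisfies the bound. To reach the supremum, the root of
    order [1 + e] of a finite majorant is used as an upper bound. *)
Lemma Ncomp_power_le w : (poweR (Ncomp F r w) (1 + e) <= majorant w)%E.
Proof.
have e0 : 0 <= e by rewrite invr_ge0.
have q0 : 0 < 1 + e by rewrite ltr_wpDr.
have HN N : (exists c : 'I_N -> set 'rV[R]_n, injective c /\ forall j, inner_components F r w (c j)) ->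
    ((N%:R `^ (1 + e))%:E <= majorant w)%E.
  move=> [cc [cinj Hc]].
  have [Hinf|[K HK]] := components_le_nbad D D4 m0 n0 r r1 (F w) _ N cc (smooth w) erefl cinj Hc.
    by rewrite majorant_infinite// leey.
  apply: (@le_trans _ _ (\sum_(0 <= k < K) (Z k w)%:E)%E); last first.
    by apply: nneseries_lim_ge => k _ _; exact: Z0.
  rewrite sumEFin lee_fin big_mkord.
  apply: (@le_trans _ _ ((\sum_(k < K) X k w) `^ (1 + e))).
    apply: ge0_ler_powR; rewrite ?nnegrE ?(ltW q0)//; first exact: sumr_ge0.
    by rewrite /X -natr_sum ler_nat.
  exact: (power_sum_le e (D * n) Dn0 erefl (fun k => X k w) A K (ltW A0) (X0^~ w) (XA^~ w)).
have := majorant_ge0 w; case EM : (majorant w) => [y| |]; last by [].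
  rewrite lee_fin => y0.
  have Nle : (Ncomp F r w <= (y `^ (1 + e)^-1)%:E)%E.
    apply: ge_ereal_sup => _ [N HcN <-]; have := HN N HcN; rewrite EM !lee_fin => h.
    have -> : N%:R = (N%:R `^ (1 + e)) `^ (1 + e)^-1 :> R.
      by rewrite -powRrM mulfV ?gt_eqF// powRr1.
    by apply: ge0_ler_powR; rewrite ?nnegrE ?powR_ge0 ?invr_ge0 ?(ltW q0).
  have N0 : (0 <= Ncomp F r w)%E.
    apply: ereal_sup_ubound; exists 0%N => //.
    by exists (fun=> set0); split=> [[]|[]].
  have -> : y%:E = poweR (y `^ (1 + e)^-1)%:E (1 + e).
    by rewrite poweR_EFin -powRrM mulVf ?gt_eqF// powRr1.
  apply: gt0_ler_poweR => //; first exact: ltW.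
  - by rewrite in_itv/= N0 leey.
  - by rewrite in_itv/= lee_fin powR_ge0 leey.
by move=> _; rewrite leey.
Qed.

(** For [r > 1] the number of boxes per axis is at most [4 r + 1 <= 5 r = (5/2) (2 r)], which turns
    their number into a multiple of the volume. *)
Lemma majorant_bound : (\int[P]_w majorant w <=
  (8 * C * ((5 / 2) ^+ n) `^ (1 + e) * ((r *+ 2) ^+ n) `^ (1 + e))%:E)%E.
Proof.
apply: le_trans majorant_integral _; rewrite lee_fin -!mulrA; apply: ler_wpM2l => //.
apply: ler_wpM2l => //.
have e0 : 0 <= e by rewrite invr_ge0.
have r0 : 0 <= r by apply: ltW; apply: lt_trans r1.
rewrite -powRM; [|by rewrite exprn_ge0// divr_ge0|by rewrite exprn_ge0// mulrn_wge0].
apply: ge0_ler_powR; rewrite ?nnegrE ?addr_ge0 ?(ltW A0) ?mulr_ge0 ?exprn_ge0 ?mulrn_wge0 ?divr_ge0//.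
rewrite -exprMn /A natrX; apply: lerXn2r; rewrite ?nnegrE ?mulr_ge0 ?divr_ge0 ?mulrn_wge0//.
rewrite /nbox -natr1.
have : (Num.truncn (4 * r))%:R <= 4 * r by rewrite truncn_le mulr_ge0.
rewrite -[r *+ 2]mulr_natr; move: r1; lra.
Qed.

End CountBound.

(** * Changing the field on a null set *)

Section NullModification.
Context {R : realType} {d : measure_display} {T : measurableType d}.
Variables (P : probability T R) (N : set T).
Hypothesis mN : measurable N.
Hypothesis PN : P N = 0%E.

Lemma le_integral_off_null (f g : T -> \bar R) : (forall w, 0 <= f w)%E ->
  (forall w, 0 <= g w)%E -> measurable_fun setT g ->
  (forall w, ~ N w -> (f w <= g w)%E) -> (\int[P]_w f w <= \int[P]_w g w)%E.
Proof.
move=> f0 g0 mg fg.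
pose h w : \bar R := if w \in N then +oo%E else g w.
have hN w : N w -> h w = +oo%E by move=> Nw; rewrite /h mem_set.
have hg w : ~ N w -> h w = g w by move=> Nw; rewrite /h memNset.
have mh : measurable_fun setT h.
  by apply: measurable_fun_ifT => //; apply: (measurable_fun_bool true); rewrite setTI preimage_mem_true.
have h0 w : (0 <= h w)%E.
  by have [/hN ->|/hg ->] := pselect (N w); rewrite ?leey.
have -> : (\int[P]_w g w = \int[P]_w h w)%E.
  apply: ge0_ae_eq_integral => //; exists N; split => // w /= H.
  by apply: contrapT => Nw; apply: H => _; rewrite hg.
rewrite !ge0_integralTE//; apply: ge_ereal_sup => _ [u /= uf <-].
apply: ereal_sup_ubound; exists u => // w; apply: le_trans (uf w) _.
by have [/hN ->|Nw] := pselect (N w); rewrite ?leey// hg//; exact: fg.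
Qed.

Lemma gaussian_rv_off_null (X X' : T -> R) : measurable_fun setT X' ->
  (forall w, ~ N w -> X w = X' w) -> gaussian_rv P X -> gaussian_rv P X'.
Proof.
move=> mX' XX' [mX [a [s H]]]; split => //; exists a, s => A mA; rewrite -H//.
have PD (B : set T) : measurable B -> P B = P (B `\` N).
  move=> mB; rewrite (measureDI P mB mN) [X in (_ + X)%E](_ : _ = 0%E) ?adde0//.
  apply/eqP; rewrite eq_le measure_ge0 andbT -PN; apply: le_measure.
  - by rewrite inE; exact: measurableI.
  - by rewrite inE.
  - exact: subIsetr.
have mB (Y : T -> R) : measurable_fun setT Y -> measurable (Y @^-1` A).
  by move=> mY; rewrite -[_ @^-1` _]setTI; exact: mY.
rewrite (PD _ (mB _ mX')) (PD _ (mB _ mX)).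
by congr (P _); apply/seteqP; split => w [/= Aw Nw]; split => //; [rewrite XX'|rewrite -XX'].
Qed.

Lemma Ex_off_null (X X' : T -> R) : measurable_fun setT X -> measurable_fun setT X' ->
  (forall w, ~ N w -> X w = X' w) -> Ex P X = Ex P X'.
Proof.
move=> mX mX' XX'; rewrite /Ex; congr fine; apply: ae_eq_integral => //; [exact/measurable_EFinP..|].
exists N; split => // w /= H.
by apply: contrapT => Nw; apply: H => _; rewrite XX'.
Qed.

End NullModification.

Lemma pds_cst0 {R : realType} {n : nat} (s : seq 'I_n) :
  pds s (fun=> 0 : R^o) = (fun=> 0 : R^o).
Proof.
elim: s => [|j s IH]//=; rewrite IH; apply/funext => x; rewrite /pd.
exact: derive_cst.
Qed.

Lemma pds_ok_cst0 {R : realType} {n : nat} (U : set 'rV[R]_n) (s : seq 'I_n) :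
  pds_ok U s (fun=> 0 : R^o).
Proof.
elim: s => [|j s IH]//=; split => // x _; rewrite pds_cst0.
exact: derivable_cst.
Qed.

(** * From the assumptions to the moment bound *)

Section Moments.
Context {R : realType} {n m : nat} {d : measure_display} {T : measurableType d}.
Variables (P : probability T R) (F : T -> 'rV[R]_n -> 'rV[R]_m) (r M k1 k2 : R).
Local Notation U := (cube (n := n) (r + 1)).
Hypothesis n0 : (0 < n)%N.
Hypothesis m0 : (0 < m)%N.
Hypothesis r1 : 1 < r.
Hypothesis k10 : 0 < k1.
Hypothesis HF : assumptions P F r M k1 k2.

Lemma Ncomp_moment :
  (\int[P]_w poweR (Ncomp F r w) (1 + @moment_excess R n m) <=
   (8 * @bad_const R n m (Num.max M 0) k1 * ((5 / 2) ^+ n) `^ (1 + @moment_excess R n m) *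
    ((r *+ 2) ^+ n) `^ (1 + @moment_excess R n m))%:E)%E.
Proof.
have [GF [_ [[F0 A1] [[[N [mN PN HN]] A2] _]]]] := HF.
have smooth w : ~ N w -> forall i, C3minus U (fc F i w).
  by move=> Nw; apply: contrapT => H; apply: Nw; exact: HN.
(* Redefining [F] on a null set makes smoothness hold for every [w]. *)
pose F' w : 'rV[R]_n -> 'rV[R]_m := if w \in N then (fun=> 0) else F w.
have F'N w : N w -> F' w = fun=> 0 by move=> Nw; rewrite /F' mem_set.
have F'E w : ~ N w -> F' w = F w by move=> Nw; rewrite /F' memNset.
have fcN w i : N w -> fc F' i w = fun=> 0.
  by move=> Nw; apply/funext => x; rewrite /fc F'N// mxE.
have fcE w i : ~ N w -> fc F' i w = fc F i w.
  by move=> Nw; apply/funext => x; rewrite /fc F'E.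
have Uo x : U x -> nbhs x U by exact: cube_nbhs.
have cU : box_convex U := cube_box_convex (r + 1).
have GF' : gaussian_field P F' U.
  move=> k c idx pts Up; apply: (gaussian_rv_off_null P N mN PN _ _ _ _ (GF k c idx pts Up)).
    have [mX _] := GF k c idx pts Up.
    have -> : (fun w => \sum_j c j * F' w (pts j) ord0 (idx j)) =
      (fun w => if w \in N then 0 else \sum_j c j * F w (pts j) ord0 (idx j)).
      apply/funext => w; rewrite /F'; case: ifP => // _.
      by rewrite big1// => j _; rewrite mxE mulr0.
    by apply: measurable_fun_ifT => //; apply: (measurable_fun_bool true); rewrite setTI preimage_mem_true.
  by move=> w Nw; rewrite F'E.
have mF i x : U x -> measurable_fun setT (fun w => fc F i w x).
  by move=> Ux; have [] := field_span_gaussian P F U GF _ (field_span_val F U i x Ux).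
have mF' i x : U x -> measurable_fun setT (fun w => fc F' i w x).
  by move=> Ux; have [] := field_span_gaussian P F' U GF' _ (field_span_val F' U i x Ux).
have F0' i x : U x -> Ex P (fun w => fc F' i w x) = 0.
  move=> Ux; rewrite -(F0 i x Ux); apply: (Ex_off_null P N mN PN); [exact: mF'|exact: mF|].
  by move=> w Nw; rewrite fcE.
have smF' w i s : (size s <= 2)%N -> pds_ok U s (fc F' i w).
  move=> s2; have [Nw|Nw] := pselect (N w); first by rewrite fcN//; exact: pds_ok_cst0.
  by rewrite fcE//; have [/(_ s s2)[]] := smooth w Nw i.
have ctF' w i s : (size s <= 2)%N -> forall x, U x -> {for x, continuous (pds s (fc F' i w))}.
  move=> s2 x Ux; have [Nw|Nw] := pselect (N w).
    by rewrite fcN// pds_cst0; exact: cst_continuous.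
  by rewrite fcE//; have [/(_ s s2)[_ H] _] := smooth w Nw i; exact: H.
have cov i y z : U y -> U z -> cov_kernel P F i i y z = cov_kernel P F' i i y z.
  move=> Uy Uz; apply: (Ex_off_null P N mN PN); [by apply: measurable_funM; exact: mF|
    by apply: measurable_funM; exact: mF'|].
  by move=> w Nw; rewrite fcE.
(* On the diagonal the covariance derivatives are the variances of the derivatives of the field. The
   sign of [M] is free, hence the maximum with 0. *)
have HM i s : multi_index s -> (size s <= 2)%N -> forall x, U x ->
    nrm2 P (fun w => pds s (fc F' i w) x) <= Num.max M 0.
  move=> ms s2 x Ux.
  rewrite -(DxDyK_nrm2 P F' U GF' F0' Uo smF' F s i x (cov i) s2 Ux).
  have [_ [_ H]] := A2 i i s ms (leq_trans s2 (leqnSn 2)).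
  by apply: le_trans (ler_norm _) _; apply: le_trans (H x Ux) _; rewrite le_max lexx.
have M0 : 0 <= Num.max M 0 by rewrite le_max lexx orbT.
pose L (F : T -> 'rV[R]_n -> 'rV[R]_m) x eta xi w : R :=
  \sum_i eta i * fc F i w x + \sum_i \sum_j xi i j * pd j (fc F i w) x.
have GS := field_span_space P F' U GF' F0'.
have hL x eta xi : U x -> L2 P (L F' x eta xi).
  move=> Ux; apply: hull_L2; apply: (hull_add P _ GS).
    apply: (hull_sum P _ GS); first by rewrite card_ord.
    move=> i; apply: (hull_scale P _ GS).
    exact: (pds_hull P F' U GF' F0' Uo smF' [::]).
  apply: (hull_sum P _ GS); first by rewrite card_ord.
  move=> i; apply: (hull_sum P _ GS); first by rewrite card_ord.
  move=> j; apply: (hull_scale P _ GS).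
  exact: (pds_hull P F' U GF' F0' Uo smF' [:: j]).
have A1u x eta xi : U x -> \sum_i eta i ^+ 2 + \sum_i \sum_j xi i j ^+ 2 = 1 ->
    k1 <= nrm2 P (L F' x eta xi).
  move=> Ux u1; have LL := hL x eta xi Ux.
  rewrite -lee_fin /nrm2 -(Ex_EFin P); last exact: L2_sq.
  apply: le_trans (A1 x Ux eta xi u1) _; apply: (le_integral_off_null P N mN PN).
  - by move=> w; rewrite lee_fin sqr_ge0.
  - by move=> w; rewrite lee_fin sqr_ge0.
  - by apply/measurable_EFinP; apply: measurable_funX; exact: (L2_meas P _ LL).
  - move=> w Nw; rewrite /L lee_fin le_eqVlt; apply/orP; left; apply/eqP.
    congr ((_ + _) ^+ 2).
      by apply: eq_bigr => i _; rewrite fcE.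
    by apply: eq_bigr => i _; apply: eq_bigr => j _; rewrite fcE.
(* The assumption concerns unit vectors; homogeneity of degree two extends it, the zero vector being
   separate. *)
have HA1 x : U x -> forall eta xi, k1 * (\sum_i eta i ^+ 2 + \sum_i \sum_j xi i j ^+ 2) <=
    nrm2 P (L F' x eta xi).
  move=> Ux eta xi; set s := _ + _.
  have s0 : 0 <= s.
    rewrite addr_ge0//; apply: sumr_ge0 => i _; rewrite ?sqr_ge0//.
    by apply: sumr_ge0 => j _; rewrite sqr_ge0.
  have [->|sn0] := eqVneq s 0; first by rewrite mulr0; exact: nrm2_ge0.
  have sp : 0 < s by rewrite lt_def sn0.
  pose t := (Num.sqrt s)^-1.
  have t2 : t ^+ 2 = s^-1 by rewrite /t exprVn sqr_sqrtr.
  have := A1u x (fun i => t * eta i) (fun i j => t * xi i j) Ux.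
  have -> : L F' x (fun i => t * eta i) (fun i j => t * xi i j) = (fun w => t * L F' x eta xi w).
    apply/funext => w; rewrite /L mulrDr !mulr_sumr; congr (_ + _); apply: eq_bigr => i _.
      by rewrite mulrA.
    by rewrite mulr_sumr; apply: eq_bigr => j _; rewrite mulrA.
  rewrite (nrm2_scale P _ _ (hL x eta xi Ux)) t2 mulrC => H.
  rewrite -ler_pdivlMr//; apply: H.
  have -> : \sum_i (t * eta i) ^+ 2 + \sum_i \sum_j (t * xi i j) ^+ 2 = t ^+ 2 * s.
    rewrite /s mulrDr !mulr_sumr; congr (_ + _); apply: eq_bigr => i _; first by rewrite exprMn.
    by rewrite mulr_sumr; apply: eq_bigr => j _; rewrite exprMn.
  by rewrite t2 mulVf.
have C0 := ltW (bad_const_gt0 (n := n) (m := m) _ M0 k1 n0).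
have bad' := bad_small P F' U GF' F0' Uo smF' _ cU HM M0 k1 k10 HA1 n0 m0.
apply: le_trans (majorant_bound P F' r n0 m0 r1 _ C0 bad').
apply: (le_integral_off_null P N mN PN).
- by move=> w; exact: poweR_ge0.
- by move=> w; exact: majorant_ge0.
- exact: (measurable_majorant P F' r _ _ bad').
- move=> w Nw; have -> : Ncomp F r w = Ncomp F' r w.
    by rewrite /Ncomp /inner_components /zero_set F'E.
  exact: Ncomp_power_le.
Qed.

End Moments.

Theorem theorem4p4 (R : realType) (n m : nat) :
  (m < n)%N -> (1 <= m)%N ->
  exists2 q : R, 1 < q &
  forall M k1 k2 : R, 0 < k1 ->
  exists2 D2 : R, 0 < D2 &
  forall (r : R), 1 < r ->
  forall (d : measure_display) (T : measurableType d) (P : probability T R)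
         (F : T -> 'rV[R]_n -> 'rV[R]_m),
    assumptions P F r M k1 k2 ->
    (\int[P]_w poweR (Ncomp F r w) q <= (D2 * powR ((r *+ 2) ^+ n) q)%:E)%E.
Proof.
move=> mn m0; have n0 : (0 < n)%N := leq_ltn_trans (leq0n m) mn.
exists (1 + @moment_excess R n m).
  by rewrite ltrDl invr_gt0 ltr0n muln_gt0 n0 andbT /depth; lia.
move=> M k1 k2 k10.
(* The factor 8 is the 4 of [power_sum_le] times the sum of the geometric series; [5/2] compares the
   number of unit boxes per axis with the side of the cube. *)
exists (8 * @bad_const R n m (Num.max M 0) k1 * ((5 / 2) ^+ n) `^ (1 + @moment_excess R n m)).
  rewrite mulr_gt0 ?powR_gt0 ?exprn_gt0 ?divr_gt0// mulr_gt0//.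
  by apply: bad_const_gt0 => //; rewrite le_max lexx orbT.
by move=> r r1 d T P F HF; exact: (Ncomp_moment P F r M k1 k2 n0 m0 r1 k10 HF).
Qed.
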